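(* Let $F=(f_1,\dots,f_n)$ be a system of $n$ Laurent polynomials in $n$ variables, and let $S=\operatorname{supp}(f_1)\cup\cdots\cup\operatorname{supp}(f_n)\subset\mathbb{Z}^n$. Assume that $S$ satisfies the standard form conditions and that all irreducible components of the zero set of $F$ in $(\mathbb{C}^* )^n$ are (generically) reduced. Suppose the zero set of $F$ in $(\mathbb{C}^* )^n$ consists of components $C_{d_1},\dots,C_{d_\ell}\neq\varnothing$, where each $C_{d_i}$ is the union of all $d_i$-dimensional irreducible components. For generic choices of the parameters defining the sample sets, let $\jmath(C_{d_i})=|W_{d_i}|$, where $W_{d_i}$ is the rank-$d_i$ sample set. Then $\jmath(C_{d_i})>0$ for each $i=1,\dots,\ell$, and $$\sum_{i=1}^{\ell}\jmath(C_{d_i})\ \le\ n!\,\operatorname{vol}_n(\operatorname{conv}(S)).$$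
   Context: $\mathbb{C}^*=\mathbb{C}\setminus\{0\}$. For $\boldsymbol{x}\in(\mathbb{C}^* )^n$ and an integer matrix $A=[\boldsymbol{a}_1\ \cdots\ \boldsymbol{a}_m]\in M_{n\times m}(\mathbb{Z})$, $\boldsymbol{x}^A=(\boldsymbol{x}^{\boldsymbol{a}_1},\dots,\boldsymbol{x}^{\boldsymbol{a}_m})$, where $\boldsymbol{x}^{\boldsymbol{a}}=x_1^{a_1}\cdots x_n^{a_n}$. The support $\operatorname{supp}(f)$ of a Laurent polynomial $f$ is the set of exponent vectors of its monomials with nonzero coefficients; $\operatorname{conv}$ is the convex hull and $\operatorname{vol}_n$ is $n$-dimensional Euclidean volume. Let $A\in M_{n\times m}(\mathbb{Z})$ be the matrix whose columns are the $m=|S|$ elements of $S$. The standard form conditions are: (1) $m>n+1$; (2) $A$ has a zero column; (3) $A$ has full row rank $n$; (4) all invariant factors of $A$ (the nonzero diagonal entries of its Smith normal form) equal $1$. For a Laurent system $G$, $\mathcal{V}^*(G)$ is its common zero set in $(\mathbb{C}^* )^n$ and $\mathcal{V}^*_0(G)$ is the set of its isolated points ($0$-dimensional irreducible components). A $d$-dimensional irreducible component of $\mathcal{V}^*(F)$ is (generically) reduced if it has multiplicity 1, i.e. at almost all of its points the nullity of the Jacobian matrix $DF$ equals $d$. Sample sets: choose a generic complex $n\times n$ matrix $R$ and replace $F$ by $RF$ ($F$ regarded as a column vector), which has the same zero set in $(\mathbb{C}^* )^n$ and whose $n$ polynomials all have support $S$, so that $RF=(\boldsymbol{c}_1\cdot\boldsymbol{x}^A,\dots,\boldsymbol{c}_n\cdot\boldsymbol{x}^A)$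 with coefficient row vectors $\boldsymbol{c}_i\in(\mathbb{C}^* )^m$. (If the $f_i$ already have identical supports one may take $R=I$.) For generic $\boldsymbol{c}^*_1,\dots,\boldsymbol{c}^*_n\in\mathbb{C}^m$ the rank-$d$ sample set is $W_d=\mathcal{V}^*_0(F^{(d)})$, where $$F^{(d)}(\boldsymbol{x})=\bigl(\boldsymbol{c}_1\cdot\boldsymbol{x}^A,\dots,\boldsymbol{c}_n\cdot\boldsymbol{x}^A,\ \boldsymbol{c}^*_1\cdot\boldsymbol{x}^A,\dots,\boldsymbol{c}^*_d\cdot\boldsymbol{x}^A\bigr).$$ ''Generic'' means for all choices in some nonempty Zariski open subset of the parameter space. *)

(* Defs.v *)
From HB Require Import structures.
From mathcomp Require Import all_boot all_order all_algebra finmap.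
From mathcomp Require Import complex.
From mathcomp Require Import all_classical all_reals all_analysis.
(* Their notations clash with those of MathComp-Analysis. *)
From mathcomp Require Import -(notations) monalg mpoly.

Set Implicit Arguments.
Unset Strict Implicit.
Unset Printing Implicit Defensive.

Import Order.TTheory GRing.Theory Num.Theory.
Local Open Scope classical_set_scope.
Local Open Scope ring_scope.

(* Finitely supported functions on Z^n; this is only the C-module of Laurent
   polynomials: the ring structure of malg is not available, Z^n not being a
   monomType (in which only 1 is invertible). *)
Notation laurent C n := (monalg.malg 'rV[int]_n C).

Section Laurent.
Variables (C : fieldType) (n : nat).
Local Notation laurent := (laurent C n).

Implicit Types (f : laurent) (a : 'rV[int]_n) (x : 'rV[C]_n).

Definition lsupp f : {fset 'rV[int]_n} := monalg.msupp f.

Definition lcoef f a : C := monalg.mcoeff a f.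

(* z * X^a *)
Definition lmonom (z : C) a : laurent := monalg.mkmalgU a z.

Definition xpow x a : C := \prod_(i < n) x 0 i ^ a 0 i.

Definition leval f x : C := \sum_(a <- lsupp f) lcoef f a * xpow x a.

Definition lderiv (j : 'I_n) f : laurent :=
  \sum_(a <- lsupp f) lmonom (lcoef f a * (a 0 j)%:~R) (a - delta_mx 0 j).

Definition ljacobian (r : nat) (F : 'I_r -> laurent) x : 'M[C]_(r, n) :=
  \matrix_(i < r, j < n) leval (lderiv j (F i)) x.

Definition torus : set 'rV[C]_n := [set x | forall i, x 0 i != 0].

Definition zeros (G : set laurent) : set 'rV[C]_n :=
  [set x | torus x /\ forall g, G g -> leval g x = 0].

(* The Zariski topology of the torus. *)
Definition zclosed (Z : set 'rV[C]_n) := exists G : set laurent, Z = zeros G.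

Definition zirreducible (Z : set 'rV[C]_n) :=
  [/\ zclosed Z, Z !=set0 &
      forall Z1 Z2, zclosed Z1 -> zclosed Z2 -> Z `<=` Z1 `|` Z2 ->
        Z `<=` Z1 \/ Z `<=` Z2].

Definition component (V Z : set 'rV[C]_n) :=
  [/\ zirreducible Z, Z `<=` V &
      forall Z', zirreducible Z' -> Z' `<=` V -> Z `<=` Z' -> Z' = Z].

Definition irr_chain (Z : set 'rV[C]_n) (k : nat) :=
  exists T : nat -> set 'rV[C]_n,
    (forall i, (i <= k)%N -> zirreducible (T i) /\ T i `<=` Z) /\
    (forall i, (i < k)%N -> T i `<` T i.+1).

(* Krull dimension *)
Definition has_zdim (Z : set 'rV[C]_n) (d : nat) :=
  irr_chain Z d /\ ~ irr_chain Z d.+1.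

Definition equidim_part (V : set 'rV[C]_n) (d : nat) : set 'rV[C]_n :=
  [set x | exists Z, [/\ component V Z, has_zdim Z d & Z x]].

Definition isolated_zeros (G : set laurent) := equidim_part (zeros G) 0.

(* As Z is irreducible, its nonempty open subset Z `\` Y is dense in it. The
   row kernel of the transpose is the null space of the Jacobian matrix. *)
Definition generically_reduced (r : nat) (F : 'I_r -> laurent)
    (Z : set 'rV[C]_n) (d : nat) :=
  exists Y, [/\ zclosed Y, ~ (Z `<=` Y) &
    forall x, (Z `\` Y) x -> \rank (kermx (ljacobian F x)^T) = d].

Definition support_union (r : nat) (F : 'I_r -> laurent) : {fset 'rV[int]_n} :=
  \big[@fsetU _/fset0]_(i < r) lsupp (F i).

(* RF, with F regarded as a column vector *)
Definition mul_system (r s : nat) (M : 'M[C]_(r, s)) (F : 'I_s -> laurent) :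
  'I_r -> laurent := fun i => \sum_(j < s) M i j *: F j.

(* c . x^A *)
Definition lin_system (m r : nat) (A : 'M[int]_(n, m)) (c : 'M[C]_(r, m)) :
  'I_r -> laurent := fun i => \sum_(k < m) lmonom (c i k) (col k A)^T.

End Laurent.

Definition exponent_matrix (n : nat) (S : {fset 'rV[int]_n}) :
    'M[int]_(n, #|` S|) :=
  \matrix_(i, k) (S`_k : 'rV[int]_n) 0 i.

Definition smith_normal_form (n m : nat) (A : 'M[int]_(n, m)) (e : seq int) :=
  [/\ size e = minn n m, sorted dvdz e, all (>= 0) e &
      exists L : 'M[int]_n, exists2 Q : 'M[int]_m,
        (L \in unitmx) && (Q \in unitmx) &
        A = L *m (\matrix_(i, j) (e`_i *+ (i == j :> nat))) *m Q].

Definition standard_form (n m : nat) (A : 'M[int]_(n, m)) :=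
  [/\ (n + 1 < m)%N,
      exists k, col k A = 0,
      \rank (map_mx intr A : 'M[rat]_(n, m)) = n &
      exists2 e, smith_normal_form A e & {in e, forall z, z != 0 -> z = 1}].

(* F^(d) : R F together with the first d of the n polynomials c*_k . x^A *)
Definition sliced_system (C : fieldType) (n m : nat) (A : 'M[int]_(n, m))
    (F : 'I_n -> laurent C n) (M : 'M[C]_n) (c : 'M[C]_(n, m)) (d : nat) :
  set (laurent C n) :=
  range (mul_system M F) `|`
  [set lin_system A c k | k in [set k : 'I_n | (k < d)%N]].

Definition sample_set (C : fieldType) (n m : nat) (A : 'M[int]_(n, m))
    (F : 'I_n -> laurent C n) (M : 'M[C]_n) (c : 'M[C]_(n, m)) (d : nat) :
  set 'rV[C]_n := isolated_zeros (sliced_system A F M c d).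

Definition affine_zopen (C : fieldType) (N : nat) (U : set 'rV[C]_N) :=
  exists G : set (mpoly.mpoly N C),
    U = [set p | exists2 g, G g & mpoly.meval (p 0) g != 0].

Definition generic (C : fieldType) (N : nat) (P : 'rV[C]_N -> Prop) :=
  exists U, [/\ affine_zopen U, U !=set0 & forall p, U p -> P p].

Definition generic_mx (C : fieldType) (r s : nat) (P : 'M[C]_(r, s) -> Prop) :=
  generic (fun p : 'rV[C]_(r * s) => P (vec_mx p)).

Definition generic_mx2 (C : fieldType) (r1 s1 r2 s2 : nat)
    (P : 'M[C]_(r1, s1) -> 'M[C]_(r2, s2) -> Prop) :=
  generic (fun p : 'rV[C]_(r1 * s1 + r2 * s2) =>
    P (vec_mx (lsubmx p)) (vec_mx (rsubmx p))).

Section Volume.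
Variable R : realType.

(* Lebesgue measure on R^n as the iterated product of lebesgue_measure, each
   step being the value of the product measure (integral of the measures of
   the sections); on R^0 it is the unit mass. It is meaningful on Borel sets. *)
Fixpoint vol (n : nat) : set 'rV[R]_n -> \bar R :=
  match n return set 'rV[R]_n -> \bar R with
  | 0 => fun A => (\1_A (0 : 'rV[R]_0))%:E
  | n'.+1 => fun A =>
      (\int[lebesgue_measure]_(t in [set: R])
         vol [set v : 'rV[R]_n' | A (row_mx (const_mx t : 'rV[R]_1) v)])%E
  end.

Definition convhull (n : nat) (S : {fset 'rV[int]_n}) : set 'rV[R]_n :=
  smallest (@convex_set R 'rV[R]_n)
    [set map_mx intr a | a in [set a | a \in S]].

End Volume.

Arguments convhull R {n} S.

(* Main.v *)
Require Import Defs.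
From HB Require Import structures.
From mathcomp Require Import all_boot all_order all_algebra finmap.
From mathcomp Require Import perm.
From mathcomp Require Import complex.
From mathcomp Require Import all_classical all_reals all_analysis.
From mathcomp Require Import measurable_realfun.
From mathcomp Require Import -(notations) monalg mpoly.
From mathcomp Require Import zify ring lra.

Set Implicit Arguments.
Unset Strict Implicit.
Unset Printing Implicit Defensive.
Import Order.TTheory GRing.Theory Num.Theory.
Local Open Scope classical_set_scope.
Local Open Scope ring_scope.


(** The bound comes from a dimension count. Put the sample points of all dimensions in one finite
    list. At a point [p] of dimension [d], lying on the component [Z], the [d] slicing forms and
    [n - d] suitable combinations of the equations are local coordinates [G_1, ..., G_n]. Choose
    polynomials [e_p], nonzero at [p] and vanishing suitably at the other points, and a monomial
    [u]. The products [e_p G^b u^(k - |b|)], for all [p] and all [b] with [|b| <= k], are linearly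
    independent ([count_bound]). Up to a fixed monomial factor in [e_p], their exponents lie in a
    [(K + k)]-fold sumset of the support, so the number of points times ['C(n + k, n)] is at most
    the size of that sumset ([sample_count]). Unit cubes at the points of a [K]-fold sumset fit into
    the convex hull once scaled by the inverse of [K] plus a constant ([vol_ksums]), and letting [k]
    grow gives the bound ([volume_limit]). Standard form enters through an integral right inverse of
    the exponent matrix ([standard_form_section]).

    Independence is read off a filtration at [p] ([leading_form]): elements of the ideal of [Z] have
    order [k + 1], functions vanishing at [p] have order 1. The columns of the adjugate Jacobian are
    vector fields dual to the [G_i], and the first [d] of them are tangent to [Z] ([adj_field]);
    they lower the order exactly by the weight of [G_i] and thus isolate the coefficients of a
    leading form. Terms at a point [q] of another dimension have larger order because [e_q] vanishes
    on all of [Z]; this is what allows all dimensions to be counted together.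

    The behaviour of generic slices is studied on the incidence set of pairs of a point of [Z] and
    [d] forms vanishing there. It is irreducible of dimension [dim Z + d m - d], where [m] is the
    number of monomials. Comparing transcendence degrees, a generic slice is empty for [d > dim Z]
    ([slice_empty]) and avoids the singular points for [d = dim Z] ([slice_avoid]). An elementary
    generic flatness ([fiber_regular], [fiber_proper]) and the Nullstellensatz make it nonempty for
    [d <= dim Z] and free of isolated points for [d < dim Z]. So the sample set of rank [d] is the
    slice of the [d]-dimensional components ([sample_sub], [sample_sup]), and is nonempty when there
    are any. Reducedness is used in [component_frame], which identifies Krull dimension,
    transcendence degree and nullity of the Jacobian. *)

Notation pol n R := (mpoly.mpoly n R).
Notation mon n := (mpoly.multinom n).
Notation var i := (mpoly.mpolyX _ (mpoly.mnm1 i)).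

(** * Polynomial evaluation, substitution and derivations *)

Section Evaluation.
Variable (R : comNzRingType).

Definition ev n (v : 'rV[R]_n) : pol n R -> R := meval (v 0).

HB.instance Definition _ n (v : 'rV[R]_n) := GRing.RMorphism.copy (ev v) (meval (v 0)).
HB.instance Definition _ n (v : 'rV[R]_n) := GRing.Linear.copy (ev v) (meval (v 0)).

Lemma evC n (v : 'rV[R]_n) c : ev v (mpolyC n c) = c.
Proof. exact: mevalC. Qed.

Lemma evX n (v : 'rV[R]_n) i : ev v (var i) = v 0 i.
Proof. exact: mevalXU. Qed.

Definition msubst n k (f : 'I_n -> pol k R) : pol n R -> pol k R :=
  mmap (@mpolyC k R) f.

HB.instance Definition _ n k (f : 'I_n -> pol k R) :=
  GRing.RMorphism.copy (msubst f) (mmap (@mpolyC k R) f).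

Lemma msubstX n k (f : 'I_n -> pol k R) i : msubst f (var i) = f i.
Proof. by rewrite /msubst mmapX mmap1U. Qed.

Lemma msubstC n k (f : 'I_n -> pol k R) c : msubst f (mpolyC n c) = mpolyC k c.
Proof. by rewrite /msubst mmapC. Qed.

Lemma ev_msubst n k (f : 'I_n -> pol k R) v p :
  ev v (msubst f p) = ev (\row_i ev v (f i)) p.
Proof.
have -> : msubst f p = \sum_(m <- msupp p) mpolyC k (mcoeff m p) * mmap1 f m.
  by [].
rewrite raddf_sum [in RHS]/ev mevalE; apply: eq_bigr => m _ /=.
rewrite rmorphM /= evC rmorph_prod; congr (_ * _); apply: eq_bigr => i _ /=.
by rewrite rmorphXn /= mxE.
Qed.

End Evaluation.

Lemma mpoly_ring_ind (R : nzRingType) n (P : pol n R -> Prop) :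
    (forall c, P (mpolyC n c)) -> (forall i, P (var i)) ->
    (forall p q, P p -> P q -> P (p + q)) ->
    (forall p q, P p -> P q -> P (p * q)) -> forall p, P p.
Proof.
move=> PC PX PD PM p; rewrite (mpolyE p); elim: (msupp p) => [|m s IHs].
  by rewrite big_nil -(mpolyC0 n); apply: PC.
rewrite big_cons; apply: PD IHs; rewrite -mul_mpolyC; apply: (PM); first exact: PC.
rewrite mpolyXE_id; apply: (big_ind P) => [|q r|i _]; last 1 first.
- by elim: (m i) => [|k IHk]; [apply: PC 1 | rewrite exprS; apply: PM].
- exact: PC 1.
- exact: PM.
Qed.

Record derivation (R : comNzRingType) := Derivation {
  der :> R -> R;
  derD : forall x y, der (x + y) = der x + der y;
  derM : forall x y, der (x * y) = der x * y + x * der y }.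

Section Derivations.
Variables (R : comNzRingType) (D : derivation R).

Lemma der0 : D 0 = 0.
Proof. by apply: (addIr (D 0)); rewrite -derD !add0r. Qed.

Lemma der1 : D 1 = 0.
Proof. by apply: (addIr (D 1)); rewrite add0r -{3}(mulr1 1) derM mulr1 mul1r. Qed.

Lemma derN x : D (- x) = - D x.
Proof. by apply/eqP; rewrite -addr_eq0 -derD addNr der0. Qed.

Lemma der_sum I (r : seq I) (P : pred I) F :
  D (\sum_(i <- r | P i) F i) = \sum_(i <- r | P i) D (F i).
Proof. by rewrite (big_morph D (derD D) der0). Qed.

Lemma der_mulXn x k : D (x ^+ k) = (x ^+ k.-1 * D x) *+ k.
Proof.
elim: k => [|[|k] IHk]; rewrite ?expr0 ?der1 ?mulr0n ?expr1 ?mul1r //.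
rewrite exprS derM IHk /= -mulrnAr mulrA -exprS -mulrnAr.
by rewrite mulrC [in RHS]mulrS mulrDr.
Qed.

Lemma der_mmap (A : nzRingType) n (f : {rmorphism A -> R}) (h : 'I_n -> R) p :
    (forall c, D (f c) = 0) ->
  D (mmap f h p) = \sum_i mmap f h (mderiv i p) * D (h i).
Proof.
have mM p' q' : mmap f h (p' * q') = mmap f h p' * mmap f h q'.
  exact: rmorphM.
move=> Df; elim/mpoly_ring_ind: p => [c|j|p q IHp IHq|p q IHp IHq].
- by rewrite mmapC Df big1 // => i _; rewrite mderivC raddf0 mul0r.
- rewrite mmapX mmap1U (bigD1 j) //= mderivX mnm1E eqxx scale1r.
  rewrite (_ : mnm_sub _ _ = @mnm0 n); last first.
    by apply/mnmP => k; rewrite mnmBE subnn mnm0E.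
  rewrite mpolyX0 rmorph1 mul1r big1 ?addr0 // => i ij.
  by rewrite mderivX mnm1E eq_sym (negPf ij) scale0r raddf0 mul0r.
- rewrite raddfD derD IHp IHq -big_split /=; apply: eq_bigr => i _.
  by rewrite /= mderivD raddfD mulrDl.
- rewrite mM derM IHp IHq mulr_suml mulr_sumr -big_split.
  apply: eq_bigr => i _ /=.
  rewrite mderivM mmapD !mM mulrDl; congr (_ + _).
    by rewrite mulrAC.
  by rewrite mulrA.
Qed.
End Derivations.

Section VectorField.
Variables (R : comNzRingType) (n : nat) (v : 'I_n -> pol n R).

Definition vfield_fun p := \sum_i v i * mderiv i p.

Fact vfieldD p q : vfield_fun (p + q) = vfield_fun p + vfield_fun q.
Proof.
rewrite /vfield_fun -big_split /=; apply: eq_bigr => i _.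
by rewrite /= mderivD mulrDr.
Qed.

Fact vfieldM p q : vfield_fun (p * q) = vfield_fun p * q + p * vfield_fun q.
Proof.
rewrite /vfield_fun mulr_suml mulr_sumr -big_split /=; apply: eq_bigr => i _ /=.
by rewrite mderivM; ring.
Qed.

Definition vfield : derivation (pol n R) := Derivation vfieldD vfieldM.

Lemma vfieldE p : vfield p = \sum_i v i * mderiv i p. Proof. by []. Qed.

Lemma vfieldC c : vfield (mpolyC n c) = 0.
Proof. by rewrite vfieldE big1 // => i _; rewrite mderivC mulr0. Qed.

Lemma mderiv_var i j : mderiv i (var j) = (i == j)%:R :> pol n R.
Proof.
rewrite mderivX mnm1E eq_sym; case: eqP => [->|_]; last by rewrite scale0r.
rewrite scale1r (_ : mnm_sub _ _ = @mnm0 n) ?mpolyX0 //.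
by apply/mnmP => k; rewrite mnmBE subnn mnm0E.
Qed.

Lemma vfield_var j : vfield (var j) = v j.
Proof.
rewrite vfieldE (bigD1 j) //= mderiv_var eqxx mulr1 big1 ?addr0 // => i ij.
by rewrite mderiv_var (negPf ij) mulr0.
Qed.

End VectorField.

Lemma vfield_msubst (R : comNzRingType) n k (v : 'I_n -> pol n R)
    (f : 'I_k -> pol n R) p :
  vfield v (msubst f p) = \sum_i msubst f (mderiv i p) * vfield v (f i).
Proof. by apply: der_mmap => c; apply: vfieldC. Qed.

Lemma mderiv_msubst (R : comNzRingType) n k j (f : 'I_k -> pol n R) p :
  mderiv j (msubst f p) = \sum_i msubst f (mderiv i p) * mderiv j (f i).
Proof.
have dE q : vfield (fun i => (i == j)%:R) q = mderiv j q.
  rewrite vfieldE (bigD1 j) //= eqxx mul1r big1 ?addr0 // => i /negPf->.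
  by rewrite mul0r.
by rewrite -dE vfield_msubst; apply: eq_bigr => i _; rewrite dE.
Qed.

Lemma msize_mderiv (R : nzRingType) n i (p : pol n R) :
  p != 0 -> (mmeasure mdeg (mderiv i p) < mmeasure mdeg p)%N.
Proof.
move=> p0; rewrite [X in (X < _)%N]mmeasureE (mpolySpred _ p0) ltnS.
apply/bigmax_leqP_seq => m + _.
rewrite mcoeff_msupp mcoeff_deriv => /eqP m0.
have: mnm_add m (mnm1 i) \in msupp p.
  by rewrite mcoeff_msupp; apply/eqP => pm; apply: m0; rewrite pm mul0rn.
move/(@mmeasure_mnm_lt _ _ mdeg) => /=; rewrite mdegD mdeg1 addn1.
by move=> h; rewrite -ltnS (ltn_predK h).
Qed.

Lemma mderiv_eq0 (R : numDomainType) n (p : pol n R) :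
  (forall i, mderiv i p = 0) -> p = mpolyC n (mcoeff (@mnm0 n) p).
Proof.
move=> dp; apply/mpolyP => m; rewrite mcoeffC.
have [->|m0] := eqVneq m (@mnm0 n); first by rewrite mulr1.
have [i mi] : exists i, m i != 0%N.
  apply/existsP; apply: contraR m0; rewrite negb_exists => /forallP m0.
  by apply/eqP/mnmP => i; rewrite mnm0E; apply/eqP; move: (m0 i); rewrite negbK.
have := mcoeff_deriv i (mnm_sub m (mnm1 i)) p.
rewrite dp mcoeff0 submK ?lep1mP // mulr0 => /esym/eqP.
by rewrite mulrn_eq0 /= => /eqP.
Qed.

Section Lines.
Variables (R : numDomainType) (n : nat).

Definition line (v w : 'rV[R]_n) : pol n R -> {poly R} :=
  mmap (@polyC R) (fun i => (v 0 i)%:P + w 0 i *: 'X).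

HB.instance Definition _ v w :=
  GRing.RMorphism.copy (line v w) (mmap (@polyC R) _).

Lemma horner_line v w p s : (line v w p).[s] = ev (v + s *: w) p.
Proof.
elim/mpoly_ring_ind: p => [c|j|p q IHp IHq|p q IHp IHq].
- by rewrite /line mmapC hornerC evC.
- by rewrite /line mmapX mmap1U evX !hornerE !mxE mulrC.
- by rewrite !rmorphD hornerD IHp IHq.
- by rewrite !rmorphM hornerM IHp IHq.
Qed.

Fact deriv_derD (p q : {poly R}) : (p + q)^`() = p^`() + q^`().
Proof. exact: derivD. Qed.

Lemma deriv_line v w p :
  (line v w p)^`() = \sum_i line v w (mderiv i p) * (w 0 i)%:P.
Proof.
have := @der_mmap _ (Derivation deriv_derD (@derivM R)) R n
  (@polyC R) (fun i => (v 0 i)%:P + w 0 i *: 'X) p.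
move=> /= -> => [|c]; last exact: derivC.
by apply: eq_bigr => i _; rewrite derivD derivC add0r derivZ derivX alg_polyC.
Qed.

Lemma horner_eq0 (p : {poly R}) : (forall s, p.[s] = 0) -> p = 0.
Proof.
move=> p0; apply/eqP; apply: contraT => pn0.
have := @max_poly_roots _ p [seq i%:R | i <- iota 0 (size p)] pn0.
rewrite size_map size_iota ltnn; apply.
  by apply/allP => s _; apply/eqP; apply: p0.
by rewrite map_inj_uniq ?iota_uniq // => i j /eqP; rewrite eqr_nat => /eqP.
Qed.

(** Induction on the degree: if [p] vanished everywhere, so would its restrictions to lines in
    coordinate directions, hence all its partial derivatives, and in characteristic zero [p] would
    be constant. *)
Lemma ev_neq0 (p : pol n R) : p != 0 -> exists v, ev v p != 0.
Proof.
have [k] := ubnP (mmeasure mdeg p); elim: k => // k IHk in p *.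
move=> pk p0; apply/not_existsP => ev0.
suff dp i : mderiv i p = 0.
  have := mderiv_eq0 dp; move: p0 (ev0 0) => + + pE; rewrite pE evC.
  by move=> + /negP; rewrite mpolyC_eq0 => ->.
apply/eqP; apply: contraT => di0.
have [v /eqP[]] := IHk _ (leq_trans (msize_mderiv i p0) pk) di0.
have l0 : line v (delta_mx 0 i) p = 0.
  apply: horner_eq0 => s; rewrite horner_line; apply/eqP/negPn/negP.
  exact: ev0.
have := congr1 (fun q => q.[0]) (deriv_line v (delta_mx 0 i) p).
rewrite l0 derivC horner0 (bigD1 i) //= big1 => [|j ji].
  by rewrite addr0 mxE !eqxx polyC1 mulr1 horner_line scale0r addr0.
by rewrite mxE (negPf ji) andbF polyC0 mulr0.
Qed.

End Lines.


(** * Ideals, and algebraic dependence by counting monomials *)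

(** A kernel vector of the coefficient matrix. The counting arguments for algebraic dependence, for
    the Nullstellensatz and for the sample points all end here. *)
Lemma mpoly_lin_dep (K : fieldType) n (T : seq (mon n)) (L : finType)
    (p : L -> pol n K) :
    (forall l, {subset msupp (p l) <= T}) -> (size T < #|L|)%N ->
  exists2 k : L -> K, exists l, k l != 0 & \sum_l k l *: p l = 0.
Proof.
move=> pT TL; pose A : 'M[K]_(#|L|, size T) :=
  \matrix_(i, j) mcoeff (tnth (in_tuple T) j) (p (enum_val i)).
have : kermx A != 0.
  rewrite kermx_eq0 /row_free neq_ltn; apply/orP; left.
  exact: leq_ltn_trans (rank_leq_col A) TL.
move/rowV0Pn => [v /sub_kermxP vA /eqP/rowP v0].
exists (fun l => v 0 (enum_rank l)).
  apply/not_existsP => v0'; apply: v0 => i; rewrite mxE.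
  by have /negP := v0' (enum_val i); rewrite negbK enum_valK => /eqP.
apply/mpolyP => m; rewrite mcoeff0 raddf_sum /=.
have [mT|mT] := boolP (m \in T); last first.
  rewrite big1 // => l _; rewrite mcoeffZ memN_msupp_eq0 ?mulr0 //.
  by apply: contra mT; apply: pT.
have iT : (index m T < size T)%N by rewrite index_mem.
have := congr1 (fun B : 'rV__ => B 0 (Ordinal iT)) vA; rewrite !mxE => vA0.
rewrite -[RHS]vA0 (reindex_onto enum_val enum_rank) => [|l _]; last first.
  exact: enum_rankK.
apply: eq_big => [i|i _]; first by rewrite enum_valK eqxx.
rewrite mcoeffZ enum_valK; congr (_ * _).
by rewrite mxE (tnth_nth m) /= nth_index.
Qed.

Record ideal (Q : comNzRingType) (J : set Q) : Prop := Ideal {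
  ideal0 : J 0;
  idealD : forall x y, J x -> J y -> J (x + y);
  idealM : forall x y, J y -> J (x * y) }.

Section IdealTheory.
Variables (Q : comNzRingType) (J : set Q).
Hypothesis idJ : ideal J.

Lemma idealMr x y : J x -> J (x * y).
Proof. by rewrite mulrC; apply: idealM. Qed.

Lemma idealN x : J x -> J (- x).
Proof. by rewrite -mulN1r; apply: idealM. Qed.

Lemma idealB x y : J x -> J y -> J (x - y).
Proof. by move=> Jx /idealN; apply: idealD. Qed.

Lemma ideal_sum I (r : seq I) (P : pred I) F :
  (forall i, P i -> J (F i)) -> J (\sum_(i <- r | P i) F i).
Proof. by move=> JF; apply: big_ind => //; [apply: ideal0 | apply: idealD]. Qed.

Lemma ideal_subl x y : J (x - y) -> J x -> J y.
Proof. by move=> Jxy Jx; rewrite -(subKr x y); apply: idealB. Qed.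

End IdealTheory.

Record prime (Q : comNzRingType) (P : set Q) : Prop := Prime {
  prime_ideal :> ideal P;
  prime1 : ~ P 1;
  primeM : forall x y, P (x * y) -> P x \/ P y }.

Lemma primeX (Q : comNzRingType) (P : set Q) x k : prime P -> P (x ^+ k) -> P x.
Proof.
move=> prP; elim: k => [/prime1 //|k IHk].
by rewrite exprS => /(primeM prP)[].
Qed.

Section Elimination.
Variables (C : fieldType) (n : nat) (I : {set 'I_n}).
Variables (J : set (pol n C)) (Rel : 'I_n -> pol n C).
Hypothesis idJ : ideal J.
Hypothesis RelJ : forall j, j \notin I -> J (Rel j).

Definition only_vars (A : {set 'I_n}) (p : pol n C) :=
  forall m, m \in msupp p -> forall k, k \notin A -> m k = 0%N.

Definition rdeg j := \max_(m <- msupp (Rel j)) m j.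

(** [rdeg j] and [rlead j] are the degree and the leading coefficient of [Rel j] as a polynomial in
    the variable [j]. *)
Definition rlead j : pol n C :=
  \sum_(m <- msupp (Rel j) | m j == rdeg j)
    mcoeff m (Rel j) *: mpolyX _ (mnm_sub m (mnm_muln (mnm1 j) (rdeg j))).

Hypothesis Rel_vars : forall j, j \notin I -> only_vars (j |: I) (Rel j).
Hypothesis rdeg_gt0 : forall j, j \notin I -> (0 < rdeg j)%N.

(** The remainders of pseudo-division by the relations [Rel j]; their monomials number [s.+1 ^ #|I|]
    up to a constant factor, and this growth is what the counting exploits. *)
Definition normal s (p : pol n C) := forall m, m \in msupp p ->
  forall i, (m i < if i \in I then s.+1 else rdeg i)%N.

Definition base s (p : pol n C) := forall m, m \in msupp p ->
  forall i, (m i <= if i \in I then s else 0)%N.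

Lemma normalD s p q : normal s p -> normal s q -> normal s (p + q).
Proof.
move=> np nq m /msuppD_le; rewrite mem_cat => /orP[]; [exact: np|exact: nq].
Qed.

Lemma normalZ s c p : normal s p -> normal s (c *: p).
Proof. by move=> np m /msuppZ_le; apply: np. Qed.

Lemma normal0 s : normal s 0.
Proof. by move=> m; rewrite mcoeff_msupp mcoeff0 eqxx. Qed.

Lemma normal_sum s T (r : seq T) (P : pred T) F :
  (forall i, P i -> normal s (F i)) -> normal s (\sum_(i <- r | P i) F i).
Proof. by move=> nF; apply: big_ind => //; [apply: normal0|apply: normalD]. Qed.

Lemma normal_le s t p : (s <= t)%N -> normal s p -> normal t p.
Proof.
by move=> st np m /np mi i; move: (mi i); case: ifP => // _ /leq_trans; apply.
Qed.

Lemma normalM s t p q : base s p -> normal t q -> normal (s + t) (p * q).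
Proof.
move=> bp nq m /msuppM_le /allpairsP[[a b] /= [/bp ap /nq bq ->]] i.
by move: (ap i) (bq i); rewrite mnmDE; case: ifP => _; lia.
Qed.

Lemma baseM s t p q : base s p -> base t q -> base (s + t) (p * q).
Proof.
move=> bp nq m /msuppM_le /allpairsP[[a b] /= [/bp ap /nq bq ->]] i.
by move: (ap i) (bq i); rewrite mnmDE; case: ifP => _; lia.
Qed.

Lemma base1 : base 0 1.
Proof.
move=> m; rewrite msupp1 inE => /eqP-> i; by rewrite mnm0E.
Qed.

Definition rbound := (\sum_j mmeasure mdeg (Rel j))%N.

Lemma mnm_le_mmeasure (p : pol n C) m i :
  m \in msupp p -> (m i <= mmeasure mdeg p)%N.
Proof.
move=> /(@mmeasure_mnm_lt _ _ mdeg) /= /ltnW; apply: leq_trans.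
by rewrite mdegE (bigD1 i) //= leq_addr.
Qed.

Lemma rlead_base j : j \notin I -> base (mmeasure mdeg (Rel j)) (rlead j).
Proof.
move=> jI m /msupp_sum_le /flattenP[s /mapP[m']].
rewrite mem_filter => /andP[/eqP m'j m'R] -> /msuppZ_le.
rewrite msuppX inE => /eqP-> i.
rewrite mnmBE mulmnE mnm1E; case: ifP => [iI|/negbT iI].
  exact: leq_trans (leq_subr _ _) (mnm_le_mmeasure _ m'R).
have [<-|ij] := eqVneq j i; first by rewrite -m'j mul1n subnn.
rewrite mul0n subn0 (Rel_vars jI m'R) //.
by rewrite !inE negb_or eq_sym ij.
Qed.

Definition rleads := \prod_(j | j \notin I) rlead j.

Lemma rleads_base (A : pred 'I_n) : (forall j, A j -> j \notin I) ->
  base (\sum_(j | A j) mmeasure mdeg (Rel j)) (\prod_(j | A j) rlead j).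
Proof.
move=> AI; apply: (big_ind2 (fun s p => base s p)) => [|s p t q|j /AI].
- exact: base1.
- exact: baseM.
- exact: rlead_base.
Qed.

Lemma base_le s t p : (s <= t)%N -> base s p -> base t p.
Proof.
by move=> st bp m /bp mi i; apply: leq_trans (mi i) _; case: ifP.
Qed.

Lemma mrank_sum_le (A : pred 'I_n) :
  (\sum_(j | A j) mmeasure mdeg (Rel j) <= rbound)%N.
Proof. by rewrite /rbound [leqRHS](bigID A) /= leq_addr. Qed.

Lemma normalX s (m : mon n) : (forall i, (m i < if i \in I then s.+1 else rdeg i)%N) ->
  normal s (mpolyX C m).
Proof. by move=> mP m'; rewrite msuppX inE => /eqP->. Qed.

Lemma rlead_decomp j : Rel j = rlead j * mpolyX _ (mnm_muln (mnm1 j) (rdeg j))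
  + \sum_(m <- msupp (Rel j) | m j != rdeg j) mcoeff m (Rel j) *: mpolyX _ m.
Proof.
rewrite {1}(mpolyE (Rel j)) (bigID (fun m : mon n => m j == rdeg j)) /=.
congr (_ + _); rewrite mulr_suml; apply: eq_bigr => m /eqP mj.
rewrite -scalerAl -mpolyXD submK //; apply/mnm_lepP => i.
rewrite mulmnE mnm1E; have [<-|] := eqVneq j i; last by rewrite mul0n.
by rewrite mul1n mj.
Qed.

(** One step of pseudo-division: multiplying by the variable [k] matters only if [k] is outside [I]
    and its degree reaches [rdeg k]. Then [Rel k] replaces the top power at the price of the factor
    [rlead k]; the other factors of [rleads] keep the multiplier the same for all [k]. *)
Lemma normal_step s k (m : mon n) : normal s (mpolyX C m) ->
  exists2 g, normal (s + rbound).+1 g & J (rleads * (var k * mpolyX C m) - g).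
Proof.
move=> nm; have {}nm := nm m; rewrite msuppX mem_head in nm.
have {}nm := nm isT.
have thetab : base rbound rleads.
  by apply: base_le (rleads_base (A := fun j => j \notin I) _); rewrite ?mrank_sum_le.
pose m1 := mnm_add (mnm1 k) m.
have [km|km] := boolP ((k \notin I) && ((m k).+1 == rdeg k)); last first.
  exists (rleads * mpolyX C m1); last by rewrite mpolyXD subrr; apply: ideal0.
  have -> : (s + rbound).+1 = (rbound + s.+1)%N by lia.
  apply: normalM => //.
  apply: normalX => i; rewrite mnmDE mnm1E.
  have [ki|_] := eqVneq k i; last first.
    by rewrite add0n; move: (nm i); case: ifP => // _; lia.
  move: (nm i) km; rewrite ki; case: ifP => /= iI; first lia.
  by move=> /= mi /eqP; lia.
case/andP: km => kI /eqP mk; pose m' := mnm_sub m (mnm_muln (mnm1 k) (m k)).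
have m'E : mnm_add (mnm1 k) m = mnm_add (mnm_muln (mnm1 k) (rdeg k)) m'.
  apply/mnmP => i; rewrite !mnmDE mnmBE !mulmnE mnm1E -mk.
  by case: eqVneq => [<-|_] /=; lia.
pose low := - \sum_(m <- msupp (Rel k) | m k != rdeg k)
  mcoeff m (Rel k) *: mpolyX _ m.
pose rest := \prod_(j | (j \notin I) && (j != k)) rlead j.
have restE : rleads = rlead k * rest by rewrite /rleads (bigD1 k).
exists (rest * (low * mpolyX C m')); last first.
  have -> : rleads * (var k * mpolyX C m) - rest * (low * mpolyX C m') =
      rest * mpolyX C m' * Rel k.
    by rewrite -mpolyXD m'E mpolyXD restE [Rel k]rlead_decomp /low; ring.
  by apply: idealM => //; apply: RelJ.
apply: (@normal_le (\sum_(j | (j \notin I) && (j != k)) mmeasure mdeg (Rel j)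
  + (mmeasure mdeg (Rel k) + s))).
  rewrite addnA addnC ltnW // ltnS leq_add2l /rbound [leqRHS](bigD1 k) //=.
  rewrite addnC leq_add2l [leqRHS](bigID [pred j | j \notin I]) /=.
  by under eq_bigl do rewrite andbC; rewrite leq_addr.
apply: normalM; first by apply: rleads_base => j /andP[].
rewrite /low mulNr -scaleN1r; apply: normalZ.
rewrite mulr_suml big_seq_cond; apply: normal_sum => m0 /andP[m0R m0k].
rewrite -scalerAl -mpolyXD; apply: normalZ; apply: normalX => i.
rewrite mnmDE mnmBE mulmnE mnm1E; case: ifP => iI.
  by move: (mnm_le_mmeasure i m0R) (nm i); rewrite iI; lia.
have [<-|ki] := eqVneq k i.
  rewrite mul1n subnn addn0 ltn_neqAle m0k /rdeg.
  exact: (@leq_bigmax_seq _ _ xpredT (fun m : mon n => m k)).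
rewrite (Rel_vars kI m0R) ?add0n; last by rewrite !inE negb_or eq_sym ki iI.
by move: (nm i); rewrite iI; lia.
Qed.

Lemma normal_ind (r : seq (mon n)) (F : mon n -> pol n C) c s t (u : pol n C) :
    (forall m, m \in r -> normal s (mpolyX C m)) ->
    (forall m, normal s (mpolyX C m) ->
      exists2 g, normal t g & J (u * F m - g)) ->
  exists2 g, normal t g & J (u * (\sum_(m <- r) c m *: F m) - g).
Proof.
elim: r => [_ _|m r IHr nr Fr].
  exists 0; first exact: normal0.
  by rewrite big_nil mulr0 subrr; apply: ideal0.
have [g ng Jg] := IHr (fun m' m'r => nr m' (mem_behead (s := m :: r) m'r)) Fr.
have [h nh Jh] := Fr m (nr m (mem_head _ _)).
exists (c m *: h + g); first exact/normalD/ng/normalZ.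
rewrite big_cons mulrDr opprD addrACA; apply: idealD => //.
by rewrite -scalerAr -scalerBr -mul_mpolyC; apply: idealM.
Qed.

Lemma base_rleads k : base (k * rbound) (rleads ^+ k).
Proof.
elim: k => [|k IHk]; first exact: base1.
rewrite exprS mulSn; apply: baseM IHk.
by apply: base_le (rleads_base (A := fun j => j \notin I) _); rewrite ?mrank_sum_le.
Qed.

Lemma normal_mon (m : mon n) :
  exists2 g, normal (mdeg m * rbound.+1) g &
    J (rleads ^+ mdeg m * mpolyX C m - g).
Proof.
move: {2}(mdeg m) (erefl (mdeg m)) => k; elim: k m => [|k IHk] m mk.
  move/eqP: mk; rewrite mdeg_eq0 => /eqP->; exists 1; last first.
    by rewrite mdeg0 mpolyX0 mulr1 subrr; apply: ideal0.
  rewrite -mpolyX0; apply: normalX => i; rewrite mnm0E.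
  by case: ifPn => // /rdeg_gt0.
have [i mi] : exists i, m i != 0%N.
  apply/existsP; apply: contra_eqT mk; rewrite negb_exists => /forallP m0.
  by rewrite mdegE big1 // => i _; apply/eqP; move: (m0 i); rewrite negbK.
have mE : m = mnm_add (mnm1 i) (mnm_sub m (mnm1 i)).
  apply/mnmP => j; rewrite mnmDE mnmBE mnm1E; case: eqVneq => [<-|_] /=; lia.
move: mk; rewrite mE mdegD mdeg1 add1n => -[]; move: (mnm_sub _ _) => m' m'k.
have [g ng Jg] := IHk _ m'k; rewrite m'k in ng Jg *.
have [h nh Jh] : exists2 h, normal (k.+1 * rbound.+1) h &
    J (rleads * (\sum_(m0 <- msupp g) mcoeff m0 g *: (var i * mpolyX C m0)) - h).
  apply: (@normal_ind _ _ _ (k * rbound.+1)%N) => [m0 m0g|m0 nm0].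
    by move=> m1; rewrite msuppX inE => /eqP->; apply: ng.
  have [h nh Jh] := normal_step i nm0; exists h => //.
  by apply: normal_le nh; rewrite mulSn; lia.
exists h => //; rewrite mpolyXD exprS.
have -> : rleads * rleads ^+ k * (var i * mpolyX C m') - h =
  rleads * var i * (rleads ^+ k * mpolyX C m' - g) +
  (rleads * (var i * g) - h) by ring.
apply: idealD; [by []|by apply: idealM|].
rewrite {1}(mpolyE g) mulr_sumr; under eq_bigr do rewrite -scalerAr.
exact: Jh.
Qed.

(** The point is that the bound on the remainder is linear in [k], so that the available monomials
    grow only like [k ^ #|I|]. *)
Lemma normal_deg k p : (forall m, m \in msupp p -> (mdeg m <= k)%N) ->
  exists2 g, normal (k * rbound.+1) g & J (rleads ^+ k * p - g).
Proof.
move=> pk; rewrite [p in _ * p]mpolyE; pose c m := mcoeff m p.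
elim: (msupp p) pk => [_|m r IHr pk].
  exists 0; first exact: normal0.
  by rewrite big_nil mulr0 subrr; apply: ideal0.
have [g ng Jg] := IHr (fun m' m'r => pk m' (mem_behead (s := m :: r) m'r)).
have [h nh Jh] := normal_mon m; have mk := pk m (mem_head _ _).
exists (c m *: (rleads ^+ (k - mdeg m) * h) + g).
  apply: normalD => //; apply: normalZ.
  apply: (@normal_le ((k - mdeg m) * rbound + mdeg m * rbound.+1)); first nia.
  by apply: normalM => //; apply: base_rleads.
rewrite big_cons mulrDr opprD addrACA; apply: idealD => //.
rewrite -scalerAr -scalerBr -mul_mpolyC -[in rleads ^+ k](subnK mk) exprD.
by rewrite -mulrA -mulrBr; apply: idealM => //; apply: idealM.
Qed.

Lemma normal_monomials s : exists2 T : seq (mon n),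
  (forall p, normal s p -> {subset msupp p <= T}) &
  size T = (s.+1 ^ #|I| * \prod_(j | j \notin I) rdeg j)%N.
Proof.
pose b i := if i \in I then s.+1 else rdeg i.
pose E (f : {dffun forall i : 'I_n, 'I_(b i)}) : mon n :=
  Multinom [tuple (f i : nat) | i < n].
exists [seq E f | f <- enum {: {dffun forall i : 'I_n, 'I_(b i)}}].
  move=> p np m mp; apply/mapP.
  exists (finfun (fun i => Ordinal (np m mp i)) : {dffun forall i : 'I_n, 'I_(b i)}).
    by rewrite mem_enum.
  by apply/mnmP => i; rewrite mnmE ffunE.
rewrite size_map -cardE card_dep_ffun foldrE big_map big_enum /=.
rewrite (bigID (mem I)) /=; congr (_ * _)%N.
  under eq_bigr => i iI do rewrite card_ord /b iI.
  by rewrite prod_nat_const.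
by apply: eq_bigr => i /negPf iI; rewrite card_ord /b iI.
Qed.

Definition degle k (p : pol n C) := forall m, m \in msupp p -> (mdeg m <= k)%N.

Lemma degleM k l p q : degle k p -> degle l q -> degle (k + l) (p * q).
Proof.
move=> kp lq m /msuppM_le /allpairsP[[a b] /= [/kp ap /lq bq ->]].
by rewrite mdegD leq_add.
Qed.

Lemma degle_prod T (r : seq T) (P : pred T) (d : T -> nat) F :
  (forall i, P i -> degle (d i) (F i)) ->
  degle (\sum_(i <- r | P i) d i) (\prod_(i <- r | P i) F i).
Proof.
move=> dF; apply: (big_ind2 (fun s p => degle s p)) => //.
  by move=> m; rewrite msupp1 inE => /eqP->; rewrite mdeg0.
by move=> s p t q; apply: degleM.
Qed.

Lemma degleX k p e : degle k p -> degle (e * k) (p ^+ e).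
Proof.
move=> kp; elim: e => [|e IHe].
  by move=> m; rewrite msupp1 inE => /eqP->; rewrite mdeg0.
by rewrite exprS mulSn; apply: degleM.
Qed.

(* Counting monomials: the products of the [g l] with all exponents at most [N]
   number [N.+1 ^ t], but modulo [J] and up to powers of [rleads] they all lie
   in a space of dimension [O(N ^ #|I|)]. *)
Lemma algebraic_dependence t (g : 'I_t -> pol n C) : (#|I| < t)%N ->
  exists2 rho : pol t C, rho != 0 & exists K, J (rleads ^+ K * msubst g rho).
Proof.
move=> It; pose d := (\sum_l mmeasure mdeg (g l))%N.
(* Remainders of the products use at most [N * N.+1 ^ #|I|] monomials for this [N], which is less
   than [N.+1 ^ #|I|.+1]. *)
pose N := ((d * rbound.+1).+1 ^ #|I| * \prod_(j | j \notin I) rdeg j)%N.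
pose L : finType := {ffun 'I_t -> 'I_N.+1}.
pose p (a : L) := \prod_l g l ^+ a l.
have pdeg a : degle (N * d) (p a).
  have : degle (\sum_l a l * mmeasure mdeg (g l)) (p a).
    apply: degle_prod => l _; apply: degleX => m.
    by move/(@mmeasure_mnm_lt _ _ mdeg)/ltnW.
  move=> pa m /pa /leq_trans; apply; rewrite big_distrr /=.
  by apply: leq_sum => l _; rewrite leq_mul2r -ltnS ltn_ord orbT.
have /choice[h hP] a : exists h, normal (N * d * rbound.+1) h /\
    J (rleads ^+ (N * d) * p a - h).
  by have [h nh Jh] := normal_deg (pdeg a); exists h.
have [T TP sT] := normal_monomials (N * d * rbound.+1).
have TL : (size T < #|L|)%N.
  rewrite sT card_ffun !card_ord.
  apply: (@leq_trans (N.+1 ^ #|I|.+1)); last by rewrite leq_pexp2l.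
  rewrite expnS; apply: (@leq_trans (N * N.+1 ^ #|I|).+1).
    rewrite ltnS.
    apply: (@leq_trans ((d * rbound.+1).+1 ^ #|I| *
      \prod_(j | j \notin I) rdeg j * N.+1 ^ #|I|)); last exact: leqnn.
    rewrite [leqRHS]mulnAC leq_mul2r -expnMn; apply/orP; right.
    by case: #|I| => // c; rewrite leq_exp2r //; nia.
  by rewrite mulSn -add1n leq_add2r expn_gt0.
have [k [a0 ka0] kh] := mpoly_lin_dep (fun a => TP _ (hP a).1) TL.
pose M (a : L) : mon t := Multinom [tuple (a l : nat) | l < t].
have Minj : injective M.
  move=> a a' /mnmP E; apply/ffunP => l; apply/val_inj.
  by have := E l; rewrite !mnmE.
exists (\sum_a k a *: mpolyX C (M a)).
  apply: contra_neq ka0 => /(congr1 (mcoeff (M a0))).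
  rewrite mcoeff0 raddf_sum /= (bigD1 a0) //= big1 => [|a aa0].
    by rewrite addr0 mcoeffZ mcoeffX eqxx mulr1.
  by rewrite mcoeffZ mcoeffX (inj_eq Minj) (negPf aa0) mulr0.
exists (N * d)%N.
have -> : msubst g (\sum_a k a *: mpolyX C (M a)) = \sum_a k a *: p a.
  rewrite raddf_sum; apply: eq_bigr => a _ /=.
  rewrite /msubst mmapZ mmapX mul_mpolyC; congr (_ *: _).
  by apply: eq_bigr => l _; rewrite mnmE.
have -> : rleads ^+ (N * d) * (\sum_a k a *: p a) =
    \sum_a (rleads ^+ (N * d) * (k a *: p a) - k a *: h a).
  by rewrite sumrB kh subr0 mulr_sumr.
apply: ideal_sum => // a _.
rewrite -scalerAr -scalerBr -mul_mpolyC; apply: idealM => //.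
exact: (hP a).2.
Qed.

End Elimination.


(** * Derivations stabilising a prime ideal, and transcendence bases *)

(** Modulo [h] only those Leibniz terms survive in which the [a] derivations hit the [a] factors
    [h], one each; there are [a]! of them. *)
Lemma der_iter_mulXn (R : comNzRingType) (D : derivation R) a e h :
  exists s, iter a D (e * h ^+ a) = (e * D h ^+ a) *+ a`! + h * s.
Proof.
elim: a e => [|a IHa] e; first by exists 0; rewrite mulr0 addr0.
pose e' := D e * h + (e * D h) *+ a.+1.
have [s sE] := IHa e'; exists (s + (D e * D h ^+ a) *+ a`!).
rewrite iterSr (_ : D _ = e' * h ^+ a); last first.
  rewrite derM der_mulXn /= exprS mulrDl mulrnAr mulrnAl mulrA.
  by rewrite [h ^+ a * _]mulrC mulrA.
rewrite sE /e' mulrDl mulrnAl mulrnDl -mulrnA mulrDr mulrnAr factS exprS.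
by rewrite addrC addrA addrC !mulrA [h * D e]mulrC.
Qed.

(** Applying [D] to [e * h ^+ a] [a] times stays in [J], hence in [P], and modulo [h] leaves a
    factorial times [e * D h ^+ a]; the integer, [e] and the exponent are then cancelled in turn. *)
Lemma prime_iter (R : comNzRingType) (D : derivation R) (P J : set R) a e h :
    prime P -> (forall k x, P (x *+ k.+1) -> P x) -> J `<=` P ->
    (forall x, J x -> J (D x)) -> P h -> ~ P e -> J (e * h ^+ a) -> P (D h).
Proof.
move=> prP natP JP DJ Ph Pe Je; have : J (iter a D (e * h ^+ a)).
  move: (_ * _) Je => x; elim: a x => //= a IHa x /IHa; exact: DJ.
have [s ->] := der_iter_mulXn D a e h => /JP Pa.
have {}Pa : P ((e * D h ^+ a) *+ a`!).
  rewrite -(addrK (h * s) (_ *+ _)); apply: (idealB prP Pa).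
  exact: (idealMr prP).
move: Pa; rewrite -(prednK (fact_gt0 a)) => /natP /(primeM prP)[//|].
exact: primeX.
Qed.

(** Factors out the lowest power of one variable. Modulo a prime ideal that power can be cancelled,
    and the part [r0] free of the variable survives when the variable is sent to zero. *)
Lemma low_part (R : comNzRingType) t (i : 'I_t) (rho : pol t R) : rho != 0 ->
  exists a r0 r1, [/\ rho = var i ^+ a * (r0 + var i * r1),
    r0 != 0 & forall m, m \in msupp r0 -> m i = 0%N].
Proof.
move=> rho0; have exa : exists a, has (fun m : mon t => m i == a) (msupp rho).
  by exists (mlead rho i); apply/hasP; exists (mlead rho); rewrite ?mlead_supp.
case: (ex_minnP exa) => a /hasP[m0 m0r /eqP m0i] amin; exists a.
have {}amin m : m \in msupp rho -> (a <= m i)%N.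
  by move=> mr; apply: amin; apply/hasP; exists m.
pose q (c : bool) (u : mon t) := \sum_(m <- msupp rho | (m i == a) == c)
  mcoeff m rho *: mpolyX R (mnm_sub m u).
pose u := mnm_muln (mnm1 i) a; have uE k : u k = (a * (i == k))%N.
  by rewrite /u mulmnE mnm1E mulnC.
exists (q true u), (q false (mnm_add (mnm1 i) u)).
have qE c (v : mon t) : (forall m, m \in msupp rho -> (m i == a) == c ->
    forall k, (v k <= m k)%N) -> mpolyX R v * q c v =
    \sum_(m <- msupp rho | (m i == a) == c) mcoeff m rho *: mpolyX R m.
  move=> vm; rewrite mulr_sumr big_seq_cond [RHS]big_seq_cond.
  apply: eq_bigr => m /andP[mr mc]; rewrite -scalerAr -mpolyXD addmC submK //.
  by apply/mnm_lepP; apply: vm.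
split.
- rewrite mulrDr mulrA mpolyXn -mpolyXD (addmC u) !qE.
  + rewrite {1}(mpolyE rho) (bigID (fun m : mon t => m i == a)) /=.
    by congr (_ + _); apply: eq_bigl => m; case: (_ == a).
  + by move=> m /amin am _ k; rewrite uE; case: eqVneq => [<-|_]; lia.
  + move=> m /amin am /eqP/negP/negP mi k; rewrite mnmDE mnm1E uE.
    by case: eqVneq => [<-|_]; move: am mi; lia.
- apply/negP => /eqP q0; move: (m0r); rewrite mcoeff_msupp.
  have : 0 = mcoeff m0 (\sum_(m <- msupp rho | (m i == a) == true)
      mcoeff m rho *: mpolyX R m).
    rewrite -(qE true u) ?q0 ?mulr0 ?mcoeff0 // => m /amin am _ k.
    by rewrite uE; case: eqVneq => [<-|_]; lia.
  rewrite (raddf_sum (mcoeff m0)) big_mkcond (bigD1_seq m0) ?msupp_uniq //=.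
  have -> : (m0 i == a) = true by apply/eqP.
  rewrite eqxx mcoeffZ mcoeffX eqxx mulr1 big1 ?addr0 => [<-|m mm0].
    by rewrite eqxx.
  by case: ifP => // _; rewrite mcoeffZ mcoeffX (negPf mm0) mulr0.
- move=> m /msupp_sum_le /flattenP[s /mapP[m']].
  rewrite mem_filter eqb_id => /andP[/eqP m'i _] -> /msuppZ_le.
  by rewrite msuppX inE => /eqP->; rewrite mnmBE uE eqxx m'i; lia.
Qed.

Section Substitution.
Variables (R : comNzRingType).

Lemma mmap_eq_on n k (f g : 'I_n -> pol k R) (p : pol n R) :
  (forall m i, m \in msupp p -> m i != 0%N -> f i = g i) ->
  msubst f p = msubst g p.
Proof.
move=> fg; rewrite /msubst /mmap; apply: eq_big_seq => m mp.
congr (_ * _); apply: eq_bigr => i _.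
by have [->|mi] := eqVneq (m i) 0%N; rewrite ?expr0 ?(fg m i).
Qed.

Lemma msubst_var n (p : pol n R) : msubst (fun i => var i) p = p.
Proof.
elim/mpoly_ring_ind: p => [c|i|p q IHp IHq|p q IHp IHq].
- by rewrite msubstC.
- by rewrite msubstX.
- by rewrite rmorphD /= IHp IHq.
- by rewrite rmorphM /= IHp IHq.
Qed.

Lemma msubst_comp n k l (f : 'I_n -> pol k R) (g : 'I_k -> pol l R) p :
  msubst g (msubst f p) = msubst (fun i => msubst g (f i)) p.
Proof.
elim/mpoly_ring_ind: p => [c|i|p q IHp IHq|p q IHp IHq].
- by rewrite !msubstC.
- by rewrite !msubstX.
- by rewrite !rmorphD /= IHp IHq.
- by rewrite !rmorphM /= IHp IHq.
Qed.

End Substitution.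

Section OnlyVars.
Variables (C : numFieldType) (n : nat).
Implicit Types (A : {set 'I_n}) (p q : pol n C).

Lemma only_varsD A p q : only_vars A p -> only_vars A q -> only_vars A (p + q).
Proof.
by move=> pA qA m /msuppD_le; rewrite mem_cat => /orP[/pA|/qA].
Qed.

Lemma only_varsM A p q : only_vars A p -> only_vars A q -> only_vars A (p * q).
Proof.
move=> pA qA m /msuppM_le /allpairsP[[a b] /= [/pA ap /qA bq ->]] k kA.
by rewrite mnmDE ap ?bq.
Qed.

Lemma only_varsC A (c : C) : @only_vars C n A (mpolyC n c).
Proof.
move=> m; rewrite msuppC; case: ifP => // _; rewrite inE => /eqP-> k _.
exact: mnm0E.
Qed.

Lemma only_varsX A i : i \in A -> @only_vars C n A (var i).
Proof.
move=> iA m; rewrite msuppX inE => /eqP-> k kA; rewrite mnm1E.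
by case: eqVneq => // ik; rewrite -ik iA in kA.
Qed.

Lemma only_vars_msubst A k (f : 'I_k -> pol n C) (p : pol k C) :
  (forall m i, m \in msupp p -> m i != 0%N -> only_vars A (f i)) ->
  only_vars A (msubst f p).
Proof.
move=> fA; rewrite /msubst /mmap big_seq.
apply: (big_ind (@only_vars C n A)) => [|q r|m mp]; first by rewrite -(mpolyC0 n); apply: only_varsC.
  exact: only_varsD.
apply: only_varsM; first exact: only_varsC.
apply: (big_ind (@only_vars C n A)) => [|q r|i _].
- exact: (only_varsC (c := 1)).
- exact: only_varsM.
have [->|mi] := eqVneq (m i) 0%N; first exact: (only_varsC (c := 1)).
elim: (m i) => [|e IHe]; first exact: (only_varsC (c := 1)).
by rewrite exprS; apply: only_varsM IHe; apply: fA mi.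
Qed.

Lemma mderiv_only_vars A i p : only_vars A p -> i \notin A -> mderiv i p = 0.
Proof.
move=> pA iA; apply/mpolyP => m; rewrite mcoeff0 mcoeff_deriv.
rewrite memN_msupp_eq0 ?mul0rn //; apply/negP => /pA/(_ i iA)/eqP.
by rewrite mnmDE mnm1E eqxx addn1.
Qed.

Lemma only_vars_mderiv A i p : only_vars A p -> only_vars A (mderiv i p).
Proof.
move=> pA m; rewrite mcoeff_msupp mcoeff_deriv => mp k kA.
have /pA/(_ k kA)/eqP : mnm_add m (mnm1 i) \in msupp p.
  by rewrite mcoeff_msupp; apply: contraNneq mp => ->; rewrite mul0rn.
by rewrite mnmDE addn_eq0 => /andP[/eqP].
Qed.

Lemma only_vars_mderiv0 A i p :
  only_vars (i |: A) p -> mderiv i p = 0 -> only_vars A p.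
Proof.
move=> pA pi m mp k kA; have [ik|ik] := eqVneq i k; last first.
  by apply: (pA m mp); rewrite !inE negb_or eq_sym ik.
apply/eqP; apply: contraT => mk; move: mp; rewrite mcoeff_msupp.
have := mcoeff_deriv i (mnm_sub m (mnm1 i)) p.
rewrite pi mcoeff0 submK ?lep1mP ?ik // => /esym/eqP.
by rewrite mulrn_eq0 /= => ->.
Qed.

End OnlyVars.

Section TranscendenceBasis.
Variables (C : numFieldType) (n : nat) (P : set (pol n C)).
Hypothesis prP : prime P.

Definition indep_vars (I : {set 'I_n}) :=
  forall p, only_vars I p -> P p -> p = 0.

Lemma prime_const c : P (mpolyC n c) -> c = 0.
Proof.
move=> Pc; apply/eqP; apply: contraT => c0; case: (prime1 prP).
by rewrite -(mpolyC1 n) -(mulVf c0) mpolyCM; apply: (idealM prP).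
Qed.

Lemma prime_natmul k p : P (p *+ k.+1) -> P p.
Proof.
move=> Pk; have -> : p = mpolyC n (k.+1%:R^-1) * (p *+ k.+1).
  by rewrite mulrnAr -mulrnAl -mpolyCMn -(mulr_natr (k.+1%:R^-1)) mulVf ?pnatr_eq0 // mul1r.
exact: (idealM prP).
Qed.

(** In a relation of least degree the derivative in [j] has smaller degree and is nonzero, as the
    relation involves [j]; by minimality it is not in [P]. *)
Lemma minimal_relation I j : indep_vars I -> ~ indep_vars (j |: I) ->
  exists R, [/\ only_vars (j |: I) R, P R, ~ P (mderiv j R) & R != 0].
Proof.
move=> indI depIj.
pose rel k := `[< exists R, [/\ only_vars (j |: I) R, P R, R != 0 &
  mmeasure mdeg R = k] >].
have exk : exists k, rel k.
  move: depIj; rewrite -existsNE => -[R /not_implyP[RI /not_implyP[PR R0]]].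
  by exists (mmeasure mdeg R); apply/asboolP; exists R; split=> //; apply/eqP.
case: (ex_minnP exk) => k /asboolP[R [RI PR R0 Rk]] kmin.
exists R; split=> // PdR; have [dR0|dR0] := eqVneq (mderiv j R) 0.
  by move: R0; rewrite (indI R) ?eqxx //; apply: only_vars_mderiv0 dR0.
have /kmin : rel (mmeasure mdeg (mderiv j R)).
  by apply/asboolP; exists (mderiv j R); split=> //; apply: only_vars_mderiv.
by rewrite -Rk leqNgt msize_mderiv.
Qed.

Section Relations.
Variables (I : {set 'I_n}) (Rel : 'I_n -> pol n C).
Hypothesis indI : indep_vars I.
Hypothesis RelP : forall j, j \notin I ->
  [/\ only_vars (j |: I) (Rel j), P (Rel j), ~ P (mderiv j (Rel j))
    & Rel j != 0].

Let Rel_vars j : j \notin I -> only_vars (j |: I) (Rel j).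
Proof. by case/RelP. Qed.

Let Rel_in j : j \notin I -> P (Rel j).
Proof. by case/RelP. Qed.

Lemma rdeg_gt0 j : j \notin I -> (0 < rdeg Rel j)%N.
Proof.
move=> jI; rewrite lt0n; apply/eqP => r0.
have [_ PR _ /eqP[]] := RelP jI; apply: indI => // m mR k kI.
have [kj|kj] := eqVneq k j; last first.
  by apply: (Rel_vars jI mR); rewrite !inE negb_or kj.
apply/eqP; rewrite -leqn0 -r0 kj /rdeg.
exact: (@leq_bigmax_seq _ _ xpredT (fun m : mon n => m j)).
Qed.

Lemma prime_prod T (r : seq T) (A : pred T) (F : T -> pol n C) :
  (forall i, A i -> ~ P (F i)) -> ~ P (\prod_(i <- r | A i) F i).
Proof.
move=> FP; apply: (big_ind (fun x => ~ P x)) => // [|x y Px Py].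
  exact: prime1.
by case/(primeM prP).
Qed.

Lemma rleads_notin : ~ P (rleads I Rel).
Proof.
apply: prime_prod => j jI /indI l0; have [Rv PR _ R0] := RelP jI.
have {}l0 : rlead Rel j = 0.
  apply: l0 => m /(rlead_base Rel_vars jI) mb k /negPf kI.
  by apply/eqP; rewrite -leqn0; move: (mb k); rewrite kI.
have [m mR mr] : exists2 m : mon n, m \in msupp (Rel j) & m j = rdeg Rel j.
  have /hasP[m mR /eqP mj] : has (fun m : mon n => m j == rdeg Rel j) (msupp (Rel j)).
    apply: contraT => /hasPn no; have := rdeg_gt0 jI.
    suff : (rdeg Rel j <= (rdeg Rel j).-1)%N by lia.
    apply/bigmax_leqP_seq => m mR _; move: (no m mR).
    have : (m j <= rdeg Rel j)%N.
      exact: (@leq_bigmax_seq _ _ xpredT (fun m : mon n => m j)).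
    by lia.
  by exists m.
move: (mR); rewrite mcoeff_msupp (rlead_decomp Rel j) l0 mul0r add0r.
rewrite (raddf_sum (mcoeff m)) big1 ?eqxx // => m' m'r /=.
rewrite mcoeffZ mcoeffX; case: eqVneq => [mm'|_]; last by rewrite mulr0.
by rewrite -mr mm' eqxx in m'r.
Qed.

Lemma basis_dependence t (g : 'I_t -> pol n C) : (#|I| < t)%N ->
  exists2 rho : pol t C, rho != 0 & P (msubst g rho).
Proof.
move=> It; have [rho rho0 [K PK]] :=
  algebraic_dependence (prime_ideal prP) Rel_in Rel_vars rdeg_gt0 g It.
by exists rho => //; case/(primeM prP): PK => // /(primeX prP)/rleads_notin.
Qed.

Definition rel_ideal : set (pol n C) :=
  [set x | exists a : 'I_n -> pol n C, x = \sum_(j | j \notin I) a j * Rel j].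

Lemma ideal_rel_ideal : ideal rel_ideal.
Proof.
split=> [|_ _ [a ->] [b ->]|x _ [a ->]].
- by exists (fun=> 0); rewrite big1 // => j _; rewrite mul0r.
- exists (fun j => a j + b j); rewrite -big_split; apply: eq_bigr => j _ /=.
  by rewrite mulrDl.
- exists (fun j => x * a j); rewrite mulr_sumr; apply: eq_bigr => j _.
  by rewrite mulrA.
Qed.

Lemma rel_ideal_in j : j \notin I -> rel_ideal (Rel j).
Proof.
move=> jI; exists (fun k => (k == j)%:R); rewrite (bigD1 j) //= eqxx mul1r.
by rewrite big1 ?addr0 // => k /andP[_ /negPf->]; rewrite mul0r.
Qed.

Lemma rel_ideal_sub : rel_ideal `<=` P.
Proof.
move=> _ [a ->]; apply: (ideal_sum prP) => j jI.
by apply: (idealM prP); apply: Rel_in.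
Qed.

(* A lowest power of [h] in an algebraic relation between [h] and the variables
   in [I], read modulo the ideal of the relations [Rel]. *)
Lemma rel_ideal_power h : P h -> exists e a, ~ P e /\ rel_ideal (e * h ^+ a).
Proof.
move=> Ph; pose t := #|I|.+1.
pose g (l : 'I_t) := if unlift ord_max l is Some i then var (enum_val i) else h.
have [rho rho0 [K JK]] := algebraic_dependence ideal_rel_ideal
  rel_ideal_in Rel_vars rdeg_gt0 g (ltnSn _).
have [a [r0 [r1 [rhoE r00 r0i]]]] := low_part ord_max rho0.
exists (rleads I Rel ^+ K * (msubst g r0 + h * msubst g r1)), a; split; last first.
  move: JK; rewrite rhoE rmorphM /= rmorphD rmorphM rmorphXn /= msubstX.
  by rewrite /g unlift_none -mulrA [_ ^+ a * _]mulrC.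
case/(primeM prP) => [/(primeX prP)/rleads_notin //|].
move=> Ps; have {}Ps : P (msubst g r0).
  rewrite -(addrK (h * msubst g r1) (msubst g r0)); apply: (idealB prP Ps).
  exact: (idealMr prP).
have r0g m i : m \in msupp r0 -> m i != 0%N ->
    exists2 k, i = lift ord_max k & g i = var (enum_val k).
  move=> mr mi; rewrite /g; case: unliftP => [k ->|im]; first by exists k.
  by rewrite im (r0i m mr) in mi.
have {Ps} : msubst g r0 = 0.
  apply: indI Ps; apply: only_vars_msubst => m i mr mi.
  have [k _ ->] := r0g m i mr mi; apply: only_varsX; exact: enum_valP.
pose b (i : 'I_n) : pol t C :=
  \sum_(k < #|I| | enum_val k == i) var (lift ord_max k).
move=> /(congr1 (msubst b)); rewrite msubst_comp rmorph0 => r00'.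
case/negP: r00; rewrite -[r0]msubst_var -r00'; apply/eqP.
apply: mmap_eq_on => m i mr mi; have [k -> ->] := r0g m i mr mi.
rewrite msubstX /b (big_pred1 k) // => l.
by rewrite (inj_eq enum_val_inj).
Qed.

(** Implicit differentiation: moving the basis variable [i] and fixing the others forces the speed
    of each variable outside [I], and multiplying by all partials [mderiv j (Rel j)] clears
    denominators. The field kills every [Rel j], so it stabilises [rel_ideal]; [rel_ideal_power] and
    [prime_iter] carry this over to [P]. *)
Lemma tangent_fields : exists2 W, ~ P W &
  forall i, i \in I -> exists v : 'I_n -> pol n C,
    [/\ forall h, P h -> P (vfield v h), v i = W &
        forall k, k \in I -> k != i -> v k = 0].
Proof.
pose W := \prod_(j | j \notin I) mderiv j (Rel j).
exists W; first by apply: prime_prod => j /RelP[].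
move=> i iI; pose v k := if k \in I then (if k == i then W else 0) else
  - mderiv i (Rel k) * \prod_(l | (l \notin I) && (l != k)) mderiv l (Rel l).
exists v; split=> [h Ph||k kI ki]; last 2 first.
- by rewrite /v iI eqxx.
- by rewrite /v kI (negPf ki).
have [e [a [Pe Ja]]] := rel_ideal_power Ph.
apply: (prime_iter (J := rel_ideal) prP prime_natmul rel_ideal_sub _ Ph Pe Ja).
move=> _ [b ->]; rewrite der_sum; apply: (ideal_sum ideal_rel_ideal) => j jI.
rewrite derM; apply: (idealD ideal_rel_ideal).
  by apply: (idealM ideal_rel_ideal); apply: rel_ideal_in.
suff -> : vfield v (Rel j) = 0 by rewrite mulr0; apply: (ideal0 ideal_rel_ideal).
have ij : i != j by apply: contraNneq jI => <-.
rewrite vfieldE (bigD1 j) //= (bigD1 i) ?ij //= big1 => [|k /andP[kj ki]].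
  have WE : W = mderiv j (Rel j) *
      \prod_(l | (l \notin I) && (l != j)) mderiv l (Rel l).
    by rewrite /W (bigD1 j).
  by rewrite addr0 /v (negPf jI) iI eqxx WE; ring.
have [kI|kI] := boolP (k \in I); first by rewrite /v kI (negPf ki) mul0r.
rewrite (mderiv_only_vars (Rel_vars jI)) ?mulr0 //.
by rewrite !inE negb_or kj.
Qed.

End Relations.

(** [I] is an independent set of variables of largest size among those containing [I0]. Prescribing
    [I0] later yields fields that keep chosen coordinates fixed. *)
Theorem transcendence_basis (I0 : {set 'I_n}) : indep_vars I0 ->
  exists I : {set 'I_n}, [/\ I0 \subset I,
    forall t (g : 'I_t -> pol n C), (#|I| < t)%N ->
      exists2 rho : pol t C, rho != 0 & P (msubst g rho) &
    exists2 W, ~ P W & forall i, i \in I -> exists v : 'I_n -> pol n C,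
      [/\ forall h, P h -> P (vfield v h), v i = W &
          forall k, k \in I -> k != i -> v k = 0]].
Proof.
move=> indI0.
pose good I := `[< indep_vars I >] && (I0 \subset I).
have good0 : good I0 by rewrite /good subxx andbT; apply/asboolP.
have [I /andP[/asboolP indI I0I] Imax] := @arg_maxnP _ I0 good (fun I => #|I|) good0.
have /choice[Rel RelP] j : exists R, j \notin I ->
    [/\ only_vars (j |: I) R, P R, ~ P (mderiv j R) & R != 0].
  have [jI|jI] := boolP (j \in I); first by exists 0.
  have [|R RP] := @minimal_relation I j indI; last by exists R.
  move=> indjI; have : (#|j |: I| <= #|I|)%N.
    apply: Imax; rewrite /good (fintype.subset_trans I0I (finset.subsetUr _ _)).
    by rewrite andbT; apply/asboolP.
  by rewrite cardsU1 jI ltnn.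
exists I; split=> //; first by move=> t g; apply: (basis_dependence indI RelP).
by case: (tangent_fields indI RelP) => W PW vP; exists W.
Qed.

End TranscendenceBasis.


(** * Dickson's lemma and reduction by leading monomials *)

(** Induction on the number [k] of coordinates compared: monomials whose next coordinate is at least
    its maximum [N] on the list found so far are dominated by that list, and each of the finitely
    many smaller values gets a list of its own. *)
Lemma dickson n (U : set (mon n)) : exists2 s : seq (mon n),
  (forall m, m \in s -> U m) &
  forall m, U m -> exists2 m', m' \in s & lem m' m.
Proof.
suff /(_ n U)[s sU sP] : forall k (V : set (mon n)), exists2 s : seq (mon n),
    (forall m, m \in s -> V m) &
    forall m, V m -> exists2 m', m' \in s & forall i : 'I_n, (i < k)%N -> (m' i <= m i)%N.
  exists s => // m /sP[m' m's mm']; exists m' => //.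
  by apply/mnm_lepP => i; apply: mm'.
elim=> [|k IHk] V.
  have [[m0 Vm0]|V0] := pselect (exists m, V m).
    by exists [:: m0] => [m|m _]; [rewrite inE => /eqP->|exists m0; rewrite ?mem_head].
  by exists [::] => // m Vm; case: V0; exists m.
have [kn|nk] := ltnP k n; last first.
  have [s sV sP] := IHk V; exists s => // m /sP[m' m's mm'].
  by exists m' => // i _; apply: mm'; apply: leq_trans (ltn_ord i) nk.
pose ik := Ordinal kn; have [s0 s0V s0P] := IHk V.
have /choice[s sP] c : exists s : seq (mon n),
    (forall m, m \in s -> V m /\ m ik = c) /\
    forall m, V m -> m ik = c ->
      exists2 m', m' \in s & forall i : 'I_n, (i < k)%N -> (m' i <= m i)%N.
  have [s sV sP] := IHk [set m | V m /\ m ik = c].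
  by exists s; split=> // m Vm mc; apply: sP.
pose N := \max_(m <- s0) m ik.
exists (s0 ++ flatten [seq s c | c <- iota 0 N]).
  move=> m; rewrite mem_cat => /orP[/s0V//|/flatten_mapP[c _ ]].
  by case: (sP c) => sV _ /sV[].
move=> m Vm; have [Nm|mN] := leqP N (m ik).
  have [m' m's mm'] := s0P m Vm; exists m'; first by rewrite mem_cat m's.
  move=> i; rewrite ltnS leq_eqVlt => /orP[/eqP ik'|/mm'//].
  have -> : i = ik by apply/val_inj.
  by apply: leq_trans Nm; apply: (@leq_bigmax_seq _ _ xpredT (fun m : mon n => m ik)).
have [m' m's mm'] := (sP (m ik)).2 m Vm erefl; exists m'.
  rewrite mem_cat; apply/orP; right; apply/flatten_mapP; exists (m ik) => //.
  by rewrite mem_iota.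
move=> i; rewrite ltnS leq_eqVlt => /orP[/eqP ik'|/mm'//].
have -> : i = ik by apply/val_inj.
by rewrite ((sP (m ik)).1 m' m's).2.
Qed.

Section Reduction.
Variables (B : idomainType) (n : nat) (M : set (pol n B)).
Hypothesis idM : ideal M.

(** Normal forms modulo [M]. Multiples of leading monomials are again leading monomials when [M] is
    an ideal, so divisibility need not be mentioned. *)
Definition standard (r : pol n B) :=
  forall m, m \in msupp r -> forall p, M p -> p != 0 -> mlead p != m.

Lemma standardD p q : standard p -> standard q -> standard (p + q).
Proof.
by move=> sp sq m /msuppD_le; rewrite mem_cat => /orP[/sp|/sq].
Qed.

Lemma standardZ c p : standard p -> standard (c *: p).
Proof. by move=> sp m /msuppZ_le/sp. Qed.

Lemma standard_eq0 r : standard r -> M r -> r = 0.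
Proof.
move=> sr Mr; apply/eqP; apply: contraT => r0.
by have := sr _ (mlead_supp r0) r Mr r0; rewrite eqxx.
Qed.

Lemma mlead_lt (p : pol n B) (m : mon n) : p != 0 ->
  (forall u, u \in msupp p -> (u <= m)%O) -> mcoeff m p = 0 -> (mlead p < m)%O.
Proof.
move=> p0 pm pm0; rewrite lt_neqAle pm ?mlead_supp // andbT.
apply/eqP => pm'; move: (mlead_supp p0).
by rewrite mcoeff_msupp pm' pm0 eqxx.
Qed.

(* A Groebner basis over the fraction field, with a common denominator [h]. *)
Theorem reduction : exists2 h : B, h != 0 & exists2 gs : seq (pol n B),
  (forall g, g \in gs -> M g) &
  forall (b : set B) (D : set (pol n B)),
    b 0 -> (forall x y, b x -> b y -> b (x + y)) ->
    (forall x y, b y -> b (x * y)) ->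
    D 0 -> (forall x y, D x -> D y -> D (x + y)) ->
    (forall c x, D x -> D (c *: x)) ->
    (forall c u g, b c -> g \in gs -> D (c *: (mpolyX B u * g))) ->
    forall w, (forall m, b (mcoeff m w)) -> exists N r,
      [/\ D (h ^+ N *: w - r), forall m, b (mcoeff m r) & standard r].
Proof.
have [s sU sP] := dickson [set m | exists p, [/\ M p, p != 0 & mlead p = m]].
have /choice[G GP] (m : mon n) : exists g, m \in s -> [/\ M g, g != 0 & mlead g = m].
  by have [/sU[g gP]|_] := boolP (m \in s); [exists g|exists 0].
(* Each cancellation of a leading term divides by the leading coefficient of one of the chosen basis
   elements, so their product suffices as denominator. *)
pose h := \prod_(m <- s) mleadc (G m).
exists h.
  rewrite /h prodf_seq_neq0; apply/allP => m /GP[_ G0 _] /=.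
  by rewrite mleadc_eq0.
exists [seq G m | m <- s] => [_ /mapP[m /GP[MG _ _] ->] //|].
move=> b D b0 bD bM D0 DD DZ Dg.
have bB x y : b x -> b y -> b (x - y).
  by move=> bx by'; apply: bD => //; rewrite -mulN1r; apply: bM.
have step w : (forall q, q = 0 \/ (mlead q < mlead w)%O -> (forall m, b (mcoeff m q)) ->
    exists N r, [/\ D (h ^+ N *: q - r), forall m, b (mcoeff m r) & standard r]) ->
  w != 0 -> (forall m, b (mcoeff m w)) ->
    exists N r, [/\ D (h ^+ N *: w - r), forall m, b (mcoeff m r) & standard r].
  move=> IH w0 bw; pose mu := mlead w.
  have lt0 (q : pol n B) : (forall u, u \in msupp q -> (u <= mu)%O) -> mcoeff mu q = 0 ->
      q = 0 \/ (mlead q < mu)%O.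
    move=> qm q0; have [|qn] := eqVneq q 0; [by left|right].
    exact: (mlead_lt qn qm q0).
  have [[p [Mp p0 pmu]]|nolead] := pselect (exists p, [/\ M p, p != 0 & mlead p = mu]).
    have [m ms mmu] : exists2 m', m' \in s & lem m' mu by apply: sP; exists p.
    have [MG G0 Gm] := GP m ms.
    pose h' := \prod_(m' <- rem m s) mleadc (G m').
    have hE : h = mleadc (G m) * h' by rewrite /h (big_rem m).
    pose u := mnm_sub mu m; have umu : mnm_add u m = mu by rewrite submK.
    pose w1 := h *: w - (mcoeff mu w * h') *: (mpolyX B u * G m).
    have cX v : mcoeff (mnm_add u v) (mpolyX B u * G m) = mcoeff v (G m).
      by rewrite mulrC mcoeffMX.
    have w1b v : b (mcoeff v w1).
      rewrite mcoeffB !mcoeffZ; apply: bB; first exact: bM.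
      by rewrite -mulrA mulrC; apply: bM.
    have [|N [r [Dr br sr]]] := IH w1 _ w1b.
      apply: lt0 => [v|]; last first.
        rewrite mcoeffB !mcoeffZ -{3}umu cX -{1}Gm hE; ring.
      move/msuppB_le; rewrite mem_cat => /orP[/msuppZ_le/msupp_le_mlead//|].
      move/msuppZ_le/msuppM_le/allpairsP => [[x y] /= []].
      rewrite msuppX inE => /eqP-> yG ->; rewrite -umu lemc_add2r -Gm.
      exact: msupp_le_mlead.
    exists N.+1, r; split=> //.
    have -> : h ^+ N.+1 *: w - r = h ^+ N *: w1 - r +
        h ^+ N *: ((mcoeff mu w * h') *: (mpolyX B u * G m)).
      by rewrite /w1 scalerBr [h ^+ N *: (h *: w)]scalerA -exprSr addrAC subrK.
    apply: DD => //; apply: DZ; apply: Dg; last exact: map_f.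
    by rewrite mulrC; apply: bM.
  pose w1 := w - mcoeff mu w *: mpolyX B mu.
  have w1b v : b (mcoeff v w1).
    by rewrite mcoeffB mcoeffZ mulrC; apply: bB => //; apply: bM.
  have [|N [r [Dr br sr]]] := IH w1 _ w1b.
    apply: lt0 => [v|]; last by rewrite mcoeffB mcoeffZ mcoeffX eqxx mulr1 subrr.
    move/msuppB_le; rewrite mem_cat => /orP[/msupp_le_mlead//|].
    by move/msuppZ_le; rewrite msuppX inE => /eqP->.
  exists N, (r + h ^+ N *: (mcoeff mu w *: mpolyX B mu)); split.
  - by move: Dr; rewrite /w1 scalerBr opprD addrA addrAC.
  - move=> v; rewrite mcoeffD; apply: bD => //.
    by rewrite !mcoeffZ; apply: (bM); rewrite mulrC; apply: bM.
  - apply: standardD => //; do 2 apply: standardZ; move=> v.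
    rewrite msuppX inE => /eqP-> p Mp p0; apply/eqP => pmu.
    by apply: nolead; exists p.
move=> w; have zero : exists N r,
    [/\ D (h ^+ N *: 0 - r), forall m, b (mcoeff m r) & standard r].
  exists 0%N, 0; split=> [|m|m]; rewrite ?mcoeff0 ?scaler0 ?subrr //.
  by rewrite msupp0.
elim/mleadrect: w => w IHw bw.
have [->|w0] := eqVneq w 0; first exact: zero.
by apply: step => // q [->|/IHw]; last exact.
Qed.

End Reduction.


(** * Noetherianity and the Nullstellensatz *)

(** Reduce [w] in [M], recording the subtracted part in [J] and [M] at once: the remainder is
    standard and in [M], hence zero, and the denominator is a unit of the field. *)
Lemma noetherian (C : fieldType) n (M : set (pol n C)) : ideal M ->
  exists2 gs : seq (pol n C), (forall g, g \in gs -> M g) &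
    forall J, ideal J -> (forall g, g \in gs -> J g) -> M `<=` J.
Proof.
move=> idM; have [h h0 [gs gsM gsP]] := reduction M.
exists gs => // J idJ gsJ w Mw.
have scale (K : set (pol n C)) c x : ideal K -> K x -> K (c *: x).
  by move=> idK Kx; rewrite -mul_mpolyC; apply: idealM.
have [|||||||//|N [r [[Jr Mr] _ sr]]] := gsP setT (J `&` M) _ _ _ _ _ _ _ w.
- by [].
- by [].
- by [].
- by split; apply: ideal0.
- by move=> x y [Jx Mx] [Jy My]; split; apply: idealD.
- by move=> c x [Jx Mx]; split; apply: scale.
- move=> c u g _ gs'; split; apply: scale => //.
    by apply: idealM => //; apply: gsJ.
  by apply: idealM => //; apply: gsM.
have Mhw : M (h ^+ N *: w) by apply: scale.
have r0 : r = 0.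
  by apply: (standard_eq0 (M := M)) => //; apply: ideal_subl Mr Mhw.
rewrite r0 subr0 in Jr; rewrite -(scale1r w) -(mulVf (expf_neq0 N h0)) -scalerA.
exact: scale.
Qed.

(** The union of a chain of ideals is finitely generated, hence a member of the chain, so Zorn's
    lemma applies to an arbitrary property [bad]. *)
Lemma maximal_ideal (C : fieldType) n (bad : set (set (pol n C))) I :
    ideal I -> bad I ->
  exists J, [/\ ideal J, bad J, I `<=` J &
    forall J', ideal J' -> bad J' -> J `<=` J' -> J' `<=` J].
Proof.
move=> idI badI.
pose good A := A = set0 \/ [/\ ideal A, bad A & I `<=` A].
have [|A [goodA Amax]] := @Zorn_bigcup _ good; last first.
  have [A0|[idA badA IA]] := goodA.
    have [] := Amax I; last by right; split.
    rewrite A0; split=> // I0; exact: (I0 0 (ideal0 idI)).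
  exists A; split=> // J' idJ' badJ' AJ'; apply: contrapT => J'A.
  apply: (Amax J'); first by split.
  by right; split=> //; apply: subset_trans AJ'.
move=> F Fgood totF; pose U := \bigcup_(X in F) X; rewrite -/U.
have [|U0] := pselect (U = set0); first by left.
have [x0 [X0 FX0 X0x0]] : U !=set0.
  by apply: contrapT => nU; apply: U0; apply/seteqP; split=> // x Ux; case: nU; exists x.
have idF X x : F X -> X x -> ideal X.
  by move=> /Fgood[->//|[]].
have chain X Y : F X -> F Y -> X `<=` Y \/ Y `<=` X by apply: totF.
have idU : ideal U.
  split=> [|x y [X FX Xx] [Y FY Yy]|x y [Y FY Yy]].
  - by exists X0 => //; apply: (ideal0 (idF _ _ FX0 X0x0)).
  - have [XY|YX] := chain _ _ FX FY.
      by exists Y => //; apply: (idealD (idF _ _ FY Yy)) => //; apply: XY.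
    by exists X => //; apply: (idealD (idF _ _ FX Xx)) => //; apply: YX.
  - by exists Y => //; apply: (idealM (idF _ _ FY Yy)).
have [gs gsU gsP] := noetherian idU.
have [X FX [Xx0 gsX]] : exists2 X, F X & X x0 /\ forall g, g \in gs -> X g.
  elim: gs gsU {gsP} => [|g gs IHgs] gsU; first by exists X0.
  have [|X FX [Xx0 gsX]] := IHgs.
    by move=> g' g's; apply: gsU; rewrite inE g's orbT.
  have [Y FY Yg] := gsU g (mem_head _ _).
  have [XY|YX] := chain _ _ FX FY.
    exists Y => //; split; first exact: XY.
    by move=> g'; rewrite inE => /orP[/eqP->//|/gsX/XY].
  exists X => //; split=> // g'; rewrite inE => /orP[/eqP->|/gsX//].
  exact: YX.
suff -> : U = X by apply: Fgood.
apply/seteqP; split; last by move=> x Xx; exists X.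
by apply: gsP gsX; apply: idF Xx0.
Qed.

Definition ideal_add (Q : comNzRingType) (J : set Q) (a : Q) : set Q :=
  [set x | exists j s, J j /\ x = j + s * a].

Lemma ideal_add_ideal (Q : comNzRingType) (J : set Q) a :
  ideal J -> ideal (ideal_add J a).
Proof.
move=> idJ; split=> [|_ _ [i [s [Ji ->]]] [j [t [Jj ->]]]|x _ [j [s [Jj ->]]]].
- by exists 0, 0; rewrite mul0r addr0; split=> //; apply: ideal0.
- exists (i + j), (s + t); split; first exact: idealD.
  by rewrite mulrDl addrACA.
- exists (x * j), (x * s); split; first exact: idealM.
  by rewrite mulrDr mulrA.
Qed.

Lemma ideal_add_sub (Q : comNzRingType) (J : set Q) a : J `<=` ideal_add J a.
Proof. by move=> j Jj; exists j, 0; rewrite mul0r addr0. Qed.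

Lemma ideal_add_in (Q : comNzRingType) (J : set Q) a : ideal J -> ideal_add J a a.
Proof.
by move=> idJ; exists 0, 1; rewrite mul1r add0r; split=> //; apply: ideal0.
Qed.

Lemma infinite_fiber (T : choiceType) (f : T -> nat * nat) :
  ~ countable [set: T] -> exists y, infinite_set (f @^-1` [set y]).
Proof.
move=> ncT; apply: contrapT => /forallNP fin; apply: ncT.
have -> : [set: T] = \bigcup_(y in [set: nat * nat]) f @^-1` [set y].
  by apply/seteqP; split=> // x _; exists (f x).
apply: bigcup_countable => // y _; apply: finite_set_countable.
by apply: contrapT; apply: fin.
Qed.

Section Nullstellensatz.
Variables (C : numClosedFieldType) (n : nat).
Hypothesis ncC : ~ countable [set: C].

(* A countable-dimensional field extension of the uncountable algebraically
   closed field [C] is trivial, as the [(X - a)^-1] are linearly independent. *)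
Lemma prime_has_root (P : set (pol n C)) (q : pol n C) i : prime P -> ~ P q ->
  (forall a, exists N s, P (q ^+ N - s * (var i - mpolyC n a))) ->
  exists a, P (var i - mpolyC n a).
Proof.
move=> prP Pq; move=> /choice[N /choice[s sP]].
(* Among uncountably many [a], infinitely many share the exponent [k] and the degree bound [d];
   taking more of them than there are monomials of that degree makes the [s a] linearly
   dependent. *)
have [[k d] infkd] := infinite_fiber (fun a => (N a, mmeasure mdeg (s a))) ncC.
pose T : seq (mon n) := [seq bmnm m | m : bmultinom n d].
have [Y YA sY] := infinite_set_fset (size T).+1 infkd.
have Yj (j : 'I_(size T).+1) : (j < size Y)%N by apply: leq_trans (ltn_ord j) sY.
pose a (j : 'I_(size T).+1) := nth 0 Y j.
have ainj : injective a.
  move=> j l /eqP; rewrite /a nth_uniq ?fset_uniq ?Yj // => /eqP jl.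
  exact/val_inj.
have aP j : N (a j) = k /\ mmeasure mdeg (s (a j)) = d.
  have /YA[-> ->//] : [set` Y] (a j) by apply: mem_nth; apply: Yj.
have [||c [j0 cj0] c0] := @mpoly_lin_dep C n T _ (fun j => s (a j)).
- move=> j m mj; have := @mmeasure_mnm_lt _ _ mdeg _ _ mj; rewrite (aP j).2 => /= md.
  by apply/mapP; exists (BMultinom md); rewrite ?mem_enum.
- by rewrite card_ord.
pose l j := var i - mpolyC n (a j).
(* The dependence with denominators cleared. It is nonzero because only the term [j0] survives at
   [a j0], while its value at [var i] lies in [P], and hence so does one of its linear factors. *)
pose R := \sum_j c j *: \prod_(m | m != j) ('X - (a m)%:P).
pose phi (p : {poly C}) := (map_poly (@mpolyC n C) p).[var i].
have phil b : phi ('X - b%:P) = var i - mpolyC n b.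
  by rewrite /phi rmorphB /= map_polyX map_polyC !hornerE.
have phiM p p' : phi (p * p') = phi p * phi p' by rewrite /phi rmorphM hornerM.
have phiZ b p : phi (b *: p) = mpolyC n b * phi p.
  by rewrite /phi -mul_polyC rmorphM /= map_polyC hornerM hornerC.
have phi_prod (J : Type) (r : seq J) (A : pred J) F :
    phi (\prod_(m <- r | A m) F m) = \prod_(m <- r | A m) phi (F m).
  by apply: (big_morph phi phiM); rewrite /phi rmorph1 hornerC.
have PR : P (phi R).
  suff : P (q ^+ k * phi R) by case/(primeM prP) => // /(primeX prP).
  have phiR : phi R = \sum_j c j *: \prod_(m | m != j) l m.
    rewrite /phi raddf_sum horner_sum; apply: eq_bigr => j _.
    rewrite -/(phi _) phiZ phi_prod mul_mpolyC; congr (_ *: _).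
    by apply: eq_bigr => m _; apply: phil.
  have z0 : \sum_j c j *: (s (a j) * l j * \prod_(m | m != j) l m) = 0.
    transitivity ((\sum_j c j *: s (a j)) * \prod_m l m); last by rewrite c0 mul0r.
    rewrite mulr_suml; apply: eq_bigr => j _.
    by rewrite -scalerAl -mulrA [in RHS](bigD1 j).
  have -> : q ^+ k * phi R = \sum_j (q ^+ k * (c j *: \prod_(m | m != j) l m) -
      c j *: (s (a j) * l j * \prod_(m | m != j) l m)).
    by rewrite sumrB z0 subr0 phiR mulr_sumr.
  apply: (ideal_sum prP) => j _; rewrite -scalerAr -scalerBr -mulrBl.
  rewrite -mul_mpolyC; apply: (idealM prP); apply: (idealMr prP).
  by have := sP (a j); rewrite (aP j).1.
have R0 : R != 0.
  apply: contra_neq cj0 => /(congr1 (fun p => p.[a j0])).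
  rewrite horner0 horner_sum (bigD1 j0) //= [X in _ + X]big1 => [|j jj0].
    rewrite addr0 hornerZ horner_prod => /eqP; rewrite mulf_eq0 => /orP[/eqP//|].
    rewrite prodf_seq_eq0 => /hasP[m _ /andP[mj]].
    by rewrite hornerXsubC subr_eq0 (inj_eq ainj) eq_sym (negPf mj).
  by rewrite hornerZ horner_prod (bigD1 j0) ?[_ == j]eq_sym //= hornerXsubC subrr mul0r mulr0.
have [r rE] := closed_field_poly_normal R.
move: PR; rewrite rE phiZ phi_prod => /(primeM prP)[/(prime_const prP)/eqP|].
  by rewrite lead_coef_eq0 (negPf R0).
elim: r {rE} => [|b r IHr]; first by rewrite big_nil => /(prime1 prP).
by rewrite big_cons phil => /(primeM prP)[Pb|/IHr//]; exists b.
Qed.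

(** Any ideal strictly above [P] contains a power of [q]; in other words the quotient by [P],
    localised at [q], is a field. *)
Lemma maximal_avoiding_prime (P : set (pol n C)) q : ideal P ->
    (forall N, ~ P (q ^+ N)) ->
    (forall J, ideal J -> (forall N, ~ J (q ^+ N)) -> P `<=` J -> J `<=` P) ->
  prime P /\ forall a, ~ P a -> exists N s, P (q ^+ N - s * a).
Proof.
move=> idP Pq Pmax.
have add a : ~ P a -> exists N s, P (q ^+ N - s * a).
  move=> Pa; have [allN|/existsNP[N /contrapT[j [s [Pj jE]]]]] :=
    pselect (forall N, ~ ideal_add P a (q ^+ N)).
    case: Pa; apply: (Pmax _ (ideal_add_ideal a idP) allN).
      exact: ideal_add_sub.
    exact: ideal_add_in.
  by exists N, s; rewrite jE addrK.
split=> //; split=> //; first by move=> P1; apply: (Pq 0%N).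
move=> x y Pxy; apply: contrapT => /not_orP[/add[N [s Ps]] /add[M [t Pt]]].
apply: (Pq (N + M)%N); rewrite exprD.
have -> : q ^+ N * q ^+ M = (q ^+ N - s * x) * q ^+ M +
    s * x * (q ^+ M - t * y) + s * t * (x * y) by ring.
apply: idealD => //; last exact: idealM.
by apply: idealD => //; [apply: idealMr | apply: idealM].
Qed.

(** In an ideal maximal among those above [J] without powers of [q], each variable is congruent to a
    constant by [prime_has_root]; these constants are the coordinates of the point. *)
Theorem nullstellensatz (J : set (pol n C)) q : ideal J ->
    (forall N, ~ J (q ^+ N)) ->
  exists2 v : 'rV[C]_n, forall p, J p -> ev v p = 0 & ev v q != 0.
Proof.
move=> idJ Jq; have [P [idP Pq JP Pmax]] :=
  @maximal_ideal C n [set J | forall N, ~ J (q ^+ N)] J idJ Jq.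
have [prP add] := maximal_avoiding_prime idP Pq Pmax.
have /choice[a aP] i : exists a, P (var i - mpolyC n a).
  have [//|no] := pselect (exists a, P (var i - mpolyC n a)).
  apply: (prime_has_root prP (Pq 1%N)) => a; apply: add => Pa.
  by apply: no; exists a.
pose v := \row_i a i; have Pv p : P (p - mpolyC n (ev v p)).
  elim/mpoly_ring_ind: p => [c|i|p p' Pp Pp'|p p' Pp Pp'].
  - by rewrite evC subrr; apply: ideal0.
  - by rewrite evX mxE.
  - by rewrite rmorphD mpolyCD opprD addrACA; apply: idealD.
  - rewrite rmorphM mpolyCM /=; have -> : p * p' - mpolyC n (ev v p) * mpolyC n (ev v p')
      = (p - mpolyC n (ev v p)) * p' + mpolyC n (ev v p) * (p' - mpolyC n (ev v p')) by ring.
    by apply: idealD => //; [apply: idealMr|apply: idealM].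
exists v => [p /JP Pp|].
  by apply: (prime_const prP); apply: ideal_subl (Pv p) Pp.
apply/eqP => qv; apply: (Pq 1%N); have := Pv q.
by rewrite qv mpolyC0 subr0.
Qed.

End Nullstellensatz.


(** * Laurent polynomials as polynomials on the torus *)

Lemma evZ (R : comNzRingType) n (v : 'rV[R]_n) c p : ev v (c *: p) = c * ev v p.
Proof. exact: mevalZ. Qed.

Section LaurentEvaluation.
Variables (C : fieldType) (n : nat).
Implicit Types (f g : laurent C n) (a : 'rV[int]_n) (x : 'rV[C]_n).

Lemma leval_sub (D : {fset 'rV[int]_n}) f x : (lsupp f `<=` D)%fset ->
  leval f x = \sum_(a <- D) lcoef f a * xpow x a.
Proof.
move=> fD; rewrite /leval (big_fset_incl _ fD) // => a aD af.
by rewrite /lcoef (mcoeff_outdom af) mul0r.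
Qed.

Lemma levalD f g x : leval (f + g) x = leval f x + leval g x.
Proof.
pose D := (lsupp f `|` lsupp g)%fset.
rewrite (@leval_sub D (f + g)) ?monalg.msuppD_le // (@leval_sub D f) ?fsubsetUl //.
rewrite (@leval_sub D g) ?fsubsetUr // -big_split; apply: eq_bigr => a _ /=.
by rewrite /lcoef monalg.mcoeffD mulrDl.
Qed.

Lemma leval0 x : leval (0 : laurent C n) x = 0.
Proof. by rewrite /leval /lsupp monalg.msupp0 big_seq_fset0. Qed.

Lemma levalZ c f x : leval (c *: f) x = c * leval f x.
Proof.
rewrite (@leval_sub (lsupp f) (c *: f)) ?monalg.msuppZ_le //.
rewrite /leval mulr_sumr; apply: eq_bigr => a _.
by rewrite /lcoef monalg.mcoeffZ mulrA.
Qed.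

Lemma leval_sum I (r : seq I) (P : pred I) (F : I -> laurent C n) x :
  leval (\sum_(i <- r | P i) F i) x = \sum_(i <- r | P i) leval (F i) x.
Proof. exact: (big_morph (fun f => leval f x) (fun f g => levalD f g x) (leval0 x)). Qed.

Lemma leval_monom c a x : leval (lmonom c a) x = c * xpow x a.
Proof.
rewrite (@leval_sub [fset a]%fset) ?monalg.msuppU_le // big_seq_fset1.
by rewrite /lcoef /lmonom mcoeffUU.
Qed.

Lemma leval_mul_system r s (M : 'M[C]_(r, s)) F i x :
  leval (mul_system M F i) x = \sum_j M i j * leval (F j) x.
Proof. by rewrite leval_sum; apply: eq_bigr => j _; rewrite levalZ. Qed.

Lemma leval_lin_system m r (A : 'M[int]_(n, m)) (c : 'M[C]_(r, m)) i x :
  leval (lin_system A c i) x = \sum_k c i k * xpow x (col k A)^T.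
Proof. by rewrite leval_sum; apply: eq_bigr => j _; rewrite leval_monom. Qed.

(** Exponent of the monomial multiplied by the [N]-th power of the product of all variables; under
    [bounds N a] the absolute value changes nothing. *)
Definition shift_mon (N : nat) a : mon n :=
  Multinom [tuple absz (a 0 i + N%:Z) | i < n].

Definition lpoly N f : pol n C :=
  \sum_(a <- lsupp f) lcoef f a *: mpolyX C (shift_mon N a).

Definition xall x : C := \prod_i x 0 i.

Lemma ev_mon x (m : mon n) : ev x (mpolyX C m) = \prod_i x 0 i ^+ m i.
Proof. exact: mevalX. Qed.

Definition bounds (N : nat) a := forall i, 0 <= a 0 i + N%:Z.

Lemma shift_monE N a i : bounds N a -> (shift_mon N a i : int) = a 0 i + N%:Z.
Proof. by move=> aN; rewrite /shift_mon mnmE gez0_abs. Qed.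

Lemma ev_shift_mon N a x : torus x -> bounds N a ->
  ev x (mpolyX C (shift_mon N a)) = xall x ^+ N * xpow x a.
Proof.
move=> tx aN; rewrite ev_mon /xall /xpow -prodrXl -big_split.
apply: eq_bigr => i _ /=; rewrite -[LHS]/(x 0 i ^ (shift_mon N a i : int)).
by rewrite shift_monE // expfzDr ?tx // mulrC.
Qed.

Lemma ev_lpoly N f x : torus x -> (forall a, a \in lsupp f -> bounds N a) ->
  ev x (lpoly N f) = xall x ^+ N * leval f x.
Proof.
move=> tx fN; rewrite raddf_sum /leval mulr_sumr; apply: eq_big_seq => a af /=.
rewrite evZ (ev_shift_mon tx (fN a af)).
by rewrite mulrCA.
Qed.

Lemma ev_mderiv_mon x j (m : mon n) : x 0 j != 0 ->
  ev x (mderiv j (mpolyX C m)) = (m j)%:R * ((x 0 j)^-1 * ev x (mpolyX C m)).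
Proof.
move=> xj; rewrite mderivX evZ; have [->|mj] := eqVneq (m j) 0%N.
  by rewrite !mul0r.
congr (_ * _); rewrite -[in RHS](submK (m := mnm1 j) (m' := m)) ?lep1mP //.
by rewrite mpolyXD rmorphM /= evX [RHS]mulrC mulfK.
Qed.

Lemma xpow_sub_delta x a j : x 0 j != 0 ->
  xpow x (a - delta_mx 0 j) = (x 0 j)^-1 * xpow x a.
Proof.
move=> xj; rewrite /xpow (bigD1 j) //= [in RHS](bigD1 j) //= mulrA.
congr (_ * _); last first.
  by apply: eq_bigr => i ij; rewrite !mxE (negPf ij) andbF subr0.
by rewrite !mxE !eqxx /= expfzDr // exprN1 mulrC.
Qed.

Lemma lcoef_lderiv j f x : leval (lderiv j f) x =
  \sum_(a <- lsupp f) lcoef f a * ((a 0 j)%:~R * xpow x (a - delta_mx 0 j)).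
Proof. by rewrite leval_sum; apply: eq_bigr => a _; rewrite leval_monom mulrA. Qed.

(** The Leibniz term that differentiates the power of the product of the variables carries the
    factor [leval f x], so at a zero both Jacobians agree up to a unit. *)
Lemma ev_mderiv_lpoly N f x j : torus x ->
    (forall a, a \in lsupp f -> bounds N a) -> leval f x = 0 ->
  ev x (mderiv j (lpoly N f)) = xall x ^+ N * leval (lderiv j f) x.
Proof.
move=> tx fN f0; have xj : x 0 j != 0 by apply: tx.
rewrite /lpoly [mderiv _ _]raddf_sum [LHS]raddf_sum lcoef_lderiv mulr_sumr.
transitivity (\sum_(a <- lsupp f) (xall x ^+ N * (lcoef f a *
   ((a 0 j)%:~R * xpow x (a - delta_mx 0 j))) +
   xall x ^+ N * N%:R * (x 0 j)^-1 * (lcoef f a * xpow x a))); last first.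
  by rewrite big_split /= -[X in _ + X]mulr_sumr -/(leval f x) f0 mulr0 addr0.
apply: eq_big_seq => a /fN aN /=.
rewrite mderivZ evZ ev_mderiv_mon // ev_shift_mon // xpow_sub_delta //.
have -> : (shift_mon N a j)%:R = (a 0 j)%:~R + N%:R :> C.
  by rewrite -[LHS]/((shift_mon N a j : int)%:~R) shift_monE // rmorphD.
by ring.
Qed.

Lemma lsupp_bound f : exists N, forall a, a \in lsupp f -> bounds N a.
Proof.
exists (\sum_(a <- lsupp f) \sum_i absz (a 0%R i))%N => a af i.
have : (absz (a 0%R i) <= \sum_(a <- lsupp f) \sum_i absz (a 0%R i))%N.
  by rewrite (big_rem a af) /= (bigD1 i) //= -addnA leq_addr.
by move: (\sum_(_ <- _) _)%N => K; lia.
Qed.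

End LaurentEvaluation.


(** * Zariski closed sets, vanishing ideals and irreducibility *)

Section Locus.
Variables (C : numClosedFieldType) (n : nat).
Implicit Types (Z : set 'rV[C]_n) (p q : pol n C).

Definition van Z : set (pol n C) := [set p | forall v, Z v -> ev v p = 0].

Definition locus (I : set (pol n C)) : set 'rV[C]_n :=
  [set v | torus v /\ forall p, I p -> ev v p = 0].

Lemma van_ideal Z : ideal (van Z).
Proof.
split=> [v _|x y Zx Zy v Zv|x y Zy v Zv]; first by rewrite rmorph0.
  by rewrite rmorphD /= Zx ?Zy ?addr0.
by rewrite rmorphM /= Zy ?mulr0.
Qed.

Lemma van_anti Z1 Z2 : Z1 `<=` Z2 -> van Z2 `<=` van Z1.
Proof. by move=> Z12 p Z2p v /Z12; apply: Z2p. Qed.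

Lemma locus_torus I v : locus I v -> torus v. Proof. by case. Qed.

Lemma sub_locus_van Z : (forall v, Z v -> torus v) -> Z `<=` locus (van Z).
Proof. by move=> tZ v Zv; split=> [|p]; [exact: tZ|apply]. Qed.

Lemma locus_van_locus I : locus I = locus (van (locus I)).
Proof.
apply/seteqP; split; first by apply: sub_locus_van => v [].
by move=> v [tv Iv]; split=> // p Ip; apply: Iv => w [_]; apply.
Qed.

Lemma zclosedP Z : zclosed Z <-> Z = locus (van Z).
Proof.
split=> [[G ->]|ZE].
  apply/seteqP; split; first by apply: sub_locus_van => v [].
  move=> v [tv Gv]; split=> // g Gg; have [N gN] := lsupp_bound g.
  have /eqP : ev v (lpoly N g) = 0.
    by apply: Gv => w [tw wG]; rewrite ev_lpoly // wG ?mulr0.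
  rewrite ev_lpoly // mulf_eq0 expf_eq0 => /orP[/andP[_]|/eqP//].
  by rewrite prodf_seq_eq0 => /hasP[i _ /andP[_ /negPn]]; rewrite tv.
pose f p : laurent C n := \sum_(m <- msupp p)
  lmonom (mcoeff m p) (\row_i (m i : int)).
have fE p v : leval (f p) v = ev v p.
  rewrite leval_sum [p in RHS]mpolyE raddf_sum; apply: eq_bigr => m _ /=.
  rewrite leval_monom evZ ev_mon; congr (_ * _).
  by apply: eq_bigr => i _; rewrite mxE.
exists (f @` van Z); rewrite {1}ZE; apply/seteqP; split=> v [tv vZ]; split=> //.
  by move=> _ [p Zp <-]; rewrite fE vZ.
by move=> p Zp; rewrite -fE; apply: vZ; exists p.
Qed.

Lemma zclosed_locus I : zclosed (locus I).
Proof. by apply/zclosedP; apply: locus_van_locus. Qed.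

Lemma zclosed_torus Z v : zclosed Z -> Z v -> torus v.
Proof. by move=> /zclosedP-> []. Qed.

Lemma zclosed_sep Z v : zclosed Z -> torus v -> ~ Z v ->
  exists2 p, van Z p & ev v p != 0.
Proof.
move=> /zclosedP ZE tv Zv; apply: contrapT => no; apply: Zv; rewrite ZE.
split=> // p Zp; apply/eqP/negPn/negP => pv; by apply: no; exists p.
Qed.

Lemma zirreducibleP Z : zirreducible Z <-> zclosed Z /\ prime (van Z).
Proof.
split=> [[cZ [z0 Zz0] ZI]|[cZ prZ]]; split=> //.
- split; first exact: van_ideal.
    by move=> /(_ z0 Zz0)/eqP; rewrite rmorph1 oner_eq0.
  move=> p q Zpq.
  have part r : Z `&` locus [set r] = locus (van Z `|` [set r]).
    have /zclosedP ZE := cZ; rewrite {1}ZE; apply/seteqP; split.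
      by move=> v [[tv Zv] [_ rv]]; split=> // s [/Zv|/rv].
    move=> v [tv vZ]; split; split=> // s Zs; apply: vZ; [by left|by right].
  have [] := ZI _ _ (zclosed_locus (van Z `|` [set p])) (zclosed_locus (van Z `|` [set q])).
  + move=> v Zv; have tv := zclosed_torus cZ Zv; rewrite -!part.
    have /eqP := Zpq v Zv; rewrite rmorphM mulf_eq0 => /orP[]/eqP v0.
      by left; split=> //; split=> // _ ->.
    by right; split=> //; split=> // _ ->.
  + by rewrite -part => Zp; left=> v /Zp[_ [_]]; apply.
  + by rewrite -part => Zq; right=> v /Zq[_ [_]]; apply.
- apply: contrapT => Z0; apply: (prime1 prZ) => v Zv.
  by case: Z0; exists v.
- move=> Z1 Z2 c1 c2 Z12; apply: contrapT => /not_orP[].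
  move=> /existsNP[v1 /not_implyP[Zv1 nv1]] /existsNP[v2 /not_implyP[Zv2 nv2]].
  have [p1 p1Z p1v] := zclosed_sep c1 (zclosed_torus cZ Zv1) nv1.
  have [p2 p2Z p2v] := zclosed_sep c2 (zclosed_torus cZ Zv2) nv2.
  have [v Zv||] := primeM prZ (x := p1) (y := p2).
  + by rewrite rmorphM; case: (Z12 v Zv) => [/p1Z|/p2Z] /= ->; rewrite ?mul0r ?mulr0.
  + by move=> /(_ v1 Zv1)/eqP; rewrite (negPf p1v).
  + by move=> /(_ v2 Zv2)/eqP; rewrite (negPf p2v).
Qed.

Lemma zirr_prime Z : zirreducible Z -> prime (van Z).
Proof. by case/zirreducibleP. Qed.

Lemma zirr_closed Z : zirreducible Z -> zclosed Z.
Proof. by case/zirreducibleP. Qed.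

Definition finite_union Z := exists k (Y : 'I_k -> set 'rV[C]_n),
  (forall i, zirreducible (Y i)) /\ Z = [set v | exists i, Y i v].

Lemma finite_unionU Z1 Z2 :
  finite_union Z1 -> finite_union Z2 -> finite_union (Z1 `|` Z2).
Proof.
move=> [k [Y [irrY ->]]] [l [Y' [irrY' ->]]]; exists (k + l)%N.
exists (fun i => match fintype.split i with inl j => Y j | inr j => Y' j end).
split=> [i|]; first by case: fintype.split.
apply/seteqP; split=> v.
  move=> [[i Yi]|[i Yi]]; [exists (lshift l i)|exists (rshift k i)].
    by case: fintype.splitP => j /= E; [have -> : j = i by apply: ord_inj|move: (ltn_ord i); lia].
  by case: fintype.splitP => j /= E; [move: (ltn_ord j); lia|have -> : j = i by apply: ord_inj; lia].
by move=> [i' ]; case: fintype.split => j Yj; [left|right]; exists j.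
Qed.

(** Noetherian induction: take an ideal [J] maximal among those whose locus is no finite union. If
    its locus were reducible, adjoining [p] or [q] to [J] would cut it into loci of strictly larger
    ideals, which are finite unions. *)
Lemma zclosed_finite_union Z : zclosed Z -> finite_union Z.
Proof.
move=> cZ; apply: contrapT => badZ.
have [|J [idJ badJ _ Jmax]] := @maximal_ideal C n
    [set J | ~ finite_union (locus J)] (van Z) (van_ideal Z).
  by rewrite /=; have /zclosedP <- := cZ.
pose Y := locus J; have cY : zclosed Y by apply: zclosed_locus.
have JY : J `<=` van Y by move=> p Jp v [_]; apply.
apply: (badJ); have [[y0 Yy0]|Y0] := pselect (Y !=set0); last first.
  exists 0%N, (fun=> set0); split=> [[]//|].
  by apply/seteqP; split=> v; [move=> Yv; case: Y0; exists v|move=> [[]]].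
exists 1%N, (fun=> Y); split; last first.
  by apply/seteqP; split=> v; [exists ord0|move=> []].
move=> _; apply/zirreducibleP; split=> //; split; first exact: van_ideal.
  by move=> /(_ y0 Yy0)/eqP; rewrite rmorph1 oner_eq0.
move=> p q Ypq; apply: contrapT => /not_orP[Yp Yq]; apply: (badJ).
have good r : ~ van Y r -> finite_union (locus (ideal_add J r)).
  move=> Yr; apply: contrapT => bad; apply: (Yr); apply: JY.
  apply: (Jmax _ (ideal_add_ideal r idJ) bad (@ideal_add_sub _ _ _)).
  exact: ideal_add_in.
have -> : locus J = locus (ideal_add J p) `|` locus (ideal_add J q).
  apply/seteqP; split=> v; last first.
    by move=> [] [tv vJ]; split=> // s Js; apply: vJ; apply: ideal_add_sub.
  move=> Yv; have [tv Jv] := Yv; have /eqP := Ypq v Yv.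
  rewrite rmorphM mulf_eq0 => /orP[]/eqP v0; [left|right]; split=> //.
    by move=> _ [j [s [Jj ->]]]; rewrite rmorphD rmorphM /= v0 mulr0 addr0 Jv.
  by move=> _ [j [s [Jj ->]]]; rewrite rmorphD rmorphM /= v0 mulr0 addr0 Jv.
by apply: finite_unionU; apply: good.
Qed.

Lemma zirr_finite_union Z k (Y : 'I_k -> set 'rV[C]_n) : zirreducible Z ->
  (forall i, zclosed (Y i)) -> Z `<=` [set v | exists i, Y i v] ->
  exists i, Z `<=` Y i.
Proof.
move=> irrZ cY ZY; apply: contrapT => /forallNP no.
have prZ := zirr_prime irrZ.
have /choice[p pP] i : exists p, van (Y i) p /\ ~ van Z p.
  have /existsNP[v /not_implyP[Zv nYv]] := no i.
  have [q Yq qv] := zclosed_sep (cY i) (zclosed_torus (zirr_closed irrZ) Zv) nYv.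
  by exists q; split=> // /(_ v Zv)/eqP; rewrite (negPf qv).
have : van Z (\prod_i p i).
  move=> v /ZY[i Yv]; rewrite rmorph_prod (bigD1 i) //= (pP i).1 //.
  by rewrite mul0r.
by apply: (prime_prod prZ) => i _; case: (pP i).
Qed.

End Locus.


(** * Krull dimension, transcendence degree and tangent vectors *)

Definition alg_indep (C : fieldType) n (P : set (pol n C)) t (g : 'I_t -> pol n C) :=
  forall rho, P (msubst g rho) -> rho = 0.

Definition rcons_fun T t (g : 'I_t -> T) (x : T) (i : 'I_t.+1) : T :=
  if unlift ord_max i is Some k then g k else x.

Lemma rcons_fun_lift T t (g : 'I_t -> T) x k :
  rcons_fun g x (lift ord_max k) = g k.
Proof. by rewrite /rcons_fun liftK. Qed.

Lemma rcons_fun_max T t (g : 'I_t -> T) x : rcons_fun g x ord_max = x.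
Proof. by rewrite /rcons_fun unlift_none. Qed.

(* Dividing an algebraic relation by a power of its last element. *)
Lemma last_relation (C : fieldType) n (P : set (pol n C)) t
    (g : 'I_t -> pol n C) x rho : prime P -> ~ P x -> rho != 0 ->
    P (msubst (rcons_fun g x) rho) ->
  exists2 r : pol t C, r != 0 & exists s, P (msubst g r + x * s).
Proof.
move=> prP Px rho0; have [a [r0 [r1 [-> r00 r0i]]]] := low_part ord_max rho0.
rewrite rmorphM rmorphXn rmorphD rmorphM /= msubstX rcons_fun_max.
case/(primeM prP) => [/(primeX prP)//|Pr].
pose r := msubst (rcons_fun (fun k => var k) 0) r0 : pol t C.
have rE : r0 = msubst (fun k => var (lift ord_max k)) r.
  rewrite /r msubst_comp -[LHS]msubst_var; apply: mmap_eq_on => m i mr mi.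
  case: (unliftP ord_max i) => [k ->|im]; last by rewrite im r0i in mi.
  by rewrite rcons_fun_lift msubstX.
exists r; first by apply: contra_neq r00 => r0'; rewrite rE r0' rmorph0.
exists (msubst (rcons_fun g x) r1).
move: Pr; rewrite rE msubst_comp; congr (P (_ + _)).
by apply: mmap_eq_on => m i _ _; rewrite msubstX rcons_fun_lift.
Qed.

(** After division by a power of [x], a relation of the extended family modulo [P'] becomes, modulo
    [P] where [x] is zero, a nontrivial relation of [g] alone. *)
Lemma alg_indep_rcons (C : fieldType) n (P P' : set (pol n C)) t
    (g : 'I_t -> pol n C) x : prime P' -> ideal P -> P' `<=` P ->
  alg_indep P g -> P x -> ~ P' x -> alg_indep P' (rcons_fun g x).
Proof.
move=> prP' idP PP' indg Px P'x rho Prho; apply/eqP; apply: contraT => rho0.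
have [r r0 [s /PP' Prs]] := last_relation prP' P'x rho0 Prho.
case/negP: r0; apply/eqP/indg.
by rewrite -(addrK (x * s) (msubst g r)); apply: idealB => //; apply: idealMr.
Qed.

Section Chains.
Variables (C : numClosedFieldType) (n : nat).

(** Each strict inclusion supplies a function vanishing on the smaller set but not on the larger
    one, which extends the independent family; so chains are no longer than the transcendence
    degree. *)
Lemma irr_chain_indep (Z : set 'rV[C]_n) d : irr_chain Z d ->
  exists g : 'I_d -> pol n C, alg_indep (van Z) g.
Proof.
move=> [T [irrT incT]].
suff /(_ d (leqnn _))[g gP] : forall i, (i <= d)%N ->
    exists g : 'I_i -> pol n C, alg_indep (van (T i)) g.
  exists g => rho Zrho; apply: gP; apply: van_anti Zrho.
  by case: (irrT d (leqnn d)).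
elim=> [_|i IHi id].
  exists (fun i => 0) => rho; have [irr0 _] := irrT 0%N (leq0n _).
  rewrite (nvar0_mpolyC rho) msubstC => /(prime_const (zirr_prime irr0))->.
  by rewrite mpolyC0.
have [g gP] := IHi (ltnW id); have [sT nsT] := incT i id.
have [irri _] := irrT i (ltnW id); have [irri1 _] := irrT i.+1 id.
have /existsNP[v /not_implyP[Tv nTv]] := nsT.
have [x xT xv] := zclosed_sep (zirr_closed irri)
  (zclosed_torus (zirr_closed irri1) Tv) nTv.
exists (rcons_fun g x); apply: (alg_indep_rcons (P := van (T i))) => //.
- exact: zirr_prime.
- exact: van_ideal.
- exact: van_anti.
- by move=> /(_ v Tv)/eqP; rewrite (negPf xv).
Qed.

Definition tangent (Z : set 'rV[C]_n) (x : 'rV[C]_n) (v : 'rV[C]_n) :=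
  forall h, van Z h -> \sum_i v 0 i * ev x (mderiv i h) = 0.

Lemma ev_vfield (v : 'I_n -> pol n C) p x :
  ev x (vfield v p) = \sum_i ev x (v i) * ev x (mderiv i p).
Proof. by rewrite vfieldE raddf_sum; apply: eq_bigr => i _; rewrite /= rmorphM. Qed.

Lemma van_witness (Z : set 'rV[C]_n) p : ~ van Z p -> exists2 v, Z v & ev v p != 0.
Proof.
by move=> /existsNP[v /not_implyP[Zv /eqP pv]]; exists v.
Qed.

(* Generic smoothness: [e] is the transcendence degree of the function field
   of [Z], and the [e] tangent fields [v] are independent where [W <> 0]. *)
Theorem tangent_frame (Z : set 'rV[C]_n) (I0 : {set 'I_n}) : prime (van Z) ->
    indep_vars (van Z) I0 ->
  exists (I : {set 'I_n}) (v : 'I_#|I| -> 'I_n -> pol n C) W,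
  [/\ I0 \subset I,
    forall t (g : 'I_t -> pol n C), (#|I| < t)%N ->
      exists2 rho : pol t C, rho != 0 & van Z (msubst g rho),
    ~ van Z W,
    forall k h, van Z h -> van Z (vfield (v k) h) &
    forall k l, v k (enum_val l) = if k == l then W else 0].
Proof.
move=> prZ indI0; have [I [I0I dep [W ZW vP]]] := transcendence_basis prZ indI0.
have /choice[v {}vP] (k : 'I_#|I|) := vP (enum_val k) (enum_valP k).
exists I, v, W; split=> // [k h|k l]; first by case: (vP k) => + _ _; apply.
have [_ vk vkl] := vP k; have [<-//|kl] := eqVneq k l.
by apply: vkl; rewrite ?enum_valP ?(inj_eq enum_val_inj) // eq_sym.
Qed.

Lemma tangent_rank (Z : set 'rV[C]_n) (I : {set 'I_n})
    (v : 'I_#|I| -> 'I_n -> pol n C) W x : Z x -> ev x W != 0 ->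
    (forall k h, van Z h -> van Z (vfield (v k) h)) ->
    (forall k l, v k (enum_val l) = if k == l then W else 0) ->
  let T := \matrix_(k, i) ev x (v k i) in
  row_free T /\ forall k, tangent Z x (row k T).
Proof.
move=> Zx Wx vP vI T; split; last first.
  move=> k h Zh; rewrite -[RHS](vP k h Zh x Zx) ev_vfield.
  by apply: eq_bigr => i _; rewrite !mxE.
pose B := \matrix_(i, l) ((i == enum_val l)%:R / ev x W) : 'M[C]_(n, #|I|).
apply/row_freeP; exists B; apply/matrixP => k l; rewrite !mxE.
rewrite (bigD1 (enum_val l)) //= !mxE eqxx mul1r big1 => [|i il].
  rewrite addr0 vI; case: eqP => _; first by rewrite mulfV.
  by rewrite rmorph0 mul0r.
by rewrite !mxE (negPf il) mul0r mulr0.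
Qed.

Lemma indep_vars0 (Z : set 'rV[C]_n) : prime (van Z) -> indep_vars (van Z) finset.set0.
Proof.
move=> prZ p p0; have -> : p = mpolyC n (mcoeff (@mnm0 n) p).
  by apply: mderiv_eq0 => i; apply: (mderiv_only_vars p0); rewrite inE.
by move/(prime_const prZ)->; rewrite mpolyC0.
Qed.

End Chains.


(** * The incidence variety of points and slicing forms *)

Section Direction.
Variables (R : comNzRingType) (n : nat).
Implicit Types (w z : 'rV[R]_n) (p q : pol n R).

Definition dir w z p : R := \sum_i w 0 i * ev z (mderiv i p).

Lemma dirC w z c : dir w z (mpolyC n c) = 0.
Proof. by rewrite /dir big1 // => i _; rewrite mderivC rmorph0 mulr0. Qed.

Lemma dirX w z i : dir w z (var i) = w 0 i.
Proof.
rewrite /dir (bigD1 i) //= mderiv_var eqxx rmorph1 mulr1 big1 ?addr0 // => j ji.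
by rewrite mderiv_var (negPf ji) rmorph0 mulr0.
Qed.

Lemma dirD w z p q : dir w z (p + q) = dir w z p + dir w z q.
Proof.
rewrite /dir -big_split; apply: eq_bigr => i _ /=.
by rewrite mderivD rmorphD mulrDr.
Qed.

Lemma dir_sum w z I (r : seq I) (P : pred I) F :
  dir w z (\sum_(i <- r | P i) F i) = \sum_(i <- r | P i) dir w z (F i).
Proof. by apply: (big_morph _ (dirD w z)); rewrite -(mpolyC0 n) dirC. Qed.

Lemma dirM w z p q : dir w z (p * q) = dir w z p * ev z q + ev z p * dir w z q.
Proof.
rewrite /dir mulr_suml mulr_sumr -big_split; apply: eq_bigr => i _ /=.
by rewrite mderivM rmorphD !rmorphM /=; ring.
Qed.

Lemma dirN w z p : dir w z (- p) = - dir w z p.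
Proof. by apply/eqP; rewrite -addr_eq0 -dirD addNr -(mpolyC0 n) dirC. Qed.

Lemma dirDl w w' z p : dir (w + w') z p = dir w z p + dir w' z p.
Proof.
by rewrite /dir -big_split; apply: eq_bigr => i _; rewrite !mxE mulrDl.
Qed.

Lemma dirZl c w z p : dir (c *: w) z p = c * dir w z p.
Proof. by rewrite /dir mulr_sumr; apply: eq_bigr => i _; rewrite !mxE mulrA. Qed.

Lemma dir0l z p : dir 0 z p = 0.
Proof. by rewrite /dir big1 // => i _; rewrite mxE mul0r. Qed.

Lemma dir_suml I (r : seq I) (P : pred I) F z p :
  dir (\sum_(i <- r | P i) F i) z p = \sum_(i <- r | P i) dir (F i) z p.
Proof.
apply: (big_morph (fun w => dir w z p)); last exact: dir0l.
by move=> w w'; apply: dirDl.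
Qed.

End Direction.

Lemma dir_msubst (R : comNzRingType) n k (f : 'I_k -> pol n R) w z (p : pol k R) :
  dir w z (msubst f p) = dir (\row_i dir w z (f i)) (\row_i ev z (f i)) p.
Proof.
rewrite /dir; under eq_bigr => i _ do rewrite mderiv_msubst rmorph_sum mulr_sumr.
rewrite exchange_big; apply: eq_bigr => j _; rewrite mxE mulr_suml.
by apply: eq_bigr => i _; rewrite rmorphM /= ev_msubst mulrCA [RHS]mulrC mulrA.
Qed.

Lemma split_lshift p q (j : 'I_p) : fintype.split (lshift q j) = inl j.
Proof. exact: (unsplitK (inl j)). Qed.

Lemma split_rshift p q (j : 'I_q) : fintype.split (rshift p j) = inr j.
Proof. exact: (unsplitK (inr j)). Qed.

Section Incidence.
Variables (C : numClosedFieldType) (n d m : nat) (Z : set 'rV[C]_n).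
Variables (mono : 'I_m -> pol n C) (k0 : 'I_m).
Hypothesis irrZ : zirreducible Z.
Hypothesis mono_k0 : forall x, torus x -> ev x (mono k0) != 0.
(** The source of all transversality of slices; it is derived from the integral right inverse of the
    exponent matrix in [mexp_span]. *)
Hypothesis mono_span : forall x, torus x -> forall u : 'rV[C]_n,
  exists g : 'I_m -> C, \sum_k g k * ev x (mono k) = 0 /\
    forall j, \sum_k g k * ev x (mderiv j (mono k)) = u 0 j.

Let prZ : prime (van Z) := zirr_prime irrZ.
Let torZ x : Z x -> torus x := @zclosed_torus _ _ _ _ (zirr_closed irrZ).

Local Notation N := (n + d * m)%N.
Implicit Types (x v : 'rV[C]_n) (c g : 'M[C]_(d, m)) (z w : 'rV[C]_N).

Definition pt x c : 'rV[C]_N := row_mx x (mxvec c).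

Lemma pt_surj z : z = pt (lsubmx z) (vec_mx (rsubmx z)).
Proof. by rewrite /pt vec_mxK hsubmxK. Qed.

Definition linval c x i := \sum_k c i k * ev x (mono k).

Definition incidence : set 'rV[C]_N :=
  [set z | Z (lsubmx z) /\ forall i, linval (vec_mx (rsubmx z)) (lsubmx z) i = 0].

Lemma incidence_pt x c : incidence (pt x c) <-> Z x /\ forall i, linval c x i = 0.
Proof. by rewrite /incidence /= /pt row_mxKl row_mxKr mxvecK. Qed.

Definition lift_x (p : pol n C) : pol N C := msubst (fun j => var (lshift _ j)) p.
Definition cvar i k : pol N C := var (rshift n (mxvec_index i k)).

Definition sflat c : pol N C -> pol n C :=
  msubst (fun i => match fintype.split i with
    | inl j => var j | inr l => mpolyC n (mxvec c 0 l) end).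

HB.instance Definition _ c := GRing.RMorphism.copy (sflat c) (msubst _).
HB.instance Definition _ := GRing.RMorphism.copy lift_x (msubst _).

Definition sub_x x : pol N C -> pol (d * m) C :=
  msubst (fun i => match fintype.split i with
    | inl j => mpolyC _ (x 0 j) | inr l => var l end).

Lemma ev_lift_x z p : ev z (lift_x p) = ev (lsubmx z) p.
Proof. by rewrite ev_msubst; congr (ev _ _); apply/rowP => j; rewrite !mxE evX. Qed.

Lemma ev_cvar x c i k : ev (pt x c) (cvar i k) = c i k.
Proof. by rewrite evX row_mxEr mxvecE. Qed.

Lemma ev_sflat c x p : ev x (sflat c p) = ev (pt x c) p.
Proof.
rewrite ev_msubst; congr (ev _ _); apply/rowP => i; rewrite !mxE.
by case: fintype.splitP => j _; rewrite ?evX ?evC.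
Qed.

Lemma ev_sub_x c x p : ev (mxvec c) (sub_x x p) = ev (pt x c) p.
Proof.
rewrite ev_msubst; congr (ev _ _); apply/rowP => i; rewrite !mxE.
by case: fintype.splitP => j _; rewrite ?evX ?evC.
Qed.

Lemma sflat_lift c p : sflat c (lift_x p) = p.
Proof.
rewrite /sflat /lift_x msubst_comp -[RHS]msubst_var; apply: mmap_eq_on => _ j _ _.
by rewrite msubstX split_lshift.
Qed.

Lemma sflat_cvar c i k : sflat c (cvar i k) = mpolyC n (c i k).
Proof.
by rewrite /sflat msubstX split_rshift mxvecE.
Qed.

(* A parametrization of the incidence variety by [Z] times an affine space,
   multiplied by [mono k0] to clear denominators. *)
Definition param_c x c : 'M[C]_(d, m) := \matrix_(i, k)
  (if k == k0 then - \sum_(k' | k' != k0) c i k' * ev x (mono k')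
   else ev x (mono k0) * c i k).

Definition param : 'I_N -> pol N C := fun i => match fintype.split i with
  | inl j => var (lshift _ j)
  | inr l => (mxvec (\matrix_(i, k)
    (if k == k0 then - \sum_(k' | k' != k0) cvar i k' * lift_x (mono k')
     else lift_x (mono k0) * cvar i k))) 0 l end.

Lemma ev_param x c p : ev (pt x c) (msubst param p) = ev (pt x (param_c x c)) p.
Proof.
rewrite ev_msubst; congr (ev _ _); apply/rowP => i; rewrite !mxE /param.
case: fintype.splitP => j _; first by rewrite evX row_mxEl.
case/mxvec_indexP: j => i' k; rewrite !mxvecE !mxE; case: ifP => _; last first.
  by rewrite rmorphM /= ev_lift_x ev_cvar row_mxKl.
rewrite rmorphN rmorph_sum /=; congr (- _); apply: eq_bigr => k' _.
by rewrite rmorphM /= ev_lift_x ev_cvar row_mxKl.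
Qed.

Lemma linval_split c x i : linval c x i =
  c i k0 * ev x (mono k0) + \sum_(k | k != k0) c i k * ev x (mono k).
Proof. by rewrite /linval (bigD1 k0). Qed.

Lemma param_in x c : Z x -> incidence (pt x (param_c x c)).
Proof.
move=> Zx; apply/incidence_pt; split=> // i; rewrite linval_split !mxE eqxx.
rewrite mulNr mulr_suml addrC -sumrB big1 // => k /negPf kk0.
by rewrite mxE kk0; ring.
Qed.

Lemma param_onto x c : torus x -> (forall i, linval c x i = 0) ->
  param_c x ((ev x (mono k0))^-1 *: c) = c.
Proof.
move=> tx lc; have mu0 := mono_k0 tx; apply/matrixP => i k; rewrite !mxE.
case: eqP => [->|_]; last by rewrite mulVKf.
have := lc i; rewrite linval_split => /(canRL (addrK _)); rewrite sub0r => cE.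
have -> : \sum_(k' | k' != k0) ((ev x (mono k0))^-1 *: c) i k' * ev x (mono k') =
    (ev x (mono k0))^-1 * \sum_(k' | k' != k0) c i k' * ev x (mono k').
  by rewrite mulr_sumr; apply: eq_bigr => k' _; rewrite mxE mulrA.
by rewrite -mulrN -cE mulrC mulfK.
Qed.

(** Pull two functions that are nonzero on the incidence set back along [param]. Primality of
    [van Z] gives a common [x] where both pullbacks are nonzero polynomials in [c], and their
    product is nonzero for some [c]. *)
Lemma incidence_prime : prime (van incidence).
Proof.
split; first exact: van_ideal.
  have [x Zx _] := van_witness (prime1 prZ).
  by move=> /(_ _ (param_in 0 Zx))/eqP; rewrite rmorph1 oner_eq0.
move=> p q pq; apply: contrapT => /not_orP[].
move=> /van_witness[z1 Xz1 pz1] /van_witness[z2 Xz2 qz2].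
have pull r z : incidence z -> ev z r != 0 ->
    exists c, ~ van Z (sflat c (msubst param r)).
  rewrite (pt_surj z) => /incidence_pt[]; move: (lsubmx z) (vec_mx _) => x c.
  move=> Zx lc rz; exists ((ev x (mono k0))^-1 *: c) => /(_ x Zx)/eqP.
  by rewrite ev_sflat ev_param param_onto ?(negPf rz) //; apply: torZ.
have [c1 p1] := pull _ _ Xz1 pz1; have [c2 q2] := pull _ _ Xz2 qz2.
have [x Zx] : exists2 x, Z x & ev x (sflat c1 (msubst param p) *
    sflat c2 (msubst param q)) != 0.
  by apply: van_witness => /(primeM prZ)[].
rewrite rmorphM /= !ev_sflat mulf_eq0 negb_or => /andP[px qx].
pose P := sub_x x (msubst param p); pose Q := sub_x x (msubst param q).
have P0 : P != 0 by apply: contraNneq px => P0; rewrite -ev_sub_x -/P P0 rmorph0.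
have Q0 : Q != 0 by apply: contraNneq qx => Q0; rewrite -ev_sub_x -/Q Q0 rmorph0.
have [u] := ev_neq0 (mulf_neq0 P0 Q0).
rewrite -[u]vec_mxK rmorphM /= !ev_sub_x !ev_param -rmorphM /=.
by rewrite (pq _ (param_in _ Zx)) eqxx.
Qed.

Definition dlin v c x i := \sum_k c i k * dir v x (mono k).

(** The fiber over [x] is a linear space, so the whole line through the point in direction [g] stays
    in the incidence set. *)
Lemma tangent_vertical x c g h : incidence (pt x c) ->
    (forall i, linval g x i = 0) -> van incidence h ->
  dir (pt 0 g) (pt x c) h = 0.
Proof.
move=> /incidence_pt[Zx lc] lg Xh; have l0 : line (pt x c) (pt 0 g) h = 0.
  apply: horner_eq0 => s; rewrite horner_line.
  have -> : pt x c + s *: pt 0 g = pt x (c + s *: g).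
    by rewrite /pt scale_row_mx add_row_mx scaler0 addr0 linearD linearZ.
  apply: Xh; apply/incidence_pt; split=> // i.
  rewrite /linval (eq_bigr (fun k => c i k * ev x (mono k) +
    s * (g i k * ev x (mono k)))) => [|k _]; last by rewrite !mxE; ring.
  by rewrite big_split -mulr_sumr /= -/(linval c x i) -/(linval g x i) lc lg mulr0 addr0.
have := congr1 (fun q => q.[0]) (deriv_line (pt x c) (pt 0 g) h).
rewrite l0 derivC horner0 horner_sum => /esym E; apply: etrans E.
apply: eq_bigr => i _; rewrite hornerM hornerC horner_line scale0r addr0.
by rewrite mulrC.
Qed.

(** Differentiating [param] along [v] with constant parameter [c'] gives one tangent lift [g0]; any
    other solution of the linearised equations differs from it by a vertical vector. *)
Lemma tangent_incidence x c v g : incidence (pt x c) -> tangent Z x v ->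
    (forall i, linval g x i + dlin v c x i = 0) ->
  tangent incidence (pt x c) (pt v g).
Proof.
move=> Xz tv lg h Xh; have /incidence_pt[Zx lc] := Xz.
have tx := torZ Zx; have mu0 := mono_k0 tx.
pose c' := (ev x (mono k0))^-1 *: c.
pose g0 := \matrix_(i, k) (if k == k0
  then - \sum_(k' | k' != k0) c' i k' * dir v x (mono k')
  else c' i k * dir v x (mono k0)) : 'M[C]_(d, m).
have vg0 : dir (pt v g0) (pt x c) h = 0.
  have /tv : van Z (sflat c' (msubst param h)).
    by move=> y Zy; rewrite ev_sflat ev_param; apply/Xh/param_in.
  rewrite -/(dir _ _ _) [sflat _ _]msubst_comp dir_msubst => <-.
  congr (dir _ _ h); apply/rowP => i; rewrite [RHS]mxE -/(sflat c' (param i)).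
    case: (split_ordP i) => j ->.
      rewrite /pt row_mxEl /param split_lshift /sflat msubstX.
      by rewrite split_lshift dirX.
    case/mxvec_indexP: j => i' k; rewrite /pt row_mxEr mxvecE mxE.
    rewrite /param split_rshift mxvecE mxE; case: ifP => _; last first.
      by rewrite rmorphM /= sflat_lift sflat_cvar dirM dirC evC mulr0 addr0 mulrC.
    rewrite rmorphN rmorph_sum /= dirN dir_sum; congr (- _).
    apply: eq_bigr => k' _; rewrite rmorphM /= sflat_lift sflat_cvar dirM dirC.
    by rewrite evC mul0r add0r.
  rewrite ev_sflat -(msubstX param) ev_param evX.
  by rewrite param_onto.
rewrite -/(dir _ _ h).
have -> : pt v g = pt v g0 + pt 0 (g - g0).
  by rewrite /pt add_row_mx addr0 -linearD /= addrC subrK.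
rewrite dirDl vg0 add0r; apply: tangent_vertical => // i.
have := lg i; rewrite /linval => /eqP; rewrite addr_eq0 => /eqP gE.
transitivity (\sum_k g i k * ev x (mono k) - \sum_k g0 i k * ev x (mono k)).
  by rewrite -sumrB; apply: eq_bigr => k _; rewrite !mxE mulrBl.
rewrite gE; apply/eqP; rewrite -opprD oppr_eq0 addr_eq0; apply/eqP.
have c'0 k : c' i k * ev x (mono k0) = c i k by rewrite mxE mulrAC mulVf ?mul1r.
rewrite /dlin (bigD1 k0) //= [in RHS](bigD1 k0) //= mxE eqxx.
have E k : k != k0 -> g0 i k = c' i k * dir v x (mono k0).
  by move=> /negPf kk; rewrite mxE kk.
rewrite opprD mulNr opprK mulr_suml addrC; congr (_ + _).
  by apply: eq_bigr => k _; rewrite -c'0; ring.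
have := lc i; rewrite linval_split => /eqP; rewrite addr_eq0 => /eqP cE.
apply: (mulIf mu0); rewrite mulrAC cE mulNr mulNr; congr (- _).
rewrite !mulr_suml; apply: eq_bigr => k kk0; rewrite E // -[c i k]c'0; ring.
Qed.

Lemma dir_lift_x w z p : dir w z (lift_x p) = dir (lsubmx w) (lsubmx z) p.
Proof.
by rewrite dir_msubst; congr (dir _ _ _); apply/rowP => j; rewrite !mxE ?dirX ?evX.
Qed.

Lemma van_lift_x p : van Z p -> van incidence (lift_x p).
Proof. by move=> Zp z [Zz _]; rewrite ev_lift_x; apply: Zp. Qed.

Lemma tangent_incidence_inv x c v g : incidence (pt x c) ->
    tangent incidence (pt x c) (pt v g) ->
  tangent Z x v /\ forall i, linval g x i + dlin v c x i = 0.
Proof.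
move=> Xz tz; have xE : lsubmx (pt x c) = x by apply: row_mxKl.
have vE : lsubmx (pt v g) = v by apply: row_mxKl.
split=> [p /van_lift_x/tz|i].
  by rewrite -/(dir _ _ _) dir_lift_x xE vE.
have /tz : van incidence (\sum_k cvar i k * lift_x (mono k)).
  move=> z; rewrite (pt_surj z) => /incidence_pt[_ /(_ i) <-].
  rewrite rmorph_sum; apply: eq_bigr => k _.
  by rewrite rmorphM /= ev_lift_x ev_cvar row_mxKl.
rewrite -/(dir _ _ _) dir_sum => <-; rewrite -big_split; apply: eq_bigr => k _ /=.
by rewrite dirM dir_lift_x ev_lift_x ev_cvar xE vE dirX row_mxEr mxvecE.
Qed.

Section Frame.
Variables (I : {set 'I_n}) (vf : 'I_#|I| -> 'I_n -> pol n C) (W : pol n C).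
Hypothesis vfP : forall k h, van Z h -> van Z (vfield (vf k) h).
Hypothesis vfI : forall k l, vf k (enum_val l) = if k == l then W else 0.
Hypothesis WP : ~ van Z W.

Let T x : 'M[C]_(#|I|, n) := \matrix_(k, i) ev x (vf k i).

Lemma ev_vf x k p : ev x (vfield (vf k) p) = dir (row k (T x)) x p.
Proof. by rewrite ev_vfield; apply: eq_bigr => i _; rewrite !mxE. Qed.

Lemma row_tangent x k : Z x -> tangent Z x (row k (T x)).
Proof. by move=> Zx h Zh; rewrite -/(dir _ _ _) -ev_vf; apply: vfP. Qed.

(** Pairs the tangent fields of [Z] with the differentials of the [d] forms, then with the basis
    coordinates of position at least [d]. Where it is invertible, those coordinates and the
    coefficients [c] can be moved independently. *)
Definition frame_mx : 'M[pol N C]_#|I| := \matrix_(k, l)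
  (if insub (l : nat) is Some i then
     \sum_k' cvar (i : 'I_d) k' * lift_x (vfield (vf k) (mono k'))
   else lift_x (vf k (enum_val l))).

Lemma ev_frame_mx x c k l : ev (pt x c) (frame_mx k l) =
  if insub (l : nat) is Some i then dlin (row k (T x)) c x (i : 'I_d)
  else T x k (enum_val l).
Proof.
rewrite mxE; case: insubP => [i _ _|_]; last by rewrite ev_lift_x row_mxKl mxE.
rewrite rmorph_sum; apply: eq_bigr => k' _.
by rewrite rmorphM /= ev_lift_x ev_cvar row_mxKl ev_vf.
Qed.

Hypothesis dI : (d <= #|I|)%N.

Lemma frame_point : ~ van incidence (\det frame_mx).
Proof.
have [x Zx Wx] := van_witness WP; have tx := torZ Zx.
(* The gradients are the first [d] basis covectors divided by [W], which makes the frame matrix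
   diagonal with entries 1 and [ev x W]. *)
have /choice[g gP] (i : 'I_d) := mono_span tx
  (\row_j ((j == enum_val (widen_ord dI i))%:R / ev x W)).
pose c := \matrix_(i, k) g i k; move=> /(_ (pt x c)); rewrite -det_map_mx.
have Xz : incidence (pt x c).
  apply/incidence_pt; split=> // i; rewrite -[RHS](gP i).1.
  by apply: eq_bigr => k _; rewrite mxE.
have -> : map_mx (ev (pt x c)) frame_mx =
    diag_mx (\row_l if (l < d)%N then 1 else ev x W).
  apply/matrixP => k l; rewrite [LHS]mxE ev_frame_mx !mxE.
  case: insubP => [i /= ld il|/= nd]; last first.
    by rewrite vfI; case: (eqVneq k l) => [->|_]; rewrite ?(negPf nd) ?rmorph0.
  have -> : dlin (row k (T x)) c x i =
      \sum_j T x k j * ((j == enum_val (widen_ord dI i))%:R / ev x W).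
    rewrite /dlin /dir; under eq_bigr => k' _ do rewrite mulr_sumr.
    rewrite exchange_big; apply: eq_bigr => j _ /=.
    have := (gP i).2 j; rewrite mxE => <-; rewrite mulr_sumr.
    by apply: eq_bigr => k' _; rewrite !mxE mulrCA.
  rewrite (bigD1 (enum_val l)) //= big1 => [|j jl]; last first.
    have -> : widen_ord dI i = l by apply: ord_inj.
    by rewrite (negPf jl) mul0r mulr0.
  have -> : widen_ord dI i = l by apply: ord_inj.
  rewrite addr0 eqxx mxE vfI; case: (eqVneq k l) => [->|_].
    by rewrite ld mul1r mulfV.
  by rewrite rmorph0 mul0r.
rewrite det_diag => /(_ Xz)/eqP; apply/negP; apply/prodf_neq0 => l _.
by rewrite mxE; case: ifP => _; rewrite ?oner_neq0.
Qed.

(** Inverting the frame matrix gives the combination of tangent fields: its first [d] equations keep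
    the forms zero while [c] moves along [g], the others move the remaining basis coordinates as
    prescribed. *)
Lemma frame_solve x c (g : 'M[C]_(d, m)) (s : 'I_#|I| -> C) :
    incidence (pt x c) -> ev (pt x c) (\det frame_mx) != 0 ->
  exists2 v, tangent incidence (pt x c) (pt v g) &
    forall l : 'I_#|I|, (d <= l)%N -> v 0 (enum_val l) = s l.
Proof.
move=> Xz; rewrite -det_map_mx -unitfE => dM.
pose M := map_mx (ev (pt x c)) frame_mx; have uM : M \in unitmx by rewrite unitmxE.
pose t : 'rV[C]_#|I| := \row_l if insub (l : nat) is Some i
  then - linval g x (i : 'I_d) else s l.
pose a := t *m invmx M; have aM : a *m M = t by rewrite mulmxKV.
have aT v' : v' = a *m T x -> forall h, dir v' x h = \sum_k a 0 k * dir (row k (T x)) x h.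
  move=> -> h; rewrite mulmx_sum_row dir_suml; apply: eq_bigr => k _.
  by rewrite dirZl.
have /incidence_pt[Zx lc] := Xz.
exists (a *m T x).
  apply: tangent_incidence => // [h Zh|i].
    rewrite -/(dir _ _ _) (aT _ erefl) big1 // => k _.
    by rewrite [dir _ _ _](row_tangent k Zx Zh) mulr0.
  have il : (i < #|I|)%N by apply: leq_trans dI.
  have /rowP/(_ (Ordinal il)) := aM.
  rewrite mxE [RHS]mxE /= (valK i) => /eqP; rewrite -addr_eq0 => /eqP tE.
  rewrite addrC -[RHS]tE; congr (_ + _); rewrite /dlin.
  transitivity (\sum_k \sum_l c i k * (a 0 l * dir (row l (T x)) x (mono k))).
    by apply: eq_bigr => k _; rewrite (aT _ erefl) mulr_sumr.
  rewrite exchange_big; apply: eq_bigr => k _ /=; rewrite [M _ _]mxE ev_frame_mx /=.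
  by rewrite (valK i) mulr_sumr; apply: eq_bigr => k' _; rewrite mulrCA.
move=> l dl; have /rowP/(_ l) := aM; rewrite mxE [RHS]mxE.
rewrite insubF ?ltnNge ?dl // => <-; rewrite mxE; apply: eq_bigr => k _.
by rewrite [M _ _]mxE ev_frame_mx insubF ?ltnNge ?dl.
Qed.

Definition free_vars : {set 'I_N} :=
  [set rshift n l | l : 'I_(d * m)] :|:
  [set lshift (d * m) (enum_val l) | l : 'I_#|I| & (d <= l)%N].

(** Induction on the degree of a relation: the tangent vector from [frame_solve] that moves one free
    variable and fixes the others shows that each partial derivative is again a relation, the frame
    determinant being cancelled by primality. *)
Lemma free_vars_indep : indep_vars (van incidence) free_vars.
Proof.
have prX := incidence_prime.
move=> p; have [k] := ubnP (mmeasure mdeg p); elim: k => // k IHk in p *.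
move=> pk pv Xp; suff dp i : mderiv i p = 0.
  by move: Xp; rewrite (mderiv_eq0 dp) => /(prime_const prX)->; rewrite mpolyC0.
have [iF|iF] := boolP (i \in free_vars); last exact: mderiv_only_vars pv iF.
have [p0|p0] := eqVneq p 0; first by rewrite p0 mderiv0.
apply: IHk; [exact: leq_trans (msize_mderiv i p0) pk|exact: only_vars_mderiv|].
have [//|/frame_point//] : van incidence (mderiv i p) \/ van incidence (\det frame_mx).
apply: (primeM prX) => z; rewrite (pt_surj z); move: (lsubmx z) (vec_mx _) => x c Xz.
rewrite rmorphM /=; apply/eqP; rewrite mulf_eq0.
have [//|pz /=] := boolP (ev (pt x c) (mderiv i p) == 0).
apply: contraT => fz.
have [v tv vs] := @frame_solve x c (vec_mx (rsubmx (delta_mx 0 i)))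
  (fun l => (i == lshift (d * m) (enum_val l))%:R) Xz fz.
have := tv p Xp; rewrite (bigD1 i) //= big1 => [|j ji].
  suff -> : pt v (vec_mx (rsubmx (delta_mx 0 i))) 0 i = 1.
    by rewrite addr0 mul1r => pi0; rewrite pi0 eqxx in pz.
  move: iF; rewrite inE => /orP[/imsetP[l _ il]|/imsetP[l + il]].
    by rewrite il /pt row_mxEr vec_mxK !mxE !eqxx.
  by rewrite inE => dl; rewrite il /pt row_mxEl vs // il eqxx.
have [jF|jF] := boolP (j \in free_vars); last first.
  by rewrite (mderiv_only_vars pv jF) rmorph0 mulr0.
suff -> : pt v (vec_mx (rsubmx (delta_mx 0 i))) 0 j = 0 by rewrite mul0r.
move: jF; rewrite inE => /orP[/imsetP[l _ jl]|/imsetP[l + jl]].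
  by rewrite jl /pt row_mxEr vec_mxK !mxE -jl (negPf ji).
by rewrite inE => dl; rewrite jl /pt row_mxEl vs // -jl eq_sym (negPf ji).
Qed.

End Frame.

Lemma linval_rank x : torus x -> exists M : 'M[C]_(d * m, d),
  (forall (a : 'rV[C]_(d * m)) i, (a *m M) 0 i = linval (vec_mx a) x i) /\
  \rank M = d.
Proof.
move=> tx; have mu0 := mono_k0 tx.
pose M : 'M[C]_(d * m, d) := \matrix_(l, i)
  \sum_k (l == mxvec_index i k)%:R * ev x (mono k).
have ME (a : 'rV[C]_(d * m)) i : (a *m M) 0 i = linval (vec_mx a) x i.
  rewrite mxE; under eq_bigr => l _ do rewrite mxE mulr_sumr.
  rewrite exchange_big; apply: eq_bigr => k _ /=; rewrite mxE.
  rewrite (bigD1 (mxvec_index i k)) //= big1 => [|l /negPf->].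
    by rewrite eqxx mul1r addr0.
  by rewrite mul0r mulr0.
exists M; split=> //; apply/eqP/row_fullP.
exists (\matrix_i' mxvec (\matrix_(i, k)
  ((k == k0)%:R * (i == i')%:R / ev x (mono k0)))).
apply/row_matrixP => i'; rewrite row_mul rowK; apply/rowP => i.
rewrite ME mxvecK /linval (bigD1 k0) //= big1 => [|k /negPf kk0].
  rewrite !mxE eqxx mul1r addr0 mulfVK // eq_sym.
  by [].
by rewrite mxE kk0 !mul0r.
Qed.

(** Rank-nullity for the projection to [Z] of the tangent vectors at a generic point: the image has
    rank at most [e], and the kernel is vertical and satisfies [d] independent linear conditions. *)
Lemma incidence_dim_le e W0 (I : {set 'I_N}) (vf : 'I_#|I| -> 'I_N -> pol N C) W :
    ~ van Z W0 ->
    (forall x, Z x -> ev x W0 != 0 -> forall r (T : 'M[C]_(r, n)),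
       (forall k, tangent Z x (row k T)) -> (\rank T <= e)%N) ->
    ~ van incidence W ->
    (forall k h, van incidence h -> van incidence (vfield (vf k) h)) ->
    (forall k l, vf k (enum_val l) = if k == l then W else 0) ->
  (#|I| + d <= e + d * m)%N.
Proof.
move=> W0P rkZ WP vfP vfI; have prX := incidence_prime.
have liftW0 : ~ van incidence (lift_x W0).
  have [x Zx /eqP Wx] := van_witness W0P.
  move=> /(_ (pt x 0)); rewrite ev_lift_x row_mxKl => W00; apply/Wx/W00.
  apply/incidence_pt; split=> // i; rewrite /linval big1 // => k _.
  by rewrite mxE mul0r.
have [z Xz] : exists2 z, incidence z & ev z (W * lift_x W0) != 0.
  by apply: van_witness => /(primeM prX)[].
rewrite rmorphM mulf_eq0 negb_or /= ev_lift_x => /andP[Wz W0z].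
have [freeT tanT] := tangent_rank Xz Wz vfP vfI.
move: freeT tanT; set TX := \matrix_(k, i) _ => freeT tanT.
pose x := lsubmx z; pose c : 'M[C]_(d, m) := vec_mx (rsubmx z).
have zE : z = pt x c by apply: pt_surj.
have [Zx lc] : incidence (pt x c) by rewrite -zE.
rewrite /pt row_mxKl in Zx.
have inv k : tangent Z x (row k (lsubmx TX)) /\
    forall i, linval (vec_mx (row k (rsubmx TX))) x i + dlin (row k (lsubmx TX)) c x i = 0.
  apply: tangent_incidence_inv; first by rewrite -zE.
  rewrite -zE [pt _ _](_ : _ = row k TX) //.
  by rewrite /pt vec_mxK -row_row_mx hsubmxK.
have [M [ME rkM]] := linval_rank (torZ Zx).
have rk1 := rkZ x Zx W0z _ _ (fun k => (inv k).1).
pose K := kermx (lsubmx TX).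
have K0 : K *m lsubmx TX = 0 by apply: mulmx_ker.
have KE : K = kermx (lsubmx TX) by []; clearbody K.
have KM : K *m rsubmx TX *m M = 0.
  apply/row_matrixP => r; rewrite row0 !row_mul -mulmxA; apply/rowP => i.
  rewrite mulmx_sum_row summxE mxE.
  transitivity (- \sum_k row r K 0 k * dlin (row k (lsubmx TX)) c x i).
    rewrite -sumrN; apply: eq_bigr => k _; rewrite mxE row_mul ME -mulrN.
    by rewrite -[linval _ _ _]opprK (addr0_eq ((inv k).2 i)).
  apply/eqP; rewrite oppr_eq0; apply/eqP.
  transitivity (dlin (row r (K *m lsubmx TX)) c x i); last first.
    by rewrite K0 row0 /dlin big1 // => k _; rewrite dir0l mulr0.
  rewrite /dlin; under eq_bigr => k _ do rewrite mulr_sumr.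
  rewrite exchange_big; apply: eq_bigr => k _ /=.
  rewrite row_mul mulmx_sum_row dir_suml mulr_sumr.
  apply: eq_bigr => l _; rewrite dirZl mulrCA //.
have rkM' : (d <= d * m)%N by have := rank_leq_row M; rewrite rkM.
have rkK : (\rank K <= d * m - d)%N.
  have -> : (d * m - d = \rank (kermx M))%N by rewrite mxrank_ker rkM.
  rewrite -(mxrankMfree K freeT) -[TX]hsubmxK mul_mx_row K0.
  rewrite (_ : row_mx 0 _ = (K *m rsubmx TX) *m row_mx 0 1%:M); last first.
    by rewrite mul_mx_row mulmx0 mulmx1.
  by apply: leq_trans (mxrankM_maxl _ _) _; apply: mxrankS; apply/sub_kermxP.
have := mxrank_ker (lsubmx TX); rewrite -KE => rkK'.
have arith (i r a : nat) : (i - r <= a - d)%N -> (r <= e)%N -> (r <= i)%N ->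
  (d <= a)%N -> (i + d <= e + a)%N by lia.
apply: arith (rank_leq_row (lsubmx TX)) rkM' => //.
by rewrite -rkK'.
Qed.

End Incidence.


(** * Specialisation of a prime ideal at a generic parameter *)

Section Fibers.
Variables (C : numClosedFieldType) (n q : nat) (P : set (pol (n + q) C)).
Hypothesis prP : prime P.
Local Notation B := (pol q C).
Implicit Types (c : 'rV[C]_q) (w : pol n B) (p g : pol (n + q) C) (a : pol n C).

Definition spec c : pol (n + q) C -> pol n C :=
  msubst (fun i => match fintype.split i with
    | inl j => var j | inr l => mpolyC n (c 0 l) end).

HB.instance Definition _ c := GRing.RMorphism.copy (spec c) (msubst _).

Definition lift_l : pol n C -> pol (n + q) C := msubst (fun j => var (lshift q j)).
Definition lift_r : B -> pol (n + q) C := msubst (fun l => var (rshift n l)).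

HB.instance Definition _ := GRing.RMorphism.copy lift_l (msubst _).
HB.instance Definition _ := GRing.RMorphism.copy lift_r (msubst _).

Definition flat : pol n B -> pol (n + q) C :=
  mmap lift_r (fun j => var (lshift q j)).

HB.instance Definition _ := GRing.RMorphism.copy flat (mmap lift_r _).

Definition unflat_const (z : C) : pol n B := mpolyC n (mpolyC q z).

HB.instance Definition _ :=
  GRing.RMorphism.copy unflat_const (@mpolyC n B \o @mpolyC q C).

Definition unflat : pol (n + q) C -> pol n B :=
  mmap unflat_const (fun i => match fintype.split i with
    | inl j => var j | inr l => mpolyC n (var l) end).

HB.instance Definition _ := GRing.RMorphism.copy unflat (mmap unflat_const _).

Lemma flatD : {morph flat : x y / x + y}. Proof. exact: rmorphD. Qed.
Lemma flatB : {morph flat : x y / x - y}. Proof. exact: rmorphB. Qed.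
Lemma flatM : {morph flat : x y / x * y}. Proof. exact: rmorphM. Qed.
Lemma unflatD : {morph unflat : x y / x + y}. Proof. exact: rmorphD. Qed.
Lemma unflatM : {morph unflat : x y / x * y}. Proof. exact: rmorphM. Qed.

Lemma flatC x : flat (mpolyC n x) = lift_r x.
Proof. by rewrite /flat mmapC. Qed.

Lemma flatX j : flat (var j) = var (lshift q j).
Proof. by rewrite /flat mmapX mmap1U. Qed.

Lemma flatZ x w : flat (x *: w) = lift_r x * flat w.
Proof. by rewrite -mul_mpolyC flatM flatC. Qed.

Lemma unflatK p : flat (unflat p) = p.
Proof.
elim/mpoly_ring_ind: p => [z|i|p p' IHp IHq|p p' IHp IHq].
- by rewrite /unflat mmapC /unflat_const flatC /lift_r msubstC.
- rewrite /unflat mmapX mmap1U -{2}(splitK i); case: fintype.splitP => j _ /=.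
    exact: flatX.
  by rewrite flatC /lift_r msubstX.
- by rewrite unflatD flatD; apply: f_equal2.
- by rewrite unflatM flatM; apply: f_equal2.
Qed.

Lemma spec_lift_l c a : spec c (lift_l a) = a.
Proof.
rewrite /spec /lift_l msubst_comp -[RHS]msubst_var; apply: mmap_eq_on => _ j _ _.
by rewrite msubstX split_lshift.
Qed.

Lemma spec_lift_r c x : spec c (lift_r x) = mpolyC n (ev c x).
Proof.
elim/mpoly_ring_ind: x => [z|i|p p' IHp IHq|p p' IHp IHq].
- by rewrite /spec /lift_r !msubstC evC.
- by rewrite /spec /lift_r !msubstX split_rshift evX.
- by rewrite !rmorphD /= IHp IHq.
- by rewrite !rmorphM /= IHp IHq.
Qed.

Lemma spec_flat c w : spec c (flat w) = map_mpoly (ev c) w.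
Proof.
elim/mpoly_ring_ind: w => [z|i|p p' IHp IHq|p p' IHp IHq].
- by rewrite flatC spec_lift_r map_mpolyC.
- by rewrite flatX /spec msubstX split_lshift map_mpolyX.
- by rewrite flatD rmorphD [RHS]rmorphD /=; apply: f_equal2.
- by rewrite flatM rmorphM [RHS]rmorphM /=; apply: f_equal2.
Qed.

Lemma spec0_coef c p : spec c p = 0 -> forall m, ev c (mcoeff m (unflat p)) = 0.
Proof.
move=> cp m; have := congr1 (mcoeff m) (spec_flat c (unflat p)).
by rewrite unflatK cp mcoeff0 mcoeff_map_mpoly.
Qed.

(** The ideal of the scheme-theoretic fiber over [c], which need not be radical. *)
Definition fiber c : set (pol n C) := [set a | exists2 p, P p & a = spec c p].

Lemma fiber_ideal c : ideal (fiber c).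
Proof.
split=> [|_ _ [p Pp ->] [p' Pp' ->]|a _ [p Pp ->]].
- by exists 0; [exact: (ideal0 prP)|rewrite rmorph0].
- by exists (p + p'); [exact: (idealD prP)|rewrite rmorphD].
- exists (lift_l a * p); first exact: (idealM prP).
  by rewrite rmorphM /= spec_lift_l.
Qed.

Lemma fiber_scale c z a : z != 0 -> fiber c (mpolyC n z * a) -> fiber c a.
Proof.
move=> z0 ca; have -> : a = mpolyC n z^-1 * (mpolyC n z * a).
  by rewrite mulrA -mpolyCM mulVf // mul1r.
exact: (idealM (fiber_ideal c)).
Qed.

Lemma flat_ideal (J : set (pol (n + q) C)) : ideal J -> ideal [set w | J (flat w)].
Proof.
move=> idJ; split=> /= [|x y Jx Jy|x y Jy].
- by rewrite rmorph0; apply: ideal0.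
- by rewrite rmorphD; apply: idealD.
- by rewrite rmorphM; apply: idealM.
Qed.

Lemma fiber_regular g : ~ P g -> exists2 rho : B, rho != 0 &
  forall c, ev c rho != 0 -> forall a, fiber c (spec c g * a) -> fiber c a.
Proof.
move=> Pg; have idM := flat_ideal (ideal_add_ideal g (prime_ideal prP)).
have [h h0 [gs gsM red]] := reduction [set w | ideal_add P g (flat w)].
exists h => // c hc a [p Pp pE].
pose w0 := g * lift_l a - p.
have sw0 : spec c w0 = 0 by rewrite rmorphB rmorphM /= spec_lift_l pE subrr.
pose b : set B := [set x | ev c x = 0].
pose D : set (pol n B) := [set w | exists p' q', [/\ P p', spec c p' = 0,
  spec c q' = 0 & flat w = p' + q' * g]].
have [|x y|x y|||x y|x u y|N [r [[p' [q' [Pp' sp' sq' dE]] br sr]]]] :=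
  red b D _ _ _ _ _ _ _ (unflat w0) (spec0_coef sw0).
- exact: rmorph0.
- by rewrite /b /= => bx by'; rewrite rmorphD /= bx by' addr0.
- by rewrite /b /= => by'; rewrite rmorphM /= by' mulr0.
- by exists 0, 0; rewrite !rmorph0 mul0r addr0; split=> //; apply: (ideal0 prP).
- move=> x y [p1 [q1 [P1 s1 t1 e1]]] [p2 [q2 [P2 s2 t2 e2]]].
  exists (p1 + p2), (q1 + q2); rewrite !rmorphD /= s1 s2 t1 t2 e1 e2 addr0.
  by split=> //; [exact: (idealD prP)|rewrite mulrDl addrACA].
- move=> [p1 [q1 [P1 s1 t1 e1]]]; exists (lift_r x * p1), (lift_r x * q1).
  rewrite flatZ !rmorphM /= s1 t1 e1 !mulr0 mulrDr mulrA; split=> //.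
  exact: (idealM prP).
- move=> bx /gsM [j [t [Pj jE]]].
  exists (lift_r x * flat (mpolyX B u) * j), (lift_r x * flat (mpolyX B u) * t).
  have sx : spec c (lift_r x) = 0 by rewrite spec_lift_r bx.
  rewrite flatZ !rmorphM /= sx !mul0r jE; split=> //; first exact: (idealM prP).
  by ring.
have Mr : ideal_add P g (flat r).
  rewrite [r](_ : _ = h ^+ N *: unflat w0 - (h ^+ N *: unflat w0 - r)); last first.
    by rewrite opprB addrC subrK.
  rewrite flatB dE flatZ unflatK.
  exists (- (lift_r (h ^+ N) * p) - p'), (lift_r (h ^+ N) * lift_l a - q').
  split; last by rewrite /w0; ring.
  by apply: (idealB prP) => //; apply: (idealN prP); apply: (idealM prP).
have r0 := standard_eq0 sr Mr.
move: dE; rewrite r0 subr0 flatZ unflatK => dE.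
have Px : P (g * (lift_r (h ^+ N) * lift_l a - q')).
  have -> : g * (lift_r (h ^+ N) * lift_l a - q') = p' + lift_r (h ^+ N) * p.
    by apply/eqP; rewrite -subr_eq0 -[p'](addrK (q' * g)) -dE /w0; apply/eqP; ring.
  by apply: (idealD prP) => //; apply: (idealM prP).
have [//|{}Px] := primeM prP Px.
apply: (@fiber_scale c (ev c h ^+ N)); first exact: expf_neq0.
exists (lift_r (h ^+ N) * lift_l a - q') => //.
rewrite rmorphB rmorphM /= sq' subr0 spec_lift_r spec_lift_l. by rewrite [in RHS]rmorphXn.
Qed.

(** If [p] in [P] specialises to 1, reducing [1 - p] leaves a remainder congruent to [h ^+ N] modulo
    [P]. As [P] contains no nonzero polynomial in the parameters, 1 is standard, so the remainder is
    [h ^+ N]; but its coefficients vanish at [c], where [h] does not. *)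
Lemma fiber_proper : (forall x, P (lift_r x) -> x = 0) ->
  exists2 rho : B, rho != 0 & forall c, ev c rho != 0 -> ~ fiber c 1.
Proof.
move=> indc; have idM := flat_ideal (prime_ideal prP).
have [h h0 [gs gsM red]] := reduction [set w | P (flat w)].
exists h => // c hc [p Pp pE].
have sw0 : spec c (1 - p) = 0 by rewrite rmorphB rmorph1 /= -pE subrr.
pose b : set B := [set x | ev c x = 0].
pose M := [set w | P (flat w)].
have [|x y|x y|||x y|x u y|N [r [Mr br sr]]] :=
  red b M _ _ _ _ _ _ _ (unflat (1 - p)) (spec0_coef sw0).
- exact: rmorph0.
- by rewrite /b /= => bx by'; rewrite rmorphD /= bx by' addr0.
- by rewrite /b /= => by'; rewrite rmorphM /= by' mulr0.
- exact: (ideal0 idM).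
- exact: (idealD idM).
- by move=> My; rewrite /M /= flatZ; apply: (idealM prP).
- by move=> _ /gsM My; rewrite /M /= flatZ rmorphM /=; do 2 apply: (idealM prP).
have M1 : M (h ^+ N *: 1 - r).
  have -> : h ^+ N *: 1 - r = (h ^+ N *: unflat (1 - p) - r) + h ^+ N *: unflat p.
    by rewrite addrAC -scalerDr rmorphB rmorph1 subrK.
  apply: (idealD idM) => //; rewrite /= flatZ unflatK; exact: (idealM prP).
have st1 : standard M (h ^+ N *: 1 - r).
  apply: standardD; last by rewrite -scaleN1r; apply: standardZ.
  apply: standardZ => m; rewrite msupp1 inE => /eqP-> w Mw w0.
  apply/eqP => lw; have wE : w = mpolyC n (mcoeff (@mnm0 n) w).
    by apply: msize1_polyC; rewrite -(mlead_deg w0) lw mdeg0.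
  by move: w0; rewrite wE (indc (mcoeff (@mnm0 n) w)) ?mpolyC0 ?eqxx // -flatC -wE.
have /eqP := standard_eq0 st1 M1; rewrite subr_eq0 => /eqP rE.
have := br (@mnm0 n); rewrite -rE mcoeffZ mcoeff1 eqxx mulr1 /b /= rmorphXn.
by move/eqP; rewrite expf_eq0 (negPf hc) andbF.
Qed.

End Fibers.


(** * Generic linear slices of an irreducible set *)

(** The complement of a single hypersurface, so that conjunctions correspond to products of
    polynomials. *)
Definition generically (C : numClosedFieldType) q (Phi : 'rV[C]_q -> Prop) :=
  exists2 rho : pol q C, rho != 0 & forall c, ev c rho != 0 -> Phi c.

Lemma generically_and (C : numClosedFieldType) q (Phi Psi : 'rV[C]_q -> Prop) :
  generically Phi -> generically Psi -> generically (fun c => Phi c /\ Psi c).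
Proof.
move=> [r r0 rP] [s s0 sP]; exists (r * s); first exact: mulf_neq0.
by move=> c; rewrite rmorphM mulf_eq0 negb_or => /andP[/rP ? /sP ?].
Qed.

Lemma generically_impl (C : numClosedFieldType) q (Phi Psi : 'rV[C]_q -> Prop) :
  (forall c, Phi c -> Psi c) -> generically Phi -> generically Psi.
Proof. by move=> PQ [r r0 rP]; exists r => // c /rP/PQ. Qed.

Lemma generically_true (C : numClosedFieldType) q (Phi : 'rV[C]_q -> Prop) :
  (forall c, Phi c) -> generically Phi.
Proof. by move=> P; exists 1; rewrite ?oner_eq0. Qed.

Section GenericSlice.
Variables (C : numClosedFieldType) (n d m : nat) (Z : set 'rV[C]_n).
Variables (mono : 'I_m -> pol n C) (k0 : 'I_m).
Hypothesis ncC : ~ countable [set: C].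
Hypothesis irrZ : zirreducible Z.
Hypothesis mono_k0 : forall x, torus x -> ev x (mono k0) != 0.
Hypothesis mono_span : forall x, torus x -> forall u : 'rV[C]_n,
  exists g : 'I_m -> C, \sum_k g k * ev x (mono k) = 0 /\
    forall j, \sum_k g k * ev x (mderiv j (mono k)) = u 0 j.

Variables (I : {set 'I_n}) (vf : 'I_#|I| -> 'I_n -> pol n C) (W : pol n C).
Hypothesis vfP : forall k h, van Z h -> van Z (vfield (vf k) h).
Hypothesis vfI : forall k l, vf k (enum_val l) = if k == l then W else 0.
Hypothesis WP : ~ van Z W.
Variable W0 : pol n C.
Hypothesis W0P : ~ van Z W0.
Hypothesis rkZ : forall x, Z x -> ev x W0 != 0 -> forall r (T : 'M[C]_(r, n)),
  (forall k, tangent Z x (row k T)) -> (\rank T <= #|I|)%N.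

Local Notation N := (n + d * m)%N.
Local Notation X := (incidence Z mono : set 'rV[C]_N).
Implicit Types (x : 'rV[C]_n) (c : 'M[C]_(d, m)).

Let prX : prime (van X) := incidence_prime d irrZ mono_k0.

Definition slice (c : 'M[C]_(d, m)) : set 'rV[C]_n :=
  [set x | Z x /\ forall i, linval mono c x i = 0].

Local Notation generically Phi :=
  (generically (fun p : 'rV[C]_(d * m) => Phi (vec_mx p))).

Lemma incidence_dependence t (g : 'I_t -> pol N C) : (#|I| + d * m < t + d)%N ->
  exists2 rho : pol t C, rho != 0 & van X (msubst g rho).
Proof.
move=> It; have [J [v [W' [_ dep W'P vP vJ]]]] := tangent_frame prX (indep_vars0 prX).
apply: dep; have := incidence_dim_le irrZ mono_k0 W0P rkZ W'P vP vJ.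
by move: It; lia.
Qed.

Lemma ev_msubst_c x c (rho : pol (d * m) C) :
  ev (pt x c) (msubst (fun l => var (rshift n l)) rho) = ev (mxvec c) rho.
Proof.
rewrite ev_msubst; congr (ev _ _); apply/rowP => l.
by rewrite mxE evX row_mxEr.
Qed.

(** The [d * m] coefficients outnumber the dimension of the incidence set, so a nonzero polynomial
    in [c] alone vanishes on it. *)
Lemma slice_empty : (#|I| < d)%N -> generically (fun c => ~ (slice c !=set0)).
Proof.
move=> Id; have [|rho rho0 Xr] :=
  @incidence_dependence (d * m) (fun l => var (rshift n l)); first by lia.
exists rho => // p; rewrite -[p]vec_mxK; move: (vec_mx p) => c; rewrite mxvecK.
move=> rc [x [Zx lc]]; have /Xr : X (pt x c) by apply/incidence_pt.
by rewrite ev_msubst_c => /eqP; rewrite (negPf rc).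
Qed.

(** The coefficients together with [g] are dependent on the incidence set. Dividing out powers of
    [g] leaves [r(c) + g s = 0] there, so a zero of [g] in the slice forces [r(c) = 0]. *)
Lemma slice_avoid g : (#|I| <= d)%N -> ~ van X g ->
  generically (fun c => forall x, slice c x -> ev (pt x c) g != 0).
Proof.
move=> Id Xg; have [|rho rho0 Xr] := @incidence_dependence (d * m).+1
  (rcons_fun (fun l => var (rshift n l)) g); first by lia.
have [r r0 [s Xrs]] := last_relation prX Xg rho0 Xr.
exists r => // p; rewrite -[p]vec_mxK; move: (vec_mx p) => c; rewrite mxvecK.
move=> rc x [Zx lc]; have /Xrs : X (pt x c) by apply/incidence_pt.
rewrite rmorphD rmorphM /= ev_msubst_c => rg; apply: contraNneq rc => g0.
by move: rg; rewrite g0 mul0r addr0 => ->.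
Qed.

Let Fib c := fiber (van X) (mxvec c).

Lemma fiber_slice c x : torus x -> (slice c x <-> forall a, Fib c a -> ev x a = 0).
Proof.
move=> tx; split=> [[Zx lc] _ [p Xp ->]|Fx].
  by rewrite [LHS](ev_sflat c x p); apply: Xp; apply/incidence_pt.
split=> [|i].
  have [/zclosedP-> _] := (zirreducibleP Z).1 irrZ; split=> // h Zh.
  apply: Fx; exists (lift_x d m h); first exact: van_lift_x.
  exact/esym/(sflat_lift (d := d) (m := m)).
have /Fx : Fib c (sflat c (\sum_k @cvar C n d m i k * lift_x d m (mono k))).
  eexists; last by [].
  move=> z; rewrite (pt_surj z) => /incidence_pt[_ /(_ i) <-].
  rewrite rmorph_sum; apply: eq_bigr => k _.
  by rewrite rmorphM /= ev_lift_x ev_cvar row_mxKl.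
move=> <-; rewrite ev_sflat rmorph_sum; apply: eq_bigr => k _ /=.
by rewrite rmorphM /= ev_lift_x ev_cvar row_mxKl.
Qed.

Let xpol : pol n C := \prod_i var i.

Lemma ev_xpol x : (ev x xpol != 0) <-> torus x.
Proof.
rewrite rmorph_prod /=; split=> [/prodf_neq0 x0 i|tx].
  by have := x0 i isT; rewrite evX.
by apply/prodf_neq0 => i _; rewrite evX.
Qed.

Lemma lift_xpol_notin : ~ van X (lift_l (d * m) xpol).
Proof.
have [x Zx _] := van_witness WP.
have Xx : X (pt x 0).
  by apply/incidence_pt; split=> // i; rewrite /linval big1 // => k _; rewrite mxE mul0r.
move=> /(_ _ Xx)/eqP; rewrite -[_ == _]negbK => /negP; apply.
rewrite [ev _ _](ev_lift_x (d := d) (m := m)) row_mxKl; apply/ev_xpol.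
exact: zclosed_torus (zirr_closed irrZ) Zx.
Qed.

Lemma fiber_regular_iter g k c a :
  (forall a, Fib c (g * a) -> Fib c a) -> Fib c (g ^+ k * a) -> Fib c a.
Proof.
move=> reg; elim: k a => [|k IHk] a; first by rewrite mul1r.
by rewrite exprS -mulrA => /reg/IHk.
Qed.

Lemma free_c : (d <= #|I|)%N -> forall q, van X (lift_r n q) -> q = 0.
Proof.
move=> dI q Xq; have q0 : lift_r n q = 0.
  apply: (free_vars_indep irrZ mono_k0 mono_span vfP vfI WP dI) Xq.
  apply: only_vars_msubst => mm l _ _; apply: only_varsX.
  by rewrite inE; apply/orP; left; apply/imsetP; exists l.
apply/eqP; apply: contraT => /ev_neq0[u]; rewrite -[u]vec_mxK.
by rewrite -(ev_msubst_c 0) [msubst _ _]q0 rmorph0 eqxx.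
Qed.

(** The generic fiber ideal is proper and the product of the variables is regular modulo it, so it
    contains no power of that product; the Nullstellensatz then gives a point in the torus. *)
Lemma slice_nonempty : (d <= #|I|)%N -> generically (fun c => slice c !=set0).
Proof.
move=> dI; have [r r0 rP] := fiber_proper prX (free_c dI).
have [s s0 sP] := fiber_regular prX lift_xpol_notin.
exists (r * s) => [|p]; first exact: mulf_neq0.
rewrite -[p]vec_mxK; move: (vec_mx p) => c; rewrite mxvecK rmorphM mulf_eq0 negb_or.
move=> /andP[/rP Fc1 /sP reg]; rewrite spec_lift_l in reg.
have [N|x Fx] := nullstellensatz ncC (fiber_ideal prX (mxvec c)) (q := xpol).
  by rewrite -[_ ^+ _]mulr1 => /(fiber_regular_iter reg)/Fc1.
by move/ev_xpol => tx; exists x; apply/fiber_slice.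
Qed.

Lemma spec_mderiv c j (p : pol N C) :
  mderiv j (spec (mxvec c) p) = spec (mxvec c) (mderiv (lshift (d * m) j) p).
Proof.
rewrite mderiv_msubst (bigD1 (lshift _ j)) //= split_lshift mderiv_var eqxx mulr1.
rewrite big1 ?addr0 // => i; case: (fintype.splitP i) => k ik ij.
  rewrite mderiv_var; case: eqP => [jk|_]; last by rewrite mulr0.
  by case/eqP: ij; apply: val_inj; rewrite /= ik jk.
by rewrite mderivC mulr0.
Qed.

Lemma spec_vfield c (v : 'I_N -> pol N C) (p : pol N C) : (forall l, v (rshift n l) = 0) ->
  spec (mxvec c) (vfield v p) =
  vfield (fun j => spec (mxvec c) (v (lshift (d * m) j))) (spec (mxvec c) p).
Proof.
move=> v0; rewrite !vfieldE rmorph_sum big_split_ord /= [X in _ + X]big1 => [|l _].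
  rewrite addr0; apply: eq_bigr => j _; by rewrite rmorphM /= spec_mderiv.
by rewrite v0 mul0r rmorph0.
Qed.

(** Some coordinate [x_i] is free besides [c], so a field tangent to the incidence set moves it at
    speed [W'], fixes [c] and acts on the fiber ideal. If [w] singled out [x] in the slice, a power
    of [w (x_i - x_i(x))] would lie in that ideal, and differentiating it repeatedly would leave a
    power of [w W'] vanishing at [x]. If [W'] itself vanishes at [x], a power of [w W'] lies in the
    ideal, and regularity of [W'] leaves a power of [w]. *)
Lemma slice_not_isolated : (d < #|I|)%N ->
  generically (fun c => forall x w, slice c x -> ev x w != 0 ->
    ~ forall y, slice c y -> y <> x -> ev y w = 0).
Proof.
move=> dI; have free := free_vars_indep irrZ mono_k0 mono_span vfP vfI WP (ltnW dI).
have [J [v [W' [FJ _ W'P vP vJ]]]] := tangent_frame prX free.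
pose i := enum_val (Ordinal dI).
have iJ : lshift (d * m) i \in J.
  apply: (fintype.subsetP FJ); rewrite inE; apply/orP; right; apply/imsetP.
  by exists (Ordinal dI); rewrite ?inE.
pose k := enum_rank_in iJ (lshift (d * m) i).
have kE : enum_val k = lshift (d * m) i by apply: enum_rankK_in.
have vi : v k (lshift (d * m) i) = W' by rewrite -kE vJ eqxx.
have v0 l : v k (rshift n l) = 0.
  have lJ : rshift n l \in J.
    apply: (fintype.subsetP FJ); rewrite inE; apply/orP; left; apply/imsetP.
    by exists l.
  rewrite -(enum_rankK_in lJ lJ) vJ; case: eqP => // kl.
  have := enum_rankK_in lJ lJ; rewrite -kl kE => /(congr1 val) /=.
  by have := ltn_ord i; lia.
have [r r0 rP] := fiber_regular prX W'P.
have [s s0 sP] := fiber_regular prX lift_xpol_notin.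
exists (r * s) => [|p]; first exact: mulf_neq0.
rewrite -[p]vec_mxK; move: (vec_mx p) => c; rewrite mxvecK rmorphM mulf_eq0 negb_or.
move=> /andP[/rP regW /sP regx] x w Sx wx iso; rewrite spec_lift_l in regx.
have tx : torus x by apply: zclosed_torus (zirr_closed irrZ) Sx.1.
have idF := fiber_ideal prX (mxvec c).
have power f : ev x f = 0 -> exists k, Fib c (w ^+ k * f ^+ k).
  move=> fx; apply: contrapT => /forallNP nF.
  have [k' Fk|y Fy] := nullstellensatz ncC idF (q := xpol * (w * f)).
    apply: (nF k'); move: Fk; rewrite exprMn -exprMn exprMn.
    by rewrite [(w * f) ^+ _]exprMn; apply: fiber_regular_iter.
  rewrite !rmorphM !mulf_eq0 !negb_or => /and3P[/ev_xpol ty wy fy].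
  case/eqP: wy; apply: iso; first exact/fiber_slice.
  by move=> yx; case/eqP: fy; rewrite yx.
pose Wc := spec (mxvec c) W'.
have [Wx|Wx] := eqVneq (ev x Wc) 0.
  have [k' Fk] := power _ Wx; rewrite mulrC in Fk.
  have /(fiber_slice c tx).1/(_ _ (fiber_regular_iter regW Fk))/eqP := Sx.
  by rewrite rmorphXn expf_eq0 (negPf wx) andbF.
pose f : pol n C := var i - mpolyC n (x 0 i).
have [|a Fa] := power f; first by rewrite rmorphB /= evX evC subrr.
pose D := vfield (fun j => spec (mxvec c) (v k (lshift (d * m) j))).
have DF h : Fib c h -> Fib c (D h).
  move=> [q Xq ->]; exists (vfield (v k) q); first exact: vP.
  by rewrite spec_vfield.
have iterF b h : Fib c h -> Fib c (iter b D h) by move=> Fh; elim: b => //= b /DF.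
have Df : D f = Wc.
  rewrite /f (derD D) derN /D vfieldC vfield_var oppr0 addr0 vi //.
have [t tE] := der_iter_mulXn D a (w ^+ a) f.
have := (fiber_slice c tx).1 Sx _ (iterF a _ Fa).
rewrite tE Df rmorphD rmorphM /= rmorphMn /= [ev x f](_ : _ = 0); last first.
  by rewrite rmorphB /= evX evC subrr.
move/eqP; rewrite mul0r addr0 mulrn_eq0; apply/negP.
rewrite negb_or -lt0n fact_gt0 rmorphM !rmorphXn /= -exprMn expf_eq0.
by rewrite mulf_eq0 (negPf wx) (negPf Wx) andbF.
Qed.

End GenericSlice.


(** * Linear independence of products of local coordinates *)

Section LeadingForms.
Variables (C : numClosedFieldType) (n : nat) (p : 'rV[C]_n).
Local Notation Q := (pol n C).
Variable fl : nat -> set Q.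
Hypothesis fl_ideal : forall t, ideal (fl t).
Hypothesis flT : forall x, fl 0 x.
Hypothesis flS : forall t x, fl t.+1 x -> fl t x.
Hypothesis flM : forall s t x y, fl s x -> fl t y -> fl (s + t) (x * y).
Hypothesis fl1 : forall x, fl 1 x -> ev p x = 0.

Variables (wt : 'I_n -> nat) (G : 'I_n -> Q) (D : 'I_n -> derivation Q) (Delta : Q).
Hypothesis wt_gt0 : forall j, (0 < wt j)%N.
Hypothesis DG : forall i j, D j (G i) = if i == j then Delta else 0.
Hypothesis Dfl : forall j t x, fl t x -> fl (t - wt j) (D j x).
Hypothesis Gfl : forall j, fl (wt j) (G j).
Hypothesis DC : forall j c, D j (mpolyC n c) = 0.
Hypothesis Delta_p : ev p Delta != 0.

Definition weight (b : mon n) := (\sum_i wt i * b i)%N.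

Lemma fl_le s t x : (s <= t)%N -> fl t x -> fl s x.
Proof.
move=> /subnK<-; elim: (t - s)%N => // k IHk; rewrite addSn => /flS; exact: IHk.
Qed.

Lemma fl_exp t x k : fl t x -> fl (t * k) (x ^+ k).
Proof.
move=> tx; elim: k => [|k IHk]; first by rewrite muln0; apply: flT.
by rewrite mulnS exprS; apply: flM.
Qed.

Lemma fl_prod (I : Type) (r : seq I) (t : I -> nat) (F : I -> Q) :
  (forall i, fl (t i) (F i)) -> fl (\sum_(i <- r) t i) (\prod_(i <- r) F i).
Proof.
move=> tF; elim: r => [|i r IHr]; first by rewrite big_nil; apply: flT.
by rewrite !big_cons; apply: flM.
Qed.

Lemma fl_monomial (b : mon n) : fl (weight b) (\prod_i G i ^+ b i).
Proof. by apply: fl_prod => i; apply: fl_exp. Qed.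

(** Induction on [t]: [D j] lowers the filtration by [wt j] and acts on the form as [Delta] times
    the formal derivative in the [j]-th unknown, the terms that differentiate coefficients keeping
    order [t]. At weight 0 the form is a single coefficient of order 1, which vanishes at [p]. *)
Lemma leading_form t (A : pol n Q) :
    (forall b, b \in msupp A -> weight b = t) -> fl t.+1 (ev (\row_i G i) A) ->
  forall b, ev p (mcoeff b A) = 0.
Proof.
have [k] := ubnP t; elim: k t A => // k IHk t A tk At flA b.
have [bA|] := boolP (b \in msupp A); last by move/memN_msupp_eq0->; rewrite rmorph0.
have evX (m : mon n) : ev (\row_i G i) (mpolyX Q m) = \prod_i G i ^+ m i.
  by rewrite /ev mevalX; apply: eq_bigr => i _; rewrite mxE.
have evE (B : pol n Q) : ev (\row_i G i) B =
    \sum_(m <- msupp B) mcoeff m B * \prod_i G i ^+ m i.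
  rewrite /ev mevalE; apply: eq_bigr => m _; congr (_ * _).
  by apply: eq_bigr => i _; rewrite mxE.
have [b0|[j bj]] : b = @mnm0 n \/ exists j, (0 < b j)%N.
- have [/existsP[j bj]|/existsPn b0] := boolP [exists j, (0 < b j)%N]; [by right; exists j|].
  by left; apply/mnmP => i; rewrite mnm0E; move: (b0 i); rewrite -eqn0Ngt => /eqP.
- have t0 : t = 0%N.
    by rewrite -(At _ bA) b0 /weight big1 // => i _; rewrite mnm0E muln0.
  move: flA; rewrite t0 => /fl1.
  have -> : A = mpolyC n (mcoeff b A); last by rewrite evC mcoeffC b0 eqxx mulr1.
  apply/mpolyP => m; rewrite mcoeffC b0; have [->|m0] := eqVneq (@mnm0 n) m.
    by rewrite mulr1.
  rewrite mulr0; apply: memN_msupp_eq0; apply: contra m0 => /At /eqP.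
  rewrite t0 sum_nat_eq0 => /forallP mi; apply/eqP/mnmP => i; rewrite mnm0E.
  by have := mi i; rewrite /= muln_eq0 eqn0Ngt wt_gt0 => /eqP->.
have DX (m : mon n) : D j (\prod_i G i ^+ m i) =
    Delta * ((m j)%:R * ev (\row_i G i) (mpolyX Q (mnm_sub m (mnm1 j)))).
  have -> : \prod_i G i ^+ m i = msubst G (mpolyX C m).
    by rewrite /msubst mmapX.
  rewrite /msubst (@der_mmap _ (D j) C n (@mpolyC n C) G); last exact: DC.
  rewrite (bigD1 j) //= big1 => [|i ij].
    rewrite addr0 mderivX DG eqxx mulrC evX; congr (_ * _).
    by rewrite mmapZ mmapX /= rmorph_nat.
  by rewrite DG (negPf ij) mulr0.
have DE : D j (ev (\row_i G i) A) =
    \sum_(m <- msupp A) D j (mcoeff m A) * \prod_i G i ^+ m i +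
    ev (\row_i G i) (Delta *: mderiv j A).
  rewrite evZ evE der_sum /mderiv rmorph_sum mulr_sumr -big_split.
  apply: eq_bigr => m _ /=; rewrite derM DX evZ; congr (_ + _); ring.
have := IHk (t - wt j)%N (Delta *: mderiv j A) _ _ _ (mnm_sub b (mnm1 j)).
have bE : mnm_add (mnm_sub b (mnm1 j)) (mnm1 j) = b.
  by apply: submK; apply/mnm_lepP => i; rewrite mnm1E; case: eqP => [<-|].
rewrite mcoeffZ mcoeff_mderiv bE rmorphM rmorphMn /= => IH.
have tE : (wt j <= t)%N.
  rewrite -(At _ bA) /weight (bigD1 j) //=; apply: leq_trans (leq_addr _ _).
  by rewrite leq_pmulr.
have /eqP : ev p Delta * ev p (mcoeff b A) *+ (mnm_sub b (mnm1 j) j).+1 = 0.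
  rewrite -mulrnAr; apply: IH.
  - by have := wt_gt0 j; lia.
  - move=> m /msuppZ_le; rewrite mcoeff_msupp mcoeff_mderiv => Am.
    have /At <- : mnm_add m (mnm1 j) \in msupp A.
      by rewrite mcoeff_msupp; apply: contraNneq Am => ->; rewrite mul0rn.
    rewrite /weight; under [in RHS]eq_bigr => i _ do rewrite mnmDE mulnDr.
    rewrite big_split /= [X in (_ + X - _)%N](_ : _ = wt j) ?addnK //.
    rewrite (bigD1 j) //= mnm1E eqxx muln1 big1 ?addn0 // => i ij.
    by rewrite mnm1E eq_sym (negPf ij) muln0.
  - have : fl (t - wt j).+1 (D j (ev (\row_i G i) A)).
      by rewrite -subSn //; apply: Dfl.
    rewrite DE => fD; rewrite -[ev _ _](addKr (\sum_(m <- msupp A)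
      D j (mcoeff m A) * \prod_i G i ^+ m i)).
    apply: (idealD (fl_ideal _)) => //; apply: (idealN (fl_ideal _)).
    rewrite big_seq; apply: (ideal_sum (fl_ideal _)) => m /At mt.
    apply: (idealM (fl_ideal _)); apply: (@fl_le _ t); last first.
      by rewrite -mt; apply: fl_monomial.
    by have := wt_gt0 j; lia.
by rewrite mulrn_eq0 /= mulf_eq0 (negPf Delta_p) => /eqP.
Qed.

End LeadingForms.

Section Filtration.
Variables (C : numClosedFieldType) (n : nat) (p : 'rV[C]_n).
Local Notation Q := (pol n C).
Variables (J : set Q) (K : nat).
Hypothesis K_gt0 : (0 < K)%N.
Hypothesis idJ : ideal J.
Hypothesis Jp : forall x, J x -> ev p x = 0.

(* The ideals generated by the products of [a] elements of [J] and [b] elements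
   vanishing at [p], for all [a], [b] with [t <= K * a + b]. *)
Inductive filt : nat -> Q -> Prop :=
| filt0 t : filt t 0
| filtD t x y : filt t x -> filt t y -> filt t (x + y)
| filtT x : filt 0 x
| filtJ t a x : J a -> filt t x -> filt (K + t) (a * x)
| filtm t a x : ev p a = 0 -> filt t x -> filt t.+1 (a * x)
| filtS t x : filt t.+1 x -> filt t x.

Lemma filtM s t x y : filt s x -> filt t y -> filt (s + t) (x * y).
Proof.
move=> sx; elim: sx t y => {s x} [s|s x x' _ IH _ IH'|x|s a x Ja _ IH|s a x pa _ IH|s x _ IH] t y ty.
- by rewrite mul0r; apply: filt0.
- by rewrite mulrDl; apply: filtD; [apply: IH|apply: IH'].
- rewrite add0n; elim: ty x => {t y} [t|t y y' _ IH _ IH'|y|t a y Ja _ IH|t a y pa _ IH|t y _ IH] x.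
  + by rewrite mulr0; apply: filt0.
  + by rewrite mulrDr; apply: filtD; [apply: IH|apply: IH'].
  + exact: filtT.
  + by rewrite mulrCA; apply: filtJ.
  + by rewrite mulrCA; apply: filtm.
  + by apply: filtS.
- by rewrite -addnA -mulrA; apply: filtJ => //; apply: IH.
- by rewrite addSn -mulrA; apply: filtm => //; apply: IH.
- by apply: filtS; rewrite -addSn; apply: IH.
Qed.

Lemma filt_ideal t : ideal (filt t).
Proof.
split; [exact: filt0|by move=> x y; apply: filtD|move=> x y ty].
by rewrite -[t]add0n; apply: filtM => //; apply: filtT.
Qed.

Lemma filt1 x : filt 1 x -> ev p x = 0.
Proof.
suff /(_ 1%N x) : forall t x, filt t x -> (0 < t)%N -> ev p x = 0 by move=> H /H->.
move=> {}t {}x; elim=> {t x} [t|t x y _ IH _ IH'|x|t a x Ja _ _|t a x pa _ _|t x _ IH] //.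
- by rewrite rmorph0.
- by move=> t0; rewrite rmorphD /= IH // IH' // addr0.
- by rewrite rmorphM /= Jp // mul0r.
- by rewrite rmorphM /= pa mul0r.
- by move=> _; apply: IH.
Qed.

Lemma filt_leq s t x : (s <= t)%N -> filt t x -> filt s x.
Proof. by apply: fl_le => *; apply: filtS. Qed.

(** Differentiating a factor from [J] may lose its whole order [K]; a field of smaller weight
    therefore has to stabilise [J]. *)
Lemma filt_der (D : derivation Q) w : (0 < w <= K)%N ->
  ((w < K)%N -> forall x, J x -> J (D x)) ->
  forall t x, filt t x -> filt (t - w) (D x).
Proof.
move=> /andP[w0 wK] DJ t x.
elim=> {t x} [t|t x y _ IH _ IH'|x|t a x Ja tx IH|t a x pa tx IH|t x _ IH].
- by rewrite der0; apply: filt0.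
- by rewrite derD; apply: filtD.
- exact: filtT.
- rewrite derM; apply: filtD; last first.
    by apply: (@filt_leq _ (K + (t - w))); [lia|apply: filtJ].
  have [wK'|Kw] := ltnP w K.
    by apply: (@filt_leq _ (K + t)); [lia|apply: filtJ => //; apply: DJ].
  by apply: (@filt_leq _ t); [lia|apply: (idealM (filt_ideal t))].
- rewrite derM; apply: filtD; last first.
    by apply: (@filt_leq _ (t - w).+1); [lia|apply: filtm].
  by apply: (@filt_leq _ t); [lia|apply: (idealM (filt_ideal t))].
- by apply: filt_leq IH; lia.
Qed.

End Filtration.

(** Cramer's rule: the columns of the adjugate Jacobian are, up to its determinant, the fields dual
    to the coordinates [G]. *)
Lemma vfield_adj (C : comNzRingType) n (G : 'I_n -> pol n C) i j :
  let M := \matrix_(i, b) mderiv b (G i) in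
  vfield (fun b => (\adj M) b j) (G i) = if i == j then \det M else 0.
Proof.
move=> M; have := congr1 (fun B : 'M[pol n C]_n => B i j) (mul_mx_adj M).
rewrite !mxE mulrb => <-; rewrite vfieldE; apply: eq_bigr => b _.
by rewrite !mxE mulrC.
Qed.

Section Count.
Variables (C : numClosedFieldType) (n k : nat) (Pt : finType).
Variables (x : Pt -> 'rV[C]_n) (dd : Pt -> nat) (J : Pt -> set (pol n C)).
Variables (lin : 'I_n -> pol n C) (FF : Pt -> 'I_n -> pol n C).
Variables (e : Pt -> pol n C) (u : pol n C).

Let G q (i : 'I_n) := if (i < dd q)%N then lin i else FF q i.
Let M q : 'M[pol n C]_n := \matrix_(i, b) mderiv b (G q i).

Hypothesis J_ideal : forall p, ideal (J p).
Hypothesis J_pt : forall p h, J p h -> ev (x p) h = 0.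
Hypothesis J_FF : forall p q i, J p (FF q i).
Hypothesis lin_pt : forall (p : Pt) (i : 'I_n), (i < dd p)%N -> ev (x p) (lin i) = 0.
Hypothesis M_pt : forall p, ev (x p) (\det (M p)) != 0.
Hypothesis J_field : forall (p : Pt) (j : 'I_n), (j < dd p)%N ->
  forall h, J p h -> J p (vfield (fun b => (\adj (M p)) b j) h).
Hypothesis e_J : forall p q, dd p != dd q -> J p (e q).
Hypothesis e_other : forall p q, p != q -> ev (x p) (e q) = 0.
Hypothesis e_pt : forall p, ev (x p) (e p) != 0.
Hypothesis u_pt : forall p, ev (x p) u != 0.

Notation expo := [set t : n.-tuple 'I_k.+1 | (\sum_(i <- t) i <= k)%N]%SET.

Let mon_of (t : n.-tuple 'I_k.+1) : mon n := Multinom [tuple (tnth t i : nat) | i < n].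

Let member q (b : mon n) : pol n C :=
  e q * (\prod_i G q i ^+ b i) * u ^+ (k - mdeg b).

Variable T : seq (mon n).
Hypothesis member_supp : forall q b, (mdeg b <= k)%N ->
  {subset msupp (member q b) <= T}.

Let mon_ofE t i : mon_of t i = tnth t i.
Proof. by rewrite multinomE tnth_mktuple. Qed.

Let mdeg_mon_of t : t \in expo -> (mdeg (mon_of t) <= k)%N.
Proof.
rewrite inE big_tuple mdegE => /(leq_trans _); apply.
by apply: leq_sum => i _; rewrite mon_ofE.
Qed.

(** In a linear relation take a nonzero term of least weight, say at [p], and filter by order at
    [p]. All terms at other points or of larger weight have larger order, so by [leading_form] the
    coefficients of the leading part vanish at [p]. But they are coefficients of the relation times
    [e p] and a power of [u], both nonzero at [p]. *)
Theorem count_bound : (#|Pt| * 'C(n + k, n) <= size T)%N.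
Proof.
rewrite leqNgt; apply/negP => sT.
pose L : finType := (Pt * {t | t \in expo})%type.
pose mn (l : L) := mon_of (val l.2).
have mn_deg (l : L) : (mdeg (mn l) <= k)%N by apply: mdeg_mon_of; apply: valP.
have mn_inj q : injective (fun t => mn (q, t)).
  move=> t t' /= tt'; apply: val_inj; apply: eq_from_tnth => i; apply: val_inj.
  by have /mnmP/(_ i) := tt'; rewrite !mon_ofE.
have [||c [l0 cl0] c0] := @mpoly_lin_dep C n T L (fun l => member l.1 (mn l)).
- by move=> l; apply: member_supp.
- by rewrite card_prod card_sig card_partial_ord_partitions.
(* [K] exceeds the degree [k] of every product, so one factor from the ideal of the component
   outweighs all the forms that can occur. *)
pose K := k.+1; pose wt (q : Pt) (i : 'I_n) := if (i < dd q)%N then 1%N else K.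
pose w (l : L) := weight (wt l.1) (mn l).
have [[p al] cl wmin] := @arg_minnP L l0 (fun l => c l != 0) w cl0.
pose fl := filt (x p) (J p) K.
have flid t : ideal (fl t) := filt_ideal _ _ _ t.
have flT y : fl 0%N y by apply: filtT.
have flM s t y z : fl s y -> fl t z -> fl (s + t)%N (y * z) by apply: filtM.
have flle s t y : (s <= t)%N -> fl t y -> fl s y by apply: filt_leq.
have flm y : ev (x p) y = 0 -> fl 1%N y.
  by move=> yp; rewrite -[y]mulr1; apply: filtm => //; apply: filtT.
have flJ y : J p y -> fl K y.
  by move=> Jy; rewrite -[y]mulr1 -[K]addn0; apply: filtJ => //; apply: filtT.
have flZ t z y : fl t y -> fl t (z *: y).
  by rewrite -mul_mpolyC; apply: (idealM (flid t)).
have Gfl q i : dd q = dd p -> fl (wt q i) (G q i).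
  rewrite /wt /G => dqp; case: ifP => iq; last exact: flJ.
  by apply: flm; apply: lin_pt; rewrite -dqp.
have term (l : L) : c l != 0 -> ~~ ((l.1 == p) && (w l == w (p, al))) ->
    fl (w (p, al)).+1 (member l.1 (mn l)).
  move=> cl' lp; have lw := wmin l cl'.
  rewrite /member mulrC; apply: (idealM (flid _)).
  have [dlp|dlp] := eqVneq (dd l.1) (dd p).
    have prodfl : fl (w l) (\prod_i G l.1 i ^+ mn l i).
      by apply: fl_monomial => // i; apply: Gfl.
    move: lp; have [lp|lp] := eqVneq l.1 p => /= wl.
      apply: (idealM (flid _)); apply: flle prodfl; rewrite ltn_neqAle lw andbT.
      by rewrite eq_sym.
    apply: (@flle _ (1 + w l)%N) => //; apply: flM => //.
    by apply: flm; apply: e_other; rewrite eq_sym.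
  (* At [p] the forms of a point of another dimension may fail to vanish and are given order 0. This
     loses at most the degree [k], which [e l.1], of order [K], makes up for. *)
  pose wt' i := if (i < dd l.1)%N then 0%N else K.
  have prodfl : fl (weight wt' (mn l)) (\prod_i G l.1 i ^+ mn l i).
    apply: fl_monomial => // i; rewrite /wt' /G; case: ifP => _ //.
    exact: flJ.
  apply: (@flle _ (K + weight wt' (mn l))%N); last first.
    by apply: flM => //; apply: flJ; apply: e_J; rewrite eq_sym.
  have : (w l <= weight wt' (mn l) + mdeg (mn l))%N.
    rewrite /w /weight mdegE -big_split; apply: leq_sum => i _ /=.
    rewrite /wt /wt'; case: ifP => _; last exact: leq_addr.
    by rewrite mul1n mul0n.
  by have := mn_deg l; rewrite /K; lia.
pose Delta := \det (M p).
pose sel (l : L) := (l.1 == p) && (w l == w (p, al)).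
(* The terms at [p] of least weight, as a form in the unknowns [G p i]; by the relation its value is
   minus the sum of terms of larger order. *)
pose A : pol n (pol n C) := \sum_(l : L | sel l)
  (c l *: (e p * u ^+ (k - mdeg (mn l)))) *: mpolyX _ (mn l).
have evA : ev (\row_i G p i) A = \sum_(l : L | sel l) c l *: member l.1 (mn l).
  rewrite rmorph_sum; apply: eq_bigr => l /andP[/eqP lp _] /=.
  rewrite evZ /ev mevalX -scalerAl lp; congr (_ *: _); rewrite /member mulrAC.
  by congr (_ * _ * _); apply: eq_bigr => i _; rewrite mxE.
have Afl : fl (w (p, al)).+1 (ev (\row_i G p i) A).
  rewrite evA; move: c0; rewrite (bigID sel) /= => /eqP; rewrite addr_eq0 => /eqP->.
  apply: (idealN (flid _)); apply: (ideal_sum (flid _)) => l lsel.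
  have [->|cl'] := eqVneq (c l) 0; first by rewrite scale0r; apply: (ideal0 (flid _)).
  by apply: flZ; apply: term.
have Asupp b : b \in msupp A -> weight (wt p) b = w (p, al).
  move=> /msupp_sum_le /flattenP[s /mapP[l]].
  rewrite mem_filter => /andP[/andP[/eqP lp /eqP lw] _] -> /msuppZ_le.
  by rewrite msuppX inE => /eqP->; rewrite -lw /w lp.
have Ap := @leading_form C n (x p) fl flid flT _ flM _ (wt p) (G p)
  (fun j => vfield (fun b => (\adj (M p)) b j)) Delta _ _ _ _ _ (M_pt p) _ A Asupp Afl.
have : ev (x p) (mcoeff (mn (p, al)) A) = 0.
  apply: Ap.
  - by move=> t y; apply: filtS.
  - by move=> y; apply: filt1 => //; apply: J_pt.
  - by move=> j; rewrite /wt; case: ifP.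
  - by move=> i j; apply: vfield_adj.
  - move=> j t y; apply: filt_der => //; first by rewrite /wt; case: ifP => //; rewrite leqnn.
    by rewrite /wt; case: ifP => [jp _|_]; [apply: J_field|rewrite ltnn].
  - by move=> j; apply: Gfl.
  - by move=> j z; apply: vfieldC.
rewrite raddf_sum (bigD1 (p, al)) /=; last by rewrite /sel /= !eqxx.
rewrite big1 => [|l /andP[/andP[/eqP lp _] lal]].
  rewrite addr0 mcoeffZ mcoeffX eqxx mulr1 evZ rmorphM rmorphXn /=.
  move/eqP; rewrite !mulf_eq0 (negPf cl) (negPf (e_pt p)) /=.
  by rewrite expf_eq0 (negPf (u_pt p)) andbF.
rewrite mcoeffZ mcoeffX; case: eqP => [ml|_]; last by rewrite mulr0.
case/eqP: lal; move: lp ml; case: l => q t /= -> ml; congr (_, _).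
exact: (mn_inj p).
Qed.

End Count.


(** * Lower bounds for volumes by cubes *)

Section VolumeLowerBound.
Variable R : realType.
Local Notation mu := (@lebesgue_measure R).

Lemma vol_ge0 n (B : set 'rV[R]_n) : (0 <= vol B)%E.
Proof.
elim: n B => [|n IHn] B /=; first by rewrite lee_fin indicE ler0n.
by apply: integral_ge0 => t _; apply: IHn.
Qed.

(* No measurability is needed, the integral of a nonnegative function being a
   lower integral. *)
Lemma integral_le_ge0 (f g : R -> \bar R) : (forall t, 0 <= f t)%E ->
    (forall t, f t <= g t)%E ->
  (\int[mu]_(t in [set: R]) f t <= \int[mu]_(t in [set: R]) g t)%E.
Proof.
move=> f0 fg; rewrite !ge0_integralTE //; last first.
  by move=> t; apply: le_trans (fg t).
apply: ereal_sup_le => _ [h hf <-]; exists h => // t.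
exact: le_trans (hf t) (fg t).
Qed.

Lemma integral_steps (zs : seq int) (c : int -> R) (v h : R) : 0 < h ->
    (forall z, 0 <= c z) ->
  (\int[mu]_(t in [set: R])
    \sum_(z <- zs) (c z)%:E * (\1_(`[v + h * z%:~R, (v + h * (z%:~R + 1))[%classic) t)%:E =
   (\sum_(z <- zs) c z * h)%:E)%E.
Proof.
move=> h0 c0; rewrite ge0_integral_sum //; last first.
- by move=> z t _; rewrite mule_ge0 // lee_fin.
- move=> z; apply: measurable_funeM; apply/measurable_EFinP.
  exact: measurable_indic.
rewrite -sumEFin; apply: eq_bigr => z _.
rewrite ge0_integralZl_EFin //; last first.
  by apply/measurable_EFinP; apply: measurable_indic.
rewrite integral_indic // setIT EFinM; congr (_ * _)%E.
rewrite [LHS]lebesgue_measure_itv /= lte_fin.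
by rewrite ltrD2l ltr_pM2l // ltrDl ltr01 -EFinD; congr _%:E; ring.
Qed.

Lemma sum_fibers (T : eqType) (f : T -> int) (s : seq T) :
  (\sum_(z <- undup (map f s)) size [seq a <- s | f a == z])%N = size s.
Proof.
under eq_bigr => z _ do rewrite size_filter -sum1_count big_mkcond.
rewrite exchange_big /= -[RHS]sum1_size big_seq [RHS]big_seq.
apply: eq_bigr => a sa; rewrite (bigD1_seq (f a)) ?undup_uniq //=; last first.
  by rewrite mem_undup map_f.
by rewrite eqxx big1 // => z /negPf fz; rewrite eq_sym fz.
Qed.

(** Half-open cubes at distinct lattice points are disjoint. By induction the section at [t] has at
    least the volume of the cubes in the layer of [t], and integrating this step function over the
    first coordinate counts all cubes. *)
Theorem vol_cubes n (B : set 'rV[R]_n) (P : seq 'rV[int]_n) (v : 'rV[R]_n) h :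
    0 < h -> uniq P ->
    (forall a (y : 'rV[R]_n), a \in P -> (forall i,
      v 0 i + h * (a 0 i)%:~R <= y 0 i < v 0 i + h * ((a 0 i)%:~R + 1)) -> B y) ->
  (((size P)%:R * h ^+ n)%:E <= vol B)%E.
Proof.
elim: n B P v => [|n IHn] B P v h0 uP cB /=.
  case: P uP cB => [|a [|b P]] uP cB; first by rewrite mul0r lee_fin indicE ler0n.
    by rewrite indicE mem_set ?mulr1 //; apply: (cB a); rewrite ?mem_head // => -[].
  by move: uP; rewrite (thinmx0 a) (thinmx0 b) /= inE eqxx.
pose hd (a : 'rV[int]_n.+1) := a 0 ord0.
pose tl T (a : 'rV[T]_n.+1) : 'rV[T]_n := \row_j a 0 (lift ord0 j).
pose Pz z := [seq a <- P | hd a == z].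
pose c z : R := (size (Pz z))%:R * h ^+ n.
have c0 z : 0 <= c z by rewrite mulr_ge0 // exprn_ge0 // ltW.
pose phi t := (\sum_(z <- undup (map hd P)) (c z)%:E *
  (\1_(`[v 0 ord0 + h * z%:~R, (v 0 ord0 + h * (z%:~R + 1))[%classic) t)%:E)%E.
have -> : ((size P)%:R * h ^+ n.+1)%:E = (\int[mu]_(t in [set: R]) phi t)%E.
  rewrite integral_steps // -(sum_fibers hd P) natr_sum mulr_suml; congr _%:E.
  by apply: eq_bigr => z _; rewrite exprSr mulrA.
apply: integral_le_ge0 => t.
  by apply: sume_ge0 => z _; rewrite mule_ge0 // lee_fin.
have := @vol_ge0 n [set y | B (row_mx (const_mx t : 'rV[R]_1) y)].
have [[z zP zt]|none] := pselect (exists2 z, z \in map hd P &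
  v 0 ord0 + h * z%:~R <= t < v 0 ord0 + h * (z%:~R + 1)); last first.
  rewrite /phi big_seq big1 // => z; rewrite mem_undup => zP.
  rewrite indicE memNset ?mule0 // => /=; rewrite in_itv /= => zt.
  by apply: none; exists z.
move=> _.
have -> : phi t = (c z)%:E.
  rewrite /phi (bigD1_seq z) ?undup_uniq ?mem_undup //= big1 => [|z' z'z].
    by rewrite indicE mem_set ?mule1 ?adde0 //= in_itv.
  rewrite indicE memNset ?mule0 //= in_itv /= => zt'.
  case/eqP: z'z; move: zt zt' => /andP[z1 z2] /andP[z3 z4].
  have := le_lt_trans z1 z4; have := le_lt_trans z3 z2.
  rewrite !ltrD2l !ltr_pM2l // -!intrD1 !ltr_int; lia.
rewrite /c -(size_map (tl int)); apply: (IHn _ _ (tl R v)).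
- exact: h0.
- rewrite map_inj_in_uniq ?filter_uniq // => a b.
  rewrite !mem_filter => /andP[/eqP az _] /andP[/eqP bz _] /rowP ab.
  apply/rowP => i; case: (unliftP ord0 i) => [j ->|->]; last exact: etrans az (esym bz).
  by have := ab j; rewrite !mxE.
- move=> a y /mapP[b]; rewrite mem_filter => /andP[/eqP bz bP] -> yb.
  pose r := row_mx (const_mx t : 'rV[R]_1) y.
  have r0 : r 0 ord0 = t.
    by rewrite (_ : ord0 = lshift n (ord0 : 'I_1)) ?row_mxEl ?mxE //; apply: val_inj.
  have rS j : r 0 (lift ord0 j) = y 0 j.
    by rewrite (_ : lift ord0 j = rshift 1 j) ?row_mxEr //; apply: val_inj.
  apply: (cB b) => // i; rewrite -/r; case: (unliftP ord0 i) => [j ->|->].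
    by have := yb j; rewrite rS [tl int b 0 j]mxE [tl R v 0 j]mxE.
  by rewrite r0; move: zt; rewrite -bz.
Qed.

End VolumeLowerBound.


(** * Sumsets of the support and the volume of its convex hull *)

(** With full rank and all invariant factors 1 the Smith form is an identity block followed by
    zeros, whose transpose is a right inverse; the columns of [A] thus generate the whole
    lattice. *)
Lemma standard_form_section n m (A : 'M[int]_(n, m)) : standard_form A ->
  exists B : 'M[int]_(m, n), A *m B = 1%:M.
Proof.
move=> [nm _ rkA [e [size_e _ _ [L [Q /andP[uL uQ] AE]]] e1]].
set D := \matrix_(i, j) _ in AE.
have size_e' : size e = n by rewrite size_e (minn_idPl _) //; lia.
have en (i : 'I_n) : e`_i = 1.
  apply: e1; first by rewrite mem_nth // size_e'.
  (* A zero on the diagonal would give a nonzero integral row killing [A], against the rank. *)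
  apply/eqP => ei; pose u : 'rV[int]_n := delta_mx 0 i *m invmx L.
  have uA : u *m A = 0.
    rewrite AE !mulmxA mulmxKV // -rowE (_ : row i D = 0) ?mul0mx //.
    by apply/rowP => j; rewrite !mxE ei mul0rn.
  have : map_mx (intr : int -> rat) u == 0.
    have := congr1 (map_mx (intr : int -> rat)) uA; rewrite map_mxM map_mx0.
    by move/eqP; rewrite mulmx_free_eq0 // /row_free rkA.
  move/eqP/rowP => u0; have {}u0 : u = 0.
    by apply/rowP => j; have := u0 j; rewrite !mxE => /eqP; rewrite intr_eq0 => /eqP.
  have := congr1 (mulmx^~ L) u0; rewrite /u mulmxKV // mul0mx => /rowP/(_ i).
  by rewrite !mxE !eqxx.
exists (invmx Q *m D^T *m invmx L).
rewrite AE !mulmxA mulmxK // -[L *m D *m D^T]mulmxA (_ : D *m D^T = 1%:M).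
  by rewrite mulmx1 mulmxV.
apply/matrixP => i j; rewrite !mxE.
have im : (i < m)%N by have := ltn_ord i; lia.
rewrite (bigD1 (Ordinal im)) //= !mxE /= eqxx en mulr1n mul1r en big1 ?addr0 => [|k ki].
  by rewrite eq_sym.
rewrite !mxE; case: eqP => [ik|_]; last by rewrite mulr0n mul0r.
by case/eqP: ki; apply: val_inj.
Qed.

Section LatticeVolume.
Variables (R : realType) (n : nat) (S : {fset 'rV[int]_n}).
Local Notation m := #|` S|.
Local Notation A := (exponent_matrix S).
Local Notation conv := (convhull R S).

Definition realpt (a : 'rV[int]_n) : 'rV[R]_n := map_mx intr a.

Lemma exponent_matrix_col k : (col k A)^T = S`_k.
Proof. by apply/rowP => i; rewrite !mxE. Qed.

Lemma convhull_pt k : conv (realpt (col k A)^T).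
Proof.
apply: sub_gen_smallest; exists (col k A)^T => //=.
by rewrite exponent_matrix_col mem_nth.
Qed.

Lemma convhull_conv (x y : 'rV[R]_n) s : 0 <= s <= 1 -> conv x -> conv y ->
  conv (s *: x + (1 - s) *: y).
Proof.
move=> /andP[s0 s1] cx cy X XP; have [cX _] := XP.
have /set_mem := cX x y (Itv01 s0 s1) (mem_set (cx X XP)) (mem_set (cy X XP)).
by [].
Qed.

Lemma convhull_sum (r : seq 'I_m) (c : 'I_m -> R) x : (forall k, 0 <= c k) ->
    \sum_(k <- r) c k <= 1 -> conv x ->
  conv (\sum_(k <- r) c k *: realpt (col k A)^T + (1 - \sum_(k <- r) c k) *: x).
Proof.
move=> c0; elim: r x => [|k r IHr] x; first by rewrite !big_nil add0r subr0 scale1r.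
rewrite !big_cons; set s := \sum_(j <- r) c j => s1 cx.
have s0 : 0 <= s by apply: sumr_ge0.
have s2 : s <= 1 by have := c0 k; lra.
have [s1'|s1'] := eqVneq (1 - s) 0.
  have ck : c k = 0 by apply/eqP; rewrite eq_le c0 andbT; lra.
  by rewrite ck scale0r !add0r; apply: IHr.
have s1'' : 0 < 1 - s by rewrite lt_neqAle eq_sym s1' /=; have := c0 k; lra.
pose t := c k / (1 - s).
have t01 : 0 <= t <= 1.
  rewrite divr_ge0 ?ler_pdivrMr //=; [lra|lra].
have := IHr (t *: realpt (col k A)^T + (1 - t) *: x) _ (convhull_conv t01 (convhull_pt k) cx).
rewrite scalerDr !scalerA -/s => H; rewrite addrAC [X in conv X](_ : _ =
  \sum_(j <- r) c j *: realpt (col j A)^T +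
    (((1 - s) * t) *: realpt (col k A)^T + ((1 - s) * (1 - t)) *: x)).
  by apply: H.
have -> : (1 - s) * t = c k by rewrite mulrC divfK.
have -> : (1 - s) * (1 - t) = 1 - (c k + s) by rewrite mulrBr mulr1 [_ * t]mulrC divfK //; ring.
by rewrite addrC addrA.
Qed.

Definition ksums K : seq 'rV[int]_n :=
  undup [seq \sum_l (col (f l) A)^T | f : {ffun 'I_K -> 'I_m}].

Variables (B : 'M[int]_(m, n)) (k0 : 'I_m).
Hypothesis AB : A *m B = 1%:M.
Hypothesis Ak0 : col k0 A = 0.

(** A point of a cube is [h (M s + a + t)] with [s] the sum of all columns, [a] a [K]-fold sum and
    [t] in the unit cube. Writing [t = A (B t)] spreads the error over the columns with coefficients
    at most [M] in absolute value, so all weights are nonnegative; their sum is at most 1, and the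
    zero column takes the rest. *)
Lemma vol_ksums : exists c0 : nat, forall K,
  (((size (ksums K))%:R * ((K + c0).+1%:R)^-1 ^+ n)%:E <= vol conv)%E.
Proof.
pose M := (\sum_k \sum_i absz (B k i))%N.
(* The total weight is at most [h (K + 2 m M)]. *)
exists (m * (2 * M))%N => K; set h := _^-1.
have h0 : 0 < h by rewrite invr_gt0 ltr0n.
apply: (@vol_cubes R n conv (ksums K) (h *: \sum_k M%:R *: realpt (col k A)^T)) => //.
  exact: undup_uniq.
move=> _ y /[!mem_undup] /mapP[f _ ->].
set a := \sum_l (col (f l) A)^T => ya.
pose t i := (y 0 i - (h *: \sum_k M%:R *: realpt (col k A)^T) 0 i) / h - (a 0 i)%:~R.
have t01 i : 0 <= t i < 1.
  have /andP[y1 y2] := ya i.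
  rewrite /t subr_ge0 ler_pdivlMr // ltrBlDr ltr_pdivrMr //.
  by apply/andP; split; lra.
pose c k : R := h * (M%:R + (\sum_l (f l == k))%N%:R + \sum_i (B k i)%:~R * t i).
have bt k : `|\sum_i (B k i)%:~R * t i| <= M%:R.
  apply: le_trans (ler_norm_sum _ _ _) _; rewrite /M natr_sum (bigD1 k) //=.
  rewrite natr_sum -[X in X <= _]addr0; apply: lerD; last exact: sumr_ge0.
  apply: ler_sum => i _; rewrite normrM natr_absz intr_norm.
  have /andP[t0 t1] := t01 i.
  by rewrite -[X in _ <= X]mulr1 ler_wpM2l // ger0_norm // ltW.
have c0 k : 0 <= c k.
  apply: mulr_ge0; first exact: ltW.
  have := bt k; rewrite ler_norml => /andP[b1 _].
  by have := ler0n R (\sum_l (f l == k)); lra.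
have sc : \sum_k c k <= 1.
  rewrite -mulr_sumr mulrC ler_pdivrMr ?ltr0n // mul1r.
  apply: (@le_trans _ _ (\sum_k ((2 * M)%:R + (\sum_l (f l == k))%N%:R))).
    apply: ler_sum => k _; have := bt k; rewrite ler_norml => /andP[_].
    by rewrite natrM; lra.
  rewrite big_split /= sumr_const card_ord -natr_sum exchange_big /=.
  rewrite (eq_bigr (fun=> 1%N)) => [|l _].
    by rewrite sum1_card card_ord -mulrnA mulnC -natrD ler_nat; lia.
  by rewrite (bigD1 (f l)) //= eqxx big1 // => k /negPf fk; rewrite eq_sym fk.
have := convhull_sum (r := index_enum _) c0 sc (convhull_pt k0).
rewrite Ak0; rewrite [realpt _](_ : _ = 0); last by apply/rowP => i; rewrite !mxE.
rewrite scaler0 addr0; congr (conv _); apply/rowP => j.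
have BA i : (\sum_k (B k i)%:~R * (A j k)%:~R : R) = (j == i)%:R.
  have := congr1 (fun X : 'M[int]_n => (X j i)%:~R : R) AB; rewrite !mxE.
  rewrite rmorph_sum; under [in LHS]eq_bigr => k _ do rewrite rmorphM mulrC.
  by move=> ->; case: eqP.
have aE : (a 0 j)%:~R = \sum_k (\sum_l (f l == k))%N%:R * (A j k)%:~R :> R.
  rewrite summxE rmorph_sum /=; under [RHS]eq_bigr => k _ do rewrite natr_sum mulr_suml.
  rewrite exchange_big; apply: eq_bigr => l _ /=.
  rewrite (bigD1 (f l)) //= eqxx mul1r big1 ?addr0 ?mxE // => k /negPf fk.
  by rewrite eq_sym fk mul0r.
have bE : t j = \sum_k (\sum_i (B k i)%:~R * t i) * (A j k)%:~R.
  under eq_bigr => k _ do rewrite mulr_suml.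
  rewrite exchange_big (bigD1 j) //= [X in _ + X]big1 => [|i ij].
    rewrite addr0; transitivity ((j == j)%:R * t j); first by rewrite eqxx mul1r.
    rewrite -BA mulr_suml.
    by apply: eq_bigr => k _; rewrite mulrAC.
  transitivity (t i * \sum_k (B k i)%:~R * (A j k)%:~R).
    by rewrite mulr_sumr; apply: eq_bigr => k _; rewrite mulrAC mulrC.
  by rewrite BA eq_sym (negPf ij) mulr0.
have yE : y 0 j = h * (\sum_k M%:R * (A j k)%:~R + (a 0 j)%:~R + t j).
  have VE : (h *: \sum_k M%:R *: realpt (col k A)^T) 0 j =
      h * \sum_k M%:R * (A j k)%:~R.
    by rewrite mxE summxE; congr (_ * _); apply: eq_bigr => k _; rewrite !mxE.
  by rewrite /t VE; field; rewrite gt_eqF.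
rewrite yE bE aE -!big_split mulr_sumr summxE; apply: eq_bigr => k _ /=.
by rewrite !mxE /c -!mulrDl mulrA.
Qed.

End LatticeVolume.

Lemma bernoulli_le (R : realDomainType) (t : R) n : 0 <= t <= 1 ->
  1 - t *+ n <= (1 - t) ^+ n.
Proof.
move=> /andP[t0 t1]; elim: n => [|n IHn]; first by rewrite mulr0n subr0.
rewrite exprS; apply: le_trans (_ : (1 - t) * (1 - t *+ n) <= _); last first.
  by apply: ler_wpM2l => //; lra.
rewrite mulrS -mulr_natr; have : 0 <= t * t * n%:R by rewrite !mulr_ge0.
by lra.
Qed.

(** As ['C(n + k, n)] is at least [(k + 1)^n / n!], the hypotheses give [N (1 - t)^n <= n! V] with
    [t = c / (k + c + 1)]. Bernoulli's inequality bounds a positive gap [N - n! V] by [N n t], which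
    is impossible for large [k]. *)
Lemma volume_limit (R : realType) n (N c : nat) (V : \bar R) (s : nat -> nat) :
    (forall k, N * 'C(n + k, n) <= s k)%N ->
    (forall k, ((s k)%:R * ((k + c).+1%:R)^-1 ^+ n)%:E <= V)%E ->
  ((N%:R : R)%:E <= (n`!)%:R%:E * V)%E.
Proof.
move=> Ns; case: V => [r sV|_|/(_ 0%N)]; last 2 first.
- by rewrite gt0_muley ?leey ?lte_fin ?ltr0n ?fact_gt0.
- by rewrite leeNy_eq.
rewrite -EFinM lee_fin leNgt; apply/negP => Nr.
pose d : R := N%:R - n`!%:R * r; have d0 : 0 < d by rewrite subr_gt0.
have key k : d <= N%:R * (n * c)%:R / (k + c).+1%:R.
  have x0 : 0 < (k + c).+1%:R :> R by rewrite ltr0n.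
  have := sV k; rewrite lee_fin exprVn ler_pdivrMr ?exprn_gt0 // => skr.
  have Nk : N%:R * (k.+1%:R : R) ^+ n <= n`!%:R * (r * (k + c).+1%:R ^+ n).
    apply: le_trans (_ : n`!%:R * (s k)%:R <= _); last by rewrite ler_wpM2l.
    rewrite -natrX -!natrM ler_nat; apply: leq_trans (leq_mul (leqnn _) (Ns k)).
    rewrite mulnCA leq_mul2l mulnC bin_ffact; apply/orP; right.
    elim: (n) => // n' IHn'; rewrite expnS ffactnS addSn /= leq_mul //.
    by rewrite ltnS leq_addl.
  pose t : R := c%:R / (k + c).+1%:R.
  have kE : k.+1%:R = (k + c).+1%:R * (1 - t) :> R.
    rewrite /t mulrBr mulr1 mulrCA divff ?gt_eqF // mulr1 -addSn natrD; ring.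
  have t01 : 0 <= t <= 1.
    by rewrite divr_ge0 //= ler_pdivrMr // mul1r ler_nat; lia.
  have {}Nk : N%:R * (1 - t) ^+ n <= n`!%:R * r.
    rewrite -(ler_pM2r (exprn_gt0 n x0)) -!mulrA [(1 - t) ^+ n * _]mulrC -exprMn -kE.
    exact: Nk.
  have := bernoulli_le n t01 => b.
  have : N%:R * (1 - t *+ n) <= n`!%:R * r by apply: le_trans Nk; rewrite ler_wpM2l.
  have tE : N%:R * (t *+ n) = N%:R * (n * c)%:R / (k + c).+1%:R.
    by rewrite natrM -(mulr_natl t) /t !mulrA.
  by rewrite /d -tE mulrBr mulr1; lra.
have := truncnS_gt (N%:R * (n * c)%:R / d); set k := Num.truncn _ => kP.
have := key k; rewrite leNgt => /negP; apply.
rewrite ltr_pdivrMr ?ltr0n // [d * _]mulrC -ltr_pdivrMr //; apply: lt_le_trans kP _.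
by rewrite ler_nat ltnS leq_addr.
Qed.


(** * Irreducible components and isolated points *)

Section Components.
Variables (C : numClosedFieldType) (n : nat).
Implicit Types (V Z : set 'rV[C]_n) (x : 'rV[C]_n).

(** Among the irreducible pieces that contain a given piece through [x], one that contains the most
    pieces is maximal. *)
Lemma component_exists V x : zclosed V -> V x -> exists2 Z, component V Z & Z x.
Proof.
move=> cV Vx; have [k [Y [irrY VE]]] := zclosed_finite_union cV.
have YV i : Y i `<=` V by rewrite VE => y Yy; exists i.
have [i0 Yx] : exists i, Y i x by move: Vx; rewrite VE.
pose deg i := #|[pred l | `[< Y l `<=` Y i >]]|.
have [i /asboolP Yi imax] := @arg_maxnP _ i0 (fun i => `[< Y i0 `<=` Y i >]) deg
  (introT (asboolP _) (fun y Yy => Yy)).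
exists (Y i); last exact: Yi.
split=> // Z' irrZ' Z'V YZ'.
have [|l Zl] := zirr_finite_union irrZ' (fun i => zirr_closed (irrY i)).
  by rewrite -VE.
have Yil : Y i `<=` Y l by apply: subset_trans Zl.
suff Yli : Y l `<=` Y i by apply/seteqP; split=> //; apply: subset_trans Yli.
apply: contrapT => nYli.
have /imax : `[< Y i0 `<=` Y l >] by apply/asboolP => y /Yi/Yil.
apply/negP; rewrite -ltnNge; apply: proper_card; apply/properP; split.
  apply/fintype.subsetP => j; rewrite !inE => /asboolP Yj.
  by apply: subset_trans Yil; apply/asboolP.
by exists l; rewrite inE ?asboolF.
Qed.

Lemma components_finite V : zclosed V -> exists k (Y : 'I_k -> set 'rV[C]_n),
  (forall i, zirreducible (Y i)) /\ forall Z, component V Z -> exists i, Z = Y i.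
Proof.
move=> cV; have [k [Y [irrY VE]]] := zclosed_finite_union cV.
exists k, Y; split=> // Z [irrZ ZV Zmax].
have [|i Zi] := zirr_finite_union irrZ (fun i => zirr_closed (irrY i)).
  by rewrite -VE.
by exists i; rewrite -(Zmax (Y i)) // VE => y Yy; exists i.
Qed.

Lemma irr_chain_leq Z k l : (k <= l)%N -> irr_chain Z l -> irr_chain Z k.
Proof.
move=> kl [T [T1 T2]]; exists T; split=> i ik; [apply: T1|apply: T2].
  exact: leq_trans kl.
exact: leq_trans kl.
Qed.

Lemma has_zdim_unique Z k l : has_zdim Z k -> has_zdim Z l -> k = l.
Proof.
move=> [Zk nZk] [Zl nZl]; apply/eqP; rewrite eqn_leq; apply/andP; split.
  by rewrite leqNgt; apply/negP => lk; apply: nZl; apply: irr_chain_leq Zk.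
by rewrite leqNgt; apply/negP => lk; apply: nZk; apply: irr_chain_leq Zl.
Qed.

Lemma zirreducible_pt x : torus x -> zirreducible [set x].
Proof.
move=> tx; apply/zirreducibleP; split.
  apply/zclosedP/seteqP; split=> [y ->|y [ty xy]]; first by split=> // p; apply.
  apply/rowP => i; have := xy (var i - mpolyC n (x 0 i)) _.
  rewrite rmorphB /= evX evC => H; apply/eqP; rewrite -subr_eq0; apply/eqP/H.
  by move=> _ ->; rewrite rmorphB /= evX evC subrr.
split; first exact: van_ideal.
  by move=> /(_ x erefl)/eqP; rewrite rmorph1 oner_eq0.
move=> p q /(_ x erefl)/eqP; rewrite rmorphM mulf_eq0 => /orP[]/eqP p0.
  by left=> _ ->.
by right=> _ ->.
Qed.

Lemma zdim0_pt Z x : zirreducible Z -> has_zdim Z 0 -> Z x -> Z = [set x].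
Proof.
move=> irrZ [_ nZ1] Zx; apply: contrapT => Zneq; apply: nZ1.
have tx := zclosed_torus (zirr_closed irrZ) Zx.
exists (fun i => if i is 0%N then [set x] else Z); split=> [[|i] _|[|i] //= _].
- by split; [exact: zirreducible_pt|move=> _ ->].
- by split.
split=> [_ ->//|Zsub]; apply: Zneq; apply/seteqP; split=> // _ -> //.
Qed.

Lemma pt_zdim0 x : torus x -> has_zdim [set x] 0.
Proof.
move=> tx; have irrx := zirreducible_pt tx; split.
  by exists (fun=> [set x]); split=> // i _; split.
move=> [T [T1 T2]]; have [irr0 _] := T1 0%N isT; have [_ T1x] := T1 1%N isT.
have [T01 nT10] := T2 0%N isT; have [_ [y T0y] _] := irr0.
apply: nT10 => z /T1x ->; have := T01 y T0y => /T1x <-; exact: T0y.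
Qed.

(** A product over the irreducible pieces of [V]: each piece other than the point itself misses [x],
    and contributes a function vanishing on it but not at [x]. *)
Lemma isolated_witness V x : zclosed V -> component V [set x] ->
  exists2 w, ev x w != 0 & forall y, V y -> y <> x -> ev y w = 0.
Proof.
move=> cV [irrx xV xmax]; have [k [Y [irrY VE]]] := zclosed_finite_union cV.
have tx : torus x by apply: (zclosed_torus cV); apply: xV.
have /choice[p pP] i : exists p, ev x p != 0 /\ forall y, Y i y -> y <> x -> ev y p = 0.
  have [Yx|nYx] := pselect (Y i x).
    exists 1; split; first by rewrite rmorph1 oner_eq0.
    have -> : Y i = [set x].
      by apply: xmax => [//|z Yz|_ -> //]; rewrite VE; exists i.
    by move=> y ->.
  have [p pY px] := zclosed_sep (zirr_closed (irrY i)) tx nYx.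
  by exists p; split=> // y /pY.
exists (\prod_i p i) => [|y].
  by rewrite rmorph_prod; apply/prodf_neq0 => i _; case: (pP i).
rewrite VE => -[i Yy] yx; rewrite rmorph_prod (bigD1 i) //= (pP i).2 //.
by rewrite mul0r.
Qed.

(* The tangent frame of an irreducible set through a nonsingular zero of [G] on
   which [G] vanishes is empty. *)
Lemma nonsingular_zero Z x (G : 'I_n -> pol n C) : zirreducible Z -> Z x ->
    (forall i, van Z (G i)) ->
    ev x (\det (\matrix_(i, j) mderiv j (G i) : 'M[pol n C]_n)) != 0 ->
  Z = [set x].
Proof.
move=> irrZ Zx ZG; set M : 'M[pol n C]_n := \matrix_(i, j) _ => Mx.
have prZ := zirr_prime irrZ.
have [I [v [W [_ dep WP vP vI]]]] := tangent_frame prZ (indep_vars0 prZ).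
have I0 : #|I| = 0%N.
  have [y Zy] : exists2 y, Z y & ev y (W * \det M) != 0.
    apply: van_witness => /(primeM prZ)[//|/(_ x Zx)/eqP].
    by rewrite (negPf Mx).
  rewrite rmorphM mulf_eq0 negb_or /= => /andP[Wy My].
  have [freeT tanT] := tangent_rank Zy Wy vP vI.
  move: freeT tanT; set T := \matrix_(k, i) _ => freeT tanT.
  have uM : map_mx (ev y) M \in unitmx by rewrite unitmxE det_map_mx unitfE.
  have T0 : T *m (map_mx (ev y) M)^T = 0.
    apply/matrixP => k i; rewrite !mxE -[RHS](tanT k (G i) (ZG i)).
    by apply: eq_bigr => j _; rewrite !mxE.
  have T00 : T = 0.
    by rewrite -[T](@mulmxK _ _ _ (map_mx (ev y) M)^T) ?unitmx_tr // T0 mul0mx.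
  by move: freeT; rewrite T00 /row_free mxrank0 => /eqP.
apply/seteqP; split=> [y Zy|_ ->//]; apply/rowP => i.
pose g := var i - mpolyC n (x 0 i).
suff /(_ y Zy) : van Z g.
  by rewrite rmorphB /= evX evC => /eqP; rewrite subr_eq0 => /eqP.
(* In transcendence degree zero the function [g] satisfies a one-variable relation; if [g] were
   nonzero on [Z], dividing by its powers would leave a nonzero constant term, contradicted at the
   zero [x] of [g]. *)
apply: contrapT => Zg; have [|rho rho0 Zrho] := dep 1%N (rcons_fun (fun _ : 'I_0 => 0) g).
  by rewrite I0.
have [r r0 [s /(_ x Zx)]] := last_relation prZ Zg rho0 Zrho.
rewrite rmorphD rmorphM /= [ev x g]rmorphB /= evX evC subrr mul0r addr0.
rewrite (nvar0_mpolyC r) msubstC evC => r00; case/eqP: r0.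
by rewrite (nvar0_mpolyC r) r00 mpolyC0.
Qed.

End Components.


(** * Generically reduced components of the system *)

Section ReducedComponent.
Variables (C : numClosedFieldType) (n N : nat) (F : 'I_n -> laurent C n).
Hypothesis FN : forall i a, a \in lsupp (F i) -> bounds N a.
Implicit Types (x : 'rV[C]_n) (Z : set 'rV[C]_n).
Local Notation V := (zeros (range F)).

Definition poly_sys i : pol n C := lpoly N (F i).

Definition poly_jac x : 'M[C]_n := \matrix_(i, j) ev x (mderiv j (poly_sys i)).

Lemma xall_neq0 x : torus x -> xall x != 0.
Proof. by move=> tx; apply/prodf_neq0 => i _; apply: tx. Qed.

Lemma zerosP x : V x <-> torus x /\ forall i, ev x (poly_sys i) = 0.
Proof.
split=> [[tx Fx]|[tx Fx]]; split=> //.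
  by move=> i; rewrite (ev_lpoly tx (FN (i := i))) Fx ?mulr0 //; exists i.
move=> _ [i _ <-]; have /eqP := Fx i; rewrite (ev_lpoly tx (FN (i := i))).
by rewrite mulf_eq0 expf_eq0 (negPf (xall_neq0 tx)) andbF => /eqP.
Qed.

Lemma poly_jacE x : V x -> poly_jac x = xall x ^+ N *: ljacobian F x.
Proof.
move=> [tx Fx]; apply/matrixP => i j; rewrite !mxE.
by rewrite (ev_mderiv_lpoly _ tx (FN (i := i))) //; apply: Fx; exists i.
Qed.

Lemma tangent_jac Z x r (T : 'M[C]_(r, n)) : Z `<=` V ->
  (forall k, tangent Z x (row k T)) -> T *m (poly_jac x)^T = 0.
Proof.
move=> ZV tT; apply/matrixP => k i; rewrite !mxE.
have Zi : van Z (poly_sys i) by move=> y /ZV/zerosP[].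
by rewrite -[RHS](tT k _ Zi); apply: eq_bigr => j _; rewrite !mxE.
Qed.

(** Chains bound the Krull dimension [d] by [#|I|]. Conversely the [#|I|] independent tangent
    vectors at a generic point lie in the kernel of the Jacobian, which has dimension [d] by
    reducedness. *)
Lemma component_frame Z : component V Z ->
    (forall d, has_zdim Z d -> generically_reduced F Z d) ->
  exists (I : {set 'I_n}) (v : 'I_#|I| -> 'I_n -> pol n C) W W0,
  [/\ [/\ forall k h, van Z h -> van Z (vfield (v k) h),
      forall k l, v k (enum_val l) = if k == l then W else 0 & ~ van Z W],
    ~ van Z W0,
    forall x, Z x -> ev x W0 != 0 -> \rank (kermx (poly_jac x)^T) = #|I| &
    has_zdim Z #|I|].
Proof.
move=> [irrZ ZV _] red; have prZ := zirr_prime irrZ.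
have [I [v [W [_ dep WP vP vI]]]] := tangent_frame prZ (indep_vars0 prZ).
have chain_le k : irr_chain Z k -> (k <= #|I|)%N.
  move=> /irr_chain_indep[g gP]; rewrite leqNgt; apply/negP => /(dep _ g)[rho + /gP r0].
  by rewrite r0 eqxx.
have [d dZ] : exists d, has_zdim Z d.
  pose P k := `[< irr_chain Z k >].
  have ex : exists k, P k.
    exists 0%N; apply/asboolP; exists (fun=> Z); split=> // i _; by split.
  have ub k : P k -> (k <= #|I|)%N by move/asboolP/chain_le.
  case: (ex_maxnP ex ub) => d /asboolP Pd dmax; exists d; split=> // Pd1.
  by have := dmax d.+1 (introT (asboolP _) Pd1); rewrite ltnn.
have [Y [cY ZY rkY]] := red d dZ.
have [x0 Zx0 nYx0] : exists2 x, Z x & ~ Y x.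
  by apply: contrapT => H; apply: ZY => x Zx; apply: contrapT => nY; apply: H; exists x.
have tZ x (Zx : Z x) : torus x := zclosed_torus (zirr_closed irrZ) Zx.
have [W0 YW0 W0x0] := zclosed_sep cY (tZ _ Zx0) nYx0.
have rk x : Z x -> ev x W0 != 0 -> \rank (kermx (poly_jac x)^T) = d.
  move=> Zx W0x; rewrite (poly_jacE (ZV x Zx)) mxrank_ker linearZ /=.
  rewrite (eqmx_scale _ (expf_neq0 N (xall_neq0 (tZ x Zx)))) -mxrank_ker.
  apply: rkY; split=> // Yx.
  by move: W0x; rewrite (YW0 x Yx) eqxx.
have W0P : ~ van Z W0 by move=> /(_ x0 Zx0)/eqP; rewrite (negPf W0x0).
have dI : d = #|I|.
  apply/eqP; rewrite eqn_leq chain_le /=; last by case: dZ.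
  have [x Zx] : exists2 x, Z x & ev x (W * W0) != 0.
    by apply: van_witness => /(primeM prZ)[].
  rewrite rmorphM mulf_eq0 negb_or /= => /andP[Wx W0x].
  have [freeT tanT] := tangent_rank Zx Wx vP vI.
  rewrite -(rk x Zx W0x) -{1}(eqP freeT); apply: mxrankS; apply/sub_kermxP.
  exact: (tangent_jac ZV tanT).
by exists I, v, W, W0; split=> // [x|]; rewrite -dI //; apply: rk.
Qed.

End ReducedComponent.


(** * Slices of one component and its square systems *)

Section Rows.
Variables (C : numClosedFieldType) (n d m : nat).
Hypothesis dn : (d <= n)%N.

Definition first_rows (c : 'M[C]_(n, m)) : 'M[C]_(d, m) :=
  \matrix_(i, k) c (widen_ord dn i) k.

Lemma generically_rows (Phi : 'rV[C]_(d * m) -> Prop) : generically Phi ->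
  generically (fun p : 'rV[C]_(n * m) => Phi (mxvec (first_rows (vec_mx p)))).
Proof.
move=> [rho rho0 rP].
pose f : 'I_(d * m) -> pol (n * m) C := fun l =>
  mxvec (\matrix_(i, k) (var (mxvec_index (widen_ord dn i) k) : pol (n * m) C)) 0 l.
have fE p : ev p (msubst f rho) = ev (mxvec (first_rows (vec_mx p))) rho.
  rewrite ev_msubst; congr (ev _ _); apply/rowP => l; rewrite mxE /f.
  by case/mxvec_indexP: l => i k; rewrite !mxvecE !mxE evX.
exists (msubst f rho) => [|p]; last by rewrite fE => /rP.
have [u] := ev_neq0 rho0; apply: contraNneq => r0.
pose c : 'M[C]_(n, m) := \matrix_(i, k)
  (if insub (i : nat) is Some i' then vec_mx u (i' : 'I_d) k else 0).
have <- : mxvec (first_rows c) = u.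
  rewrite -[RHS]vec_mxK; congr mxvec; apply/matrixP => i k; rewrite !mxE /=.
  by rewrite [insub _](valK i) mxE.
by rewrite -[c]mxvecK -fE r0 rmorph0.
Qed.

End Rows.

Section GenericComponent.
Variables (C : numClosedFieldType) (n m N : nat) (F : 'I_n -> laurent C n).
Variables (mono : 'I_m -> pol n C) (k0 : 'I_m).
Hypothesis ncC : ~ countable [set: C].
Hypothesis FN : forall i a, a \in lsupp (F i) -> bounds N a.
Hypothesis mono_k0 : forall x, torus x -> ev x (mono k0) != 0.
Hypothesis mono_span : forall x, torus x -> forall u : 'rV[C]_n,
  exists g : 'I_m -> C, \sum_k g k * ev x (mono k) = 0 /\
    forall j, \sum_k g k * ev x (mderiv j (mono k)) = u 0 j.

Variable Z : set 'rV[C]_n.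
Hypothesis irrZ : zirreducible Z.
Hypothesis ZV : Z `<=` zeros (range F).

Variables (I : {set 'I_n}) (vf : 'I_#|I| -> 'I_n -> pol n C) (W W0 : pol n C).
Hypothesis vfP : forall k h, van Z h -> van Z (vfield (vf k) h).
Hypothesis vfI : forall k l, vf k (enum_val l) = if k == l then W else 0.
Hypothesis WP : ~ van Z W.
Hypothesis W0P : ~ van Z W0.
Hypothesis rkZ : forall x, Z x -> ev x W0 != 0 ->
  \rank (kermx (poly_jac N F x)^T) = #|I|.

Local Notation Fp := (poly_sys N F).

Definition lin_form (c : 'M[C]_(n, m)) i : pol n C := \sum_k c i k *: mono k.
Definition mul_sys (U : 'M[C]_n) i : pol n C := \sum_k U i k *: Fp k.

(** On a component of dimension [d] these are local coordinates at the sample points. [U] is chosen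
    for the component and is unrelated to the matrix that defines the sample set. *)
Definition square_sys d (U : 'M[C]_n) c (i : 'I_n) : pol n C :=
  if (i < d)%N then lin_form c i else mul_sys U i.

Definition square_jac d U c : 'M[pol n C]_n :=
  \matrix_(i, j) mderiv j (square_sys d U c i).

Lemma ev_lin_form c i x : ev x (lin_form c i) = \sum_k c i k * ev x (mono k).
Proof. by rewrite raddf_sum; apply: eq_bigr => k _; rewrite /= evZ. Qed.

Lemma ev_mderiv_lin_form c i j x :
  ev x (mderiv j (lin_form c i)) = \sum_k c i k * ev x (mderiv j (mono k)).
Proof.
rewrite /lin_form [mderiv _ _]raddf_sum raddf_sum; apply: eq_bigr => k _ /=.
by rewrite mderivZ evZ.
Qed.

Lemma ev_mderiv_mul_sys U i j x :
  ev x (mderiv j (mul_sys U i)) = (U *m poly_jac N F x) i j.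
Proof.
rewrite /mul_sys [mderiv _ _]raddf_sum raddf_sum mxE; apply: eq_bigr => k _ /=.
by rewrite mderivZ evZ mxE.
Qed.

Lemma mul_sys_van U i : van Z (mul_sys U i).
Proof.
move=> x /ZV/(zerosP FN)[_ Fx]; rewrite raddf_sum big1 // => k _ /=.
by rewrite evZ Fx mulr0.
Qed.

Lemma tangent_rank_le x : Z x -> ev x W0 != 0 -> forall r (T : 'M[C]_(r, n)),
  (forall k, tangent Z x (row k T)) -> (\rank T <= #|I|)%N.
Proof.
move=> Zx W0x r T tT; rewrite -(rkZ Zx W0x); apply: mxrankS; apply/sub_kermxP.
exact: (tangent_jac FN ZV tT).
Qed.

Lemma dim_le : (#|I| <= n)%N.
Proof. by rewrite -[X in (_ <= X)%N]card_ord max_card. Qed.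

Definition inc_jac d U : pol (n + d * m) C :=
  \det (\matrix_(i < n, j < n)
    (if insub (i : nat) is Some i' then
       \sum_k @cvar C n d m i' k * lift_x d m (mderiv j (mono k))
     else lift_x d m (mderiv j (mul_sys U i)))).

Lemma ev_inc_jac d (dn : (d <= n)%N) U c x :
  ev (pt x (first_rows dn c)) (inc_jac d U) = ev x (\det (square_jac d U c)).
Proof.
rewrite -!det_map_mx; congr (\det _); apply/matrixP => i j; rewrite !mxE.
rewrite /square_sys; case: insubP => [i' id ii'|]; last first.
  by move/negPf->; rewrite /= ev_lift_x row_mxKl.
rewrite id /= ev_mderiv_lin_form rmorph_sum; apply: eq_bigr => k _.
rewrite rmorphM /= ev_cvar ev_lift_x row_mxKl mxE; congr (c _ _ * _).
exact: val_inj.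
Qed.

Lemma inc_jac_notin : exists U, ~ van (incidence Z mono) (inc_jac #|I| U).
Proof.
have [x Zx W0x] := van_witness W0P; have tx := zclosed_torus (zirr_closed irrZ) Zx.
pose J := poly_jac N F x; pose E := row_ebase J; pose L := col_ebase J.
have rkJ : \rank J = (n - #|I|)%N.
  by rewrite -(rkZ Zx W0x) mxrank_ker mxrank_tr subKn // rank_leq_row.
(* Reversing the rows puts the independent rows of the Jacobian, the first [n - #|I|] of the echelon
   basis [E], at the positions from [#|I|] on. The forms are chosen with the other rows of [E] as
   gradients, so the square Jacobian is [E] with its rows permuted. *)
pose U : 'M[C]_n := \matrix_(i, j) invmx L (rev_ord i) j.
have /choice[g gP] (i : 'I_n) := mono_span tx (row (rev_ord i) E).
pose c : 'M[C]_(n, m) := \matrix_(i, k) g i k.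
exists U => /(_ (pt x (first_rows dim_le c))).
have Xx : incidence Z mono (pt x (first_rows dim_le c)).
  apply/incidence_pt; split=> // i; rewrite -[RHS](gP (widen_ord dim_le i)).1.
  by apply: eq_bigr => k _; rewrite !mxE.
move=> /(_ Xx)/eqP; rewrite ev_inc_jac -det_map_mx.
set M := map_mx _ _; suff -> : M = row_perm (perm (@rev_ord_inj n)) E.
  by rewrite row_permE det_mulmx mulf_eq0 det_perm signr_eq0 /= -[_ == 0]negbK
    -unitfE -unitmxE row_ebase_unit.
apply/matrixP => i j; rewrite !mxE permE /square_sys; case: ltnP => id.
  rewrite /= ev_mderiv_lin_form; have := (gP i).2 j; rewrite mxE => <-.
  by apply: eq_bigr => k _; rewrite mxE.
rewrite /= ev_mderiv_mul_sys.
have -> : (U *m poly_jac N F x) i j = (invmx L *m J) (rev_ord i) j.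
  by rewrite !mxE; apply: eq_bigr => k _; rewrite mxE.
rewrite -[J]mulmx_ebase !mulmxA mulVmx ?col_ebase_unit // mul1mx mxE.
rewrite (bigD1 (rev_ord i)) //= big1 => [|k /negPf ki].
  rewrite mxE eqxx /= rkJ addr0.
  have -> : (n - i.+1 < n - #|I|)%N by have := ltn_ord i; lia.
  by rewrite mul1r.
by rewrite mxE eq_sym [_ == _]ki mul0r.
Qed.

(** At a generic point the Jacobian maps the tangent space into the span of the first [#|I|]
    coordinate vectors, as the remaining equations vanish on [Z], and onto it by rank. The [j]-th
    adjugate column maps to a multiple of the [j]-th such vector, so it is tangent there; primality
    extends this to all of [Z]. *)
Lemma adj_field U c x : Z x -> ev x (\det (square_jac #|I| U c)) != 0 ->
  forall (j : 'I_n), (j < #|I|)%N ->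
  forall h, van Z h -> van Z (vfield (fun b => (\adj (square_jac #|I| U c)) b j) h).
Proof.
set M := square_jac _ _ _ => Zx Mx j jd h Zh; have prZ := zirr_prime irrZ.
set v := fun b => _.
have [//|] : van Z (vfield v h) \/ van Z (W * \det M); last first.
  by case/(primeM prZ) => [//|/(_ x Zx)/eqP]; rewrite (negPf Mx).
apply: (primeM prZ) => y Zy; rewrite rmorphM /=; apply/eqP; rewrite mulf_eq0.
have [//|WMy] := eqVneq (ev y (W * \det M)) 0; first by rewrite orbT.
move: WMy; rewrite rmorphM mulf_eq0 negb_or /= => /andP[Wy My]; apply/orP; left.
have [freeT tanT] := tangent_rank Zy Wy vfP vfI.
move: freeT tanT; set T := \matrix_(k, i) _ => freeT tanT.
pose B := (map_mx (ev y) M)^T.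
have uB : B \in unitmx by rewrite unitmx_tr unitmxE det_map_mx unitfE.
pose w : 'rV[C]_n := \row_b ev y (v b).
have wB : w *m B = ev y (\det M) *: delta_mx 0 j.
  apply/rowP => i; rewrite !mxE eqxx /=.
  have := congr1 (ev y) (vfield_adj (square_sys #|I| U c) i j).
  rewrite /= ev_vfield => H; transitivity (ev y (if i == j then \det M else 0)).
    by rewrite -[RHS]H; apply: eq_bigr => b _; rewrite [w _ _]mxE [B _ _]mxE [map_mx _ _ _ _]mxE [M _ _]mxE.
  by case: eqP => _; rewrite ?mulr1 ?rmorph0 ?mulr0.
have TB : (T *m B <= (pid_mx #|I| : 'M[C]_n))%MS.
  apply/submxP; exists (T *m B); apply/matrixP => k i.
  rewrite [RHS]mxE (bigD1 i) //= big1 => [|l /negPf li].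
    rewrite [pid_mx _ _ _]mxE eqxx /= addr0; case: ltnP => id; first by rewrite mulr1.
    rewrite mulr0 mxE; apply: etrans (tanT k _ (mul_sys_van U i)).
    apply: eq_bigr => b _; rewrite [row _ _ _ _]mxE [B _ _]mxE [map_mx _ _ _ _]mxE.
    by rewrite [M _ _]mxE /square_sys ltnNge id.
  by rewrite [pid_mx _ _ _]mxE [_ == _]li mulr0.
have wT : (w <= T)%MS.
  rewrite -(submxMfree _ _ (_ : row_free B)) ?row_free_unit //.
  apply: submx_trans (_ : (w *m B <= (pid_mx #|I| : 'M[C]_n))%MS) _.
    rewrite wB; apply/scalemx_sub/submxP; exists (delta_mx 0 j).
    apply/rowP => i; rewrite -rowE !mxE eqxx /=.
    have [->|ij] := eqVneq i j; first by rewrite eqxx jd.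
    by rewrite [_ == _](_ : _ = false) // eq_sym; apply: negbTE.
  have [_ <-] := mxrank_leqif_sup TB.
  by rewrite mxrankMfree ?row_free_unit // (eqP freeT) rank_pid_mx ?dim_le.
case/submxP: wT => a wE; apply/eqP; rewrite ev_vfield.
transitivity (dir w y h); first by apply: eq_bigr => b _; rewrite mxE.
rewrite wE mulmx_sum_row dir_suml; apply: big1 => k _.
by rewrite dirZl [dir _ _ _](tanT k h Zh) mulr0.
Qed.

Definition on_slice (c : 'M[C]_(n, m)) d : set 'rV[C]_n :=
  [set x | forall i : 'I_n, (i < d)%N -> ev x (lin_form c i) = 0].

Lemma slice_first_rows d (dn : (d <= n)%N) c x :
  slice Z mono (first_rows dn c) x <-> Z x /\ on_slice c d x.
Proof.
split=> [[Zx lx]|[Zx lx]]; split=> //.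
  move=> i id; rewrite ev_lin_form -[RHS](lx (Ordinal id)).
  by apply: eq_bigr => k _; rewrite !mxE; congr (c _ _ * _); apply: val_inj.
move=> i; have := lx (widen_ord dn i) (ltn_ord i); rewrite ev_lin_form => <-.
by apply: eq_bigr => k _; rewrite !mxE.
Qed.

Lemma generic_component : exists U, forall d, (d <= n)%N ->
  generically (fun p : 'rV[C]_(n * m) => let c := vec_mx p in
  [/\ (#|I| < d)%N -> forall x, Z x -> ~ on_slice c d x,
    #|I| = d -> (exists2 x, Z x & on_slice c d x) /\
      forall x, Z x -> on_slice c d x -> ev x (\det (square_jac d U c)) != 0 &
    (d < #|I|)%N -> forall x w, Z x -> on_slice c d x -> ev x w != 0 ->
      ~ forall y, Z y -> on_slice c d y -> y <> x -> ev y w = 0]).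
Proof.
have [U UP] := inc_jac_notin; exists U => d dn.
case: (ltngtP #|I| d) => [Id|dI|Id].
- have := slice_empty ncC irrZ mono_k0 W0P tangent_rank_le Id.
  move/(generically_rows dn); apply: generically_impl => p /= emp.
  split=> [_ x Zx lx|dI|//]; last by move: Id; rewrite dI ltnn.
  apply: emp; exists x; rewrite mxvecK; exact/slice_first_rows.
- have := slice_not_isolated ncC irrZ mono_k0 mono_span vfP vfI WP dI.
  move/(generically_rows dn); apply: generically_impl => p /= iso.
  split=> [//|Id|_ x w Zx lx wx H]; first by move: dI; rewrite Id ltnn.
  apply: (iso x w) => //; rewrite mxvecK; first exact/slice_first_rows.
  by move=> y /slice_first_rows[]; apply: H.
- subst d; have Id : (#|I| <= #|I|)%N by [].
  have ne := slice_nonempty ncC irrZ mono_k0 mono_span vfP vfI WP Id.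
  have av := slice_avoid ncC irrZ mono_k0 W0P tangent_rank_le Id UP.
  have := generically_and ne av; move/(generically_rows dn).
  apply: generically_impl => p /=; rewrite !mxvecK => -[[x /slice_first_rows[Zx lx]] H].
  split; rewrite ?ltnn // => _; split; first by exists x.
  move=> y Zy ly; rewrite -(ev_inc_jac dn); apply: H; exact/slice_first_rows.
Qed.

End GenericComponent.


(** * Polynomials with support in a sumset *)

Section SumSupport.
Variables (C : numClosedFieldType) (n m : nat) (mexp : 'I_m -> mon n).
Implicit Types (p q : pol n C).

Definition ksum_supp K p := forall u : mon n, u \in msupp p ->
  exists2 s : seq 'I_m, size s = K & forall i, u i = (\sum_(k <- s) mexp k i)%N.

Lemma ksum_suppM K L p q :
  ksum_supp K p -> ksum_supp L q -> ksum_supp (K + L) (p * q).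
Proof.
move=> pK qL u /msuppM_le /allpairsP[[a b] /= [/pK[s sK sE] /qL[t tL tE] ->]].
exists (s ++ t); first by rewrite size_cat sK tL.
by move=> i; rewrite big_cat mnmDE sE tE.
Qed.

Lemma ksum_supp_sum K (I : eqType) (r : seq I) (P : pred I) (f : I -> pol n C) :
  (forall i, ksum_supp K (f i)) -> ksum_supp K (\sum_(i <- r | P i) f i).
Proof.
move=> fK u /msupp_sum_le /flattenP[s sA us]; case/mapP: sA us => j _ ->; exact: fK.
Qed.

Lemma ksum_suppZ K c p : ksum_supp K p -> ksum_supp K (c *: p).
Proof. by move=> pK u /msuppZ_le; apply: pK. Qed.

Lemma ksum_supp1 : ksum_supp 0 (1 : pol n C).
Proof.
by move=> u; rewrite msupp1 inE => /eqP->; exists [::] => // i; rewrite big_nil mnm0E.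
Qed.

Lemma ksum_suppX p k : ksum_supp 1 p -> ksum_supp k (p ^+ k).
Proof.
move=> p1; elim: k => [|k IHk]; first exact: ksum_supp1.
by rewrite exprS -add1n; apply: ksum_suppM.
Qed.

Lemma ksum_supp_prod (I : Type) (r : seq I) (f : I -> pol n C) (b : I -> nat) :
  (forall i, ksum_supp 1 (f i)) ->
  ksum_supp (\sum_(i <- r) b i) (\prod_(i <- r) f i ^+ b i).
Proof.
move=> f1; elim: r => [|i r IHr]; first by rewrite !big_nil; apply: ksum_supp1.
by rewrite !big_cons; apply: ksum_suppM => //; apply: ksum_suppX.
Qed.

Lemma ksum_supp_mon k : ksum_supp 1 (mpolyX C (mexp k)).
Proof.
by move=> u; rewrite msuppX inE => /eqP->; exists [:: k] => // i; rewrite big_seq1.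
Qed.

Definition ksum_mons K : seq (mon n) :=
  undup [seq Multinom [tuple (\sum_l mexp (tnth t l) i)%N | i < n] | t : K.-tuple 'I_m].

Lemma ksum_monsP K p : ksum_supp K p -> {subset msupp p <= ksum_mons K}.
Proof.
move=> pK u /pK[s sK sE]; rewrite mem_undup; have sz : size s == K by apply/eqP.
apply/mapP; exists (Tuple sz); first by rewrite mem_enum.
apply/mnmP => i; rewrite multinomE tnth_mktuple sE.
exact: (big_tuple _ _ (Tuple sz) xpredT (fun k => mexp k i : nat)).
Qed.

End SumSupport.

(** * Sample points of all dimensions and their number *)

Section GoodSlices.
Variables (C : numClosedFieldType) (n m N : nat) (F : 'I_n -> laurent C n).
Variables (mexp : 'I_m -> mon n) (k0 : 'I_m).
Hypothesis FN : forall i a, a \in lsupp (F i) -> bounds N a.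
Local Notation mono := (fun k => mpolyX C (mexp k)).
Local Notation V := (zeros (range F)).
Variable c : 'M[C]_(n, m).

Local Notation sjac d U := (square_jac N F mono d U c).
Local Notation on_sl d := (on_slice mono c d).

Definition good_slice Z e (U : 'M[C]_n) d :=
  [/\ (e < d)%N -> forall x, Z x -> ~ on_sl d x,
    e = d -> (exists2 x, Z x & on_sl d x) /\
      forall x, Z x -> on_sl d x -> ev x (\det (sjac d U)) != 0 &
    (d < e)%N -> forall x w, Z x -> on_sl d x -> ev x w != 0 ->
      ~ forall y, Z y -> on_sl d y -> y <> x -> ev y w = 0].

Definition good_fields Z e (U : 'M[C]_n) := forall x, Z x ->
  ev x (\det (sjac e U)) != 0 -> forall (j : 'I_n), (j < e)%N ->
  forall h, van Z h -> van Z (vfield (fun b => (\adj (sjac e U)) b j) h).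

Definition good_component Z e (U : 'M[C]_n) := [/\ has_zdim Z e, (e <= n)%N,
  forall d, (d <= n)%N -> good_slice Z e U d & good_fields Z e U].

Hypothesis good : forall Z, component V Z -> exists e U, good_component Z e U.

Definition slice_zeros d : set 'rV[C]_n := [set x | V x /\ on_sl d x].
Hypothesis slice_closed : forall d, zclosed (slice_zeros d).

Local Notation Wd d := (equidim_part (slice_zeros d) 0).

Lemma V_closed : zclosed V. Proof. by exists (range F). Qed.

Lemma sample_pt d x : Wd d x -> component (slice_zeros d) [set x] /\ slice_zeros d x.
Proof.
move=> [Z [cZ Z0 Zx]]; have [irrZ ZV _] := cZ; split; last exact: ZV.
by rewrite -(zdim0_pt irrZ Z0 Zx).
Qed.

(** Components of smaller dimension are missed by the slice, and on those of larger dimension no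
    point of the slice is isolated. *)
Lemma sample_sub d x Z : (d <= n)%N -> Wd d x -> component V Z -> Z x -> has_zdim Z d.
Proof.
move=> dn /sample_pt[cx [Vx lx]] cZ Zx; have [e [U [Ze en gd _]]] := good cZ.
have [g1 _ g3] := gd d dn; have [ed|de|<- //] := ltngtP e d.
  by case: (g1 ed x Zx).
have [w wx wP] := isolated_witness (slice_closed d) cx.
have [_ ZV _] := cZ.
by case: (g3 de x w Zx lx wx) => y Zy ly; apply: wP; split=> //; apply: ZV.
Qed.

(** The square system is nonsingular at [x] and vanishes on the component of the slice through [x],
    which is therefore a point by [nonsingular_zero]. *)
Lemma sample_sup d x Z : component V Z -> has_zdim Z d -> Z x -> on_sl d x -> Wd d x.
Proof.
move=> cZ Zd Zx lx; have [e [U [Ze en gd _]]] := good cZ.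
have ed := has_zdim_unique Ze Zd; subst e.
have [_ /(_ erefl)[_ /(_ x Zx lx) jx] _] := gd d en.
have [_ ZV _] := cZ; have VLx : slice_zeros d x by split=> //; apply: ZV.
have [Z' cZ' Z'x] := component_exists (slice_closed d) VLx.
have [irrZ' Z'V _] := cZ'.
have Z'E : Z' = [set x].
  apply: (nonsingular_zero irrZ' Z'x _ jx) => i.
  rewrite /square_sys; case: ifP => id y /Z'V[Vy ly]; first exact: ly.
  by apply: (mul_sys_van FN (Z := V)).
exists Z'; split=> //; rewrite Z'E; apply: pt_zdim0.
exact: (zclosed_torus V_closed (ZV x Zx)).
Qed.

Lemma sample_nonempty d Z : component V Z -> has_zdim Z d -> Wd d !=set0.
Proof.
move=> cZ Zd; have [e [U [Ze en gd _]]] := good cZ.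
have ed := has_zdim_unique Ze Zd; subst e.
have [_ /(_ erefl)[[x Zx lx] _] _] := gd d en.
by exists x; apply: sample_sup cZ Zd Zx lx.
Qed.

Lemma sample_finite d : exists s : seq 'rV[C]_n, uniq s /\ forall x, x \in s <-> Wd d x.
Proof.
have [k [Y [_ YP]]] := components_finite (slice_closed d).
have fin : finite_set (Wd d).
  have /choice[f fP] (i : 'I_k) : exists x : 'rV[C]_n, forall y, Y i = [set y] -> x = y.
    have [[y Yy]|no] := pselect (exists y, Y i = [set y]).
      by exists y => z; rewrite Yy => /seteqP[/(_ y erefl)].
    by exists 0 => y Yy; case: no; exists y.
  apply: (@sub_finite_set _ _ (f @` [set: 'I_k])); last exact: finite_image.
  by move=> x /sample_pt[/YP[j /esym Yj] _]; exists j => //; apply: fP.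
have [s sP] := (finite_seqP _).1 fin.
exists (undup s); rewrite undup_uniq; split=> // x; rewrite mem_undup sP /=.
by [].
Qed.

Lemma sample_disjoint d d' x : (d <= n)%N -> (d' <= n)%N -> Wd d x -> Wd d' x -> d = d'.
Proof.
move=> dn dn' Wx Wx'; have [_ [Vx _]] := sample_pt Wx.
have [Z cZ Zx] := component_exists V_closed Vx.
exact: has_zdim_unique (sample_sub dn Wx cZ Zx) (sample_sub dn' Wx' cZ Zx).
Qed.

Hypothesis mono_k0 : forall x : 'rV[C]_n, torus x -> ev x (mono k0) != 0.
Hypothesis sys_supp : forall i, ksum_supp mexp 1 (poly_sys N F i).
Hypothesis shift_supp : forall s : seq (pol n C), exists K (u : mon n),
  forall p, p \in s -> ksum_supp mexp K (p * mpolyX C u).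

Lemma uniq_flatten (ds : seq nat) (w : nat -> seq 'rV[C]_n) : uniq ds ->
    (forall d, d \in ds -> uniq (w d)) ->
    (forall d d' x, d \in ds -> d' \in ds -> x \in w d -> x \in w d' -> d = d') ->
  uniq (flatten [seq w d | d <- ds]).
Proof.
elim: ds => //= d ds IHds /andP[dds uds] uw dw.
rewrite cat_uniq uw ?mem_head //= IHds //; last 2 first.
- by move=> d' d'd; apply: uw; rewrite inE d'd orbT.
- by move=> d1 d2 x d1d d2d; apply: dw; rewrite inE ?d1d ?d2d orbT.
rewrite andbT; apply/hasPn => x /flatten_mapP[d' d'd xd']; apply/negP => xd.
by move: dds; rewrite (dw d d' x) ?d'd ?mem_head // inE d'd orbT.
Qed.

(** Applies [count_bound] to the points of all sample sets at once, each with a component through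
    it, whose dimension is the rank of its sample set. *)
Theorem sample_count (ds : seq nat) (w : nat -> seq 'rV[C]_n) : uniq ds ->
    (forall d, d \in ds -> [/\ (d <= n)%N, uniq (w d) & forall x, x \in w d <-> Wd d x]) ->
  exists K, forall k, ((\sum_(d <- ds) size (w d)) * 'C(n + k, n) <=
    size (ksum_mons mexp (K + k)))%N.
Proof.
move=> uds wP; pose pts := flatten [seq w d | d <- ds].
have upts : uniq pts.
  apply: uniq_flatten => // [d /wP[]//|d d' x /wP[dn _ wd] /wP[dn' _ wd'] /wd Wx /wd'].
  exact: sample_disjoint.
have spts : size pts = (\sum_(d <- ds) size (w d))%N.
  by rewrite size_flatten sumnE /shape -map_comp big_map.
pose Pt : finType := 'I_(size pts); pose x (p : Pt) := nth 0 pts p.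
have /choice[D DP] (p : Pt) : exists D : (nat * set 'rV[C]_n) * 'M[C]_n,
    [/\ good_component D.1.2 D.1.1 D.2, component V D.1.2, D.1.2 (x p) & Wd D.1.1 (x p)].
  have /flatten_mapP[d dds xw] : x p \in pts by apply: mem_nth.
  have [dn _ /(_ (x p))[/(_ xw) Wx _]] := wP d dds.
  have [_ [Vx _]] := sample_pt Wx; have [Z cZ Zx] := component_exists V_closed Vx.
  have Zd := sample_sub dn Wx cZ Zx; have [e [U gZ]] := good cZ.
  exists (d, Z, U); split=> //=; have [Ze _ _ _] := gZ.
  by rewrite (has_zdim_unique Zd Ze).
pose dd p := (D p).1.1; pose Z p := (D p).1.2; pose U p := (D p).2.
have ddn p : (dd p <= n)%N by case: (DP p) => -[].
have irrZ p : zirreducible (Z p) by case: (DP p) => _ [].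
have Vx p : V (x p) by case: (DP p) => _ _ _ /sample_pt[_ []].
have tx p : torus (x p) by apply: (zclosed_torus V_closed).
have xl p : on_sl (dd p) (x p) by case: (DP p) => _ _ _ /sample_pt[_ []].
have Zx p : Z p (x p) by case: (DP p).
(* For equal dimensions a coordinate separates the points. For different ones [x q] is off [Z p],
   since all components through it have dimension [dd q], so an element of the ideal of [Z p]
   separates them. *)
have sep p q : exists f, p != q ->
    [/\ dd p != dd q -> van (Z p) f, ev (x p) f = 0 & ev (x q) f != 0].
  have [_|pq] := eqVneq p q; first by exists 0.
  have [dpq|dpq] := eqVneq (dd p) (dd q).
    have [i xi] : exists i, x q 0 i - x p 0 i != 0.
      apply: contrapT => /forallNP H; have /eqP[] : x p != x q by rewrite nth_uniq.
      apply/rowP => i; have := H i; rewrite subr_eq0 => /negP; rewrite negbK => /eqP->.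
      by [].
    exists (var i - mpolyC n (x p 0 i)) => _; split=> //.
      by rewrite rmorphB /= evX evC subrr.
    by rewrite rmorphB /= evX evC.
  have nZ : ~ Z p (x q).
    move=> Zpq; case/eqP: dpq; have [gp cp _ _] := DP p; have [_ _ _ Wq] := DP q.
    by case: gp => Zd _ _ _; apply: has_zdim_unique Zd (sample_sub (ddn q) Wq cp Zpq).
  have [f fZ fx] := zclosed_sep (zirr_closed (irrZ p)) (tx q) nZ.
  by exists f => _; split=> //; apply: fZ.
have /choice[f0 f0P] (pq : Pt * Pt) := sep pq.1 pq.2.
pose f p q := f0 (p, q).
have fP p q : p != q -> [/\ dd p != dd q -> van (Z p) (f p q), ev (x p) (f p q) = 0 &
  ev (x q) (f p q) != 0] by apply: (f0P (p, q)).
pose e0 q := \prod_(p | p != q) f p q.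
have [K [u uP]] := shift_supp [seq e0 q | q : Pt].
exists K => k; rewrite -spts -[size pts]card_ord.
have Xu p : ev (x p) (mpolyX C u) != 0.
  by rewrite ev_mon; apply/prodf_neq0 => i _; apply: expf_neq0; apply: tx.
(* The monomial of [k0] pads each product to exactly [k] factors with exponents in the support;
   [mpolyX C u] moves those of the [e0 q] into a [K]-fold sumset. *)
apply: (@count_bound C n k Pt x dd (fun p => van (Z p)) (lin_form mono c)
  (fun p => mul_sys N F (U p)) (fun q => e0 q * mpolyX C u) (mono k0)).
- by move=> p h; apply.
- move=> p q i; apply: mul_sys_van => //; by have [_ [_ ZV _] _ _] := DP p.
- by move=> p i ip; apply: xl.
- move=> p; have [[_ _ gd _] _ _ _] := DP p.
  by have [_ /(_ erefl)[_ jx] _] := gd (dd p) (ddn p); exact: (jx _ (Zx p) (xl p)).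
- move=> p j jp h Zh; have [[_ _ gd fl] _ _ _] := DP p.
  have [_ /(_ erefl)[_ jx] _] := gd (dd p) (ddn p).
  exact: (fl (x p) (Zx p) (jx _ (Zx p) (xl p)) j jp h Zh).
- move=> p q dpq; have pq : p != q by apply: contraNneq dpq => ->.
  rewrite /e0 (bigD1 p) //= -mulrA; apply: (idealMr (van_ideal _)).
  by case: (fP p q pq) => /(_ dpq).
- move=> p q pq; rewrite /e0 (bigD1 p) //= !rmorphM /=.
  by case: (fP p q pq) => _ -> _; rewrite !mul0r.
- move=> p; rewrite rmorphM mulf_neq0 ?Xu //= rmorph_prod.
  by apply/prodf_neq0 => q qp; case: (fP q p qp).
- by move=> p; apply: mono_k0.
- move=> q b bk; apply: ksum_monsP.
  rewrite (_ : (K + k = K + mdeg b + (k - mdeg b))%N); last by rewrite -addnA subnKC.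
  apply: ksum_suppM; last by apply: ksum_suppX; apply: ksum_supp_mon.
  apply: ksum_suppM; first by apply: uP; apply: map_f; rewrite mem_enum.
  rewrite mdegE; apply: ksum_supp_prod => i; case: ifP => _.
    by apply: ksum_supp_sum => l; apply: ksum_suppZ; apply: ksum_supp_mon.
  by apply: ksum_supp_sum => l; apply: ksum_suppZ; apply: sys_supp.
Qed.

End GoodSlices.


(** * Monomials with exponents in the support *)

Lemma bounds_fset n (S : {fset 'rV[int]_n}) : exists N, forall a, a \in S -> bounds N a.
Proof.
exists (\sum_(a <- S) \sum_i absz (a 0%R i))%N => a aS i.
have : (absz (a 0%R i) <= \sum_(a <- S) \sum_i absz (a 0%R i))%N.
  by rewrite (big_rem a aS) /= (bigD1 i) //= -addnA leq_addr.
move: (\sum_(b <- S) _)%N (a 0 i) => K z; rewrite /bounds; case: z => z; lia.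
Qed.

Lemma lsupp_support_union (C : fieldType) n r (F : 'I_r -> laurent C n) i a :
  a \in lsupp (F i) -> a \in support_union F.
Proof. by move=> aF; rewrite /support_union (bigD1 i) //= inE aF. Qed.

Lemma sum_nseq (V : zmodType) (T : Type) (g : T -> V) t k :
  \sum_(j <- nseq t k) g j = g k *+ t.
Proof. by elim: t => [|t IHt]; rewrite ?big_nil // big_cons IHt mulrS. Qed.

Section LatticeMonomials.
Variables (C : numClosedFieldType) (n N : nat) (S : {fset 'rV[int]_n}).
Local Notation m := #|` S|.
Local Notation A := (exponent_matrix S).
Hypothesis SN : forall a, a \in S -> bounds N a.
Variables (B : 'M[int]_(m, n)) (k0 : 'I_m).
Hypothesis AB : A *m B = 1%:M.
Hypothesis Ak0 : col k0 A = 0.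

Definition mexp k : mon n := shift_mon N (col k A)^T.

Lemma col_bounds k : bounds N (col k A)^T.
Proof. by apply: SN; rewrite exponent_matrix_col mem_nth. Qed.

Lemma mexpE k i : (mexp k i : int) = A i k + N%:Z.
Proof. by rewrite shift_monE ?mxE //; apply: col_bounds. Qed.

Lemma ev_mexp k x : torus x ->
  ev x (mpolyX C (mexp k)) = xall x ^+ N * xpow x (col k A)^T.
Proof. by move=> tx; apply: ev_shift_mon => //; apply: col_bounds. Qed.

Lemma xpow_neq0 (x : 'rV[C]_n) a : torus x -> xpow x a != 0.
Proof. by move=> tx; apply/prodf_neq0 => i _; apply: expfz_neq0; apply: tx. Qed.

Lemma mexp_neq0 k x : torus x -> ev x (mpolyX C (mexp k)) != 0.
Proof.
by move=> tx; rewrite ev_mexp // mulf_neq0 ?expf_neq0 ?xall_neq0 ?xpow_neq0.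
Qed.

Lemma sectionE i j : \sum_k A i k * B k j = (i == j)%:R.
Proof. by have := congr1 (fun X : 'M[int]_n => X i j) AB; rewrite !mxE. Qed.

Lemma mexp_span x : torus x -> forall u : 'rV[C]_n, exists g : 'I_m -> C,
  \sum_k g k * ev x (mpolyX C (mexp k)) = 0 /\
  forall j, \sum_k g k * ev x (mderiv j (mpolyX C (mexp k))) = u 0 j.
Proof.
move=> tx u; pose mu k := ev x (mpolyX C (mexp k)).
have mu0 k : mu k != 0 by apply: mexp_neq0.
pose b k := \sum_i (B k i)%:~R * (u 0 i * x 0 i).
pose g k := b k - (k == k0)%:R * \sum_k b k.
have sg : \sum_k g k = 0.
  rewrite sumrB [X in _ - X](_ : _ = \sum_k b k) ?subrr //.
  rewrite (bigD1 k0) //= eqxx mul1r [X in _ + X]big1 ?addr0 // => k /negPf->.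
  by rewrite mul0r.
exists (fun k => g k / mu k); split=> [|j].
  by rewrite -[RHS]sg; apply: eq_bigr => k _; rewrite divfK.
transitivity ((x 0 j)^-1 * \sum_k g k * ((A j k)%:~R + N%:R)).
  rewrite mulr_sumr; apply: eq_bigr => k _.
  rewrite ev_mderiv_mon ?tx // -/(mu k).
  have -> : (mexp k j)%:R = (A j k)%:~R + N%:R :> C.
    by rewrite -[LHS]/((mexp k j : int)%:~R) mexpE rmorphD.
  by have := mu0 k; have := tx j => xj muk; field; rewrite xj.
have -> : \sum_k g k * ((A j k)%:~R + N%:R) = u 0 j * x 0 j; last first.
  by rewrite mulrC mulfK ?tx.
under eq_bigr => k _ do rewrite mulrDr.
rewrite big_split /= -mulr_suml sg mul0r addr0.
transitivity (\sum_k b k * (A j k)%:~R).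
  apply: eq_bigr => k _; rewrite /g mulrBl; have [->|_] := eqVneq k k0.
    have -> : A j k0 = 0 by have := congr1 (fun X : 'cV[int]_n => X j 0) Ak0; rewrite !mxE.
    by rewrite !mulr0 subr0.
  by rewrite !mul0r subr0.
transitivity (\sum_i (\sum_k A j k * B k i)%:~R * (u 0 i * x 0 i)).
  under eq_bigr => k _ do rewrite /b mulr_suml.
  rewrite exchange_big; apply: eq_bigr => i _ /=; rewrite rmorph_sum mulr_suml.
  by apply: eq_bigr => k _; rewrite rmorphM /=; ring.
rewrite (bigD1 j) //= sectionE eqxx mul1r big1 ?addr0 // => i ij.
by rewrite sectionE eq_sym (negPf ij) mul0r.
Qed.

(** By [A *m B = 1] an exponent is an integral combination of the columns. Adding [M] to every
    coefficient makes all of them nonnegative, at the cost of a fixed shift, and copies of the zero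
    column fill up to [K] summands. *)
Lemma mexp_shift (s : seq (pol n C)) : exists K (u : mon n),
  forall p, p \in s -> ksum_supp mexp K (p * mpolyX C u).
Proof.
pose L := flatten [seq (msupp p : seq (mon n)) | p <- s].
pose nk (v : mon n) k : int := \sum_i B k i * (v i)%:Z.
pose M := (\sum_(v <- L) \sum_k absz (nk v k))%N.
pose K := (m * (2 * M))%N.
pose sA i : int := \sum_k A i k.
have u0 i : 0 <= M%:Z * sA i + (K * N)%:Z.
  have : 0 <= \sum_k (M%:Z * (A i k + N%:Z)).
    apply: sumr_ge0 => k _; rewrite mulr_ge0 //; have := col_bounds k i.
    by rewrite !mxE.
  rewrite -mulr_sumr big_split /= -/(sA i) sumr_const card_ord.
  rewrite mulrDr -mulr_natr natz -!PoszM => h; apply: le_trans h _.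
  rewrite lerD2l lez_nat /K.
  have arith (a b d : nat) : (a * (b * d) <= d * (2 * a) * b)%N by nia.
  exact: arith.
(* Besides [M] times the sum of the columns, [u] contains the offset [K * N] of a sum of [K] shifted
   exponents. *)
pose u : mon n := Multinom [tuple absz (M%:Z * sA i + (K * N)%:Z) | i < n].
have uE i : (u i : int) = M%:Z * sA i + (K * N)%:Z.
  by rewrite multinomE tnth_mktuple gez0_abs.
exists K, u => p ps w /msuppM_le /allpairsP[[v v'] /= [vp]].
rewrite msuppX inE => /eqP-> ->.
have vL : v \in L by apply/flatten_mapP; exists p.
have nM k : (absz (nk v k) <= M)%N.
  by rewrite /M (big_rem v vL) /= (bigD1 k) //= -addnA leq_addr.
pose t k := absz (nk v k + M%:Z).
have tE k : (t k : int) = nk v k + M%:Z by rewrite /t; have := nM k; lia.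
have tM : (\sum_k t k <= K)%N.
  rewrite /K -[X in (X * _)%N]card_ord -sum_nat_const; apply: leq_sum => k _.
  by rewrite /t; have := nM k; lia.
pose r := flatten [seq nseq (t k) k | k <- index_enum 'I_m] ++ nseq (K - \sum_k t k) k0.
have size_r : size r = K.
  rewrite size_cat size_nseq size_flatten sumnE /shape -map_comp big_map.
  by under eq_bigr => k _ do rewrite /= size_nseq; rewrite subnKC.
exists r => // i; apply/eqP; rewrite -eqz_nat; apply/eqP.
rewrite mnmDE PoszD uE (big_morph Posz PoszD erefl).
under [RHS]eq_bigr => k _ do rewrite mexpE.
rewrite big_split /= big_const_seq count_predT size_r iter_addr_0.
rewrite big_cat big_flatten big_map /= sum_nseq.
have -> : A i k0 = 0 by have := congr1 (fun X : 'cV[int]_n => X i 0) Ak0; rewrite !mxE.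
rewrite mul0rn addr0.
transitivity (\sum_k A i k * (nk v k + M%:Z) + (N%:Z *+ K)); last first.
  congr (_ + _); apply: eq_bigr => k _.
  by rewrite sum_nseq -tE -mulr_natr natz.
rewrite -mulr_natr natz -PoszM [(N * K)%N]mulnC addrA; congr (_ + _).
under eq_bigr => k _ do rewrite mulrDr.
rewrite big_split /= -mulr_suml -/(sA i) [M%:Z * _]mulrC; congr (_ + _).
under eq_bigr => k _ do rewrite /nk mulr_sumr.
rewrite exchange_big (bigD1 i) //= [X in _ + X]big1 => [|j ij].
  under eq_bigr => k _ do rewrite mulrA.
  by rewrite -mulr_suml sectionE eqxx mul1r addr0.
under eq_bigr => k _ do rewrite mulrA.
by rewrite -mulr_suml sectionE eq_sym (negPf ij) mul0r.
Qed.

Lemma size_ksum_mons K : (size (ksum_mons mexp K) <= size (ksums S K))%N.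
Proof.
pose phi (a : 'rV[int]_n) : mon n := shift_mon (K * N) a.
rewrite -(size_map phi); apply: uniq_leq_size; first exact: undup_uniq.
move=> v; rewrite mem_undup => /mapP[t _ ->].
pose f : {ffun 'I_K -> 'I_m} := [ffun l => tnth t l].
apply/mapP; exists (\sum_l (col (f l) A)^T).
  by rewrite mem_undup; apply: map_f; rewrite mem_enum.
apply/mnmP => i; rewrite multinomE tnth_mktuple /phi; apply/eqP; rewrite -eqz_nat.
have fE : (\sum_l (col (f l) A)^T) 0 i + (K * N)%:Z = \sum_l (mexp (tnth t l) i)%:Z.
  rewrite summxE; under [RHS]eq_bigr => l _ do rewrite mexpE.
  rewrite big_split /= sumr_const card_ord -mulr_natr natz -PoszM mulnC.
  by congr (_ + _); apply: eq_bigr => l _; rewrite !mxE ffunE.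
rewrite multinomE tnth_mktuple fE gez0_abs ?sumr_ge0 //.
by rewrite (big_morph Posz PoszD erefl).
Qed.

End LatticeMonomials.


(** * Generic choices and the final assembly *)

(** Countable sets of reals have Lebesgue measure zero, the line does not. *)
Lemma complex_uncountable (R : realType) : ~ countable [set: R[i]].
Proof.
move=> /countable_injP[f finj]; have cR : countable [set: R].
  apply/countable_injP; exists (fun r => f (r%:C)%C) => r s _ _.
  by move/finj => /(_ (mem_set I) (mem_set I)) [].
have := countable_lebesgue_measure0 cR.
have := @lebesgue_measure_itv R `]-oo, +oo[; rewrite set_itvE /= => ->.
by [].
Qed.

Lemma card_set_seq (T : choiceType) (s : seq T) (A : set T) :
  uniq s -> (forall x, x \in s <-> A x) -> (A #= `I_(size s))%card.
Proof.
move=> us sA; have -> : A = [set` [fset x in s]%fset].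
  by apply/seteqP; split=> x /=; rewrite inE /= => /sA.
by apply/card_eq_fsetP; rewrite card_fseq undup_id.
Qed.

Lemma generically_all (C : numClosedFieldType) q (T : finType) (Phi : T -> 'rV[C]_q -> Prop) :
  (forall i, generically (Phi i)) -> generically (fun c => forall i, Phi i c).
Proof.
move=> gP; have /choice[r rE] (i : T) : exists r : pol q C,
    r != 0 /\ forall c, ev c r != 0 -> Phi i c by case: (gP i) => r r0 rp; exists r.
exists (\prod_i r i) => [|c]; first by apply/prodf_neq0 => i _; case: (rE i).
rewrite rmorph_prod => /prodf_neq0 /= rc i; exact: (rE i).2 (rc i isT).
Qed.

Section Assembly.
Variables (C : numClosedFieldType) (n : nat) (F : 'I_n -> laurent C n).
Local Notation S := (support_union F).
Local Notation m := #|` S|.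
Local Notation A := (exponent_matrix S).
Local Notation V := (zeros (range F)).
Variables (N : nat) (B : 'M[int]_(m, n)) (k0 : 'I_m).
Hypothesis ncC : ~ countable [set: C].
Hypothesis SN : forall a, a \in S -> bounds N a.
Hypothesis AB : A *m B = 1%:M.
Hypothesis Ak0 : col k0 A = 0.
Hypothesis reduced_F : forall Z d, component V Z -> has_zdim Z d ->
  generically_reduced F Z d.

Local Notation mx := (@mexp n N S).

Lemma supp_bounds i a : a \in lsupp (F i) -> bounds N a.
Proof. by move/lsupp_support_union; apply: SN. Qed.

Lemma sys_ksum_supp i : ksum_supp mx 1 (poly_sys N F i).
Proof.
move=> u; rewrite /poly_sys /lpoly => /msupp_sum_le /flattenP[s /mapP[a]].
rewrite mem_filter => /andP[_ aF] -> /msuppZ_le; rewrite msuppX inE => /eqP->.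
have aS := lsupp_support_union aF.
have am : (index a S < m)%N by rewrite index_mem.
exists [:: Ordinal am] => // j; rewrite big_seq1 /mexp exponent_matrix_col.
by rewrite /= nth_index.
Qed.

(** Invertible combinations have the same common zeros, and the shift by [N] multiplies each form by
    a factor that does not vanish on the torus. *)
Lemma zeros_sliced (M : 'M[C]_n) (c : 'M[C]_(n, m)) d : M \in unitmx ->
  zeros (sliced_system A F M c d) = slice_zeros F mx c d.
Proof.
move=> uM.
have lE x k : torus x -> (ev x (lin_form (fun k => mpolyX C (mx k)) c k) = 0) <->
    leval (lin_system A c k) x = 0.
  move=> tx; rewrite ev_lin_form leval_lin_system.
  have -> : \sum_j c k j * ev x (mpolyX C (mx j)) =
      xall x ^+ N * \sum_j c k j * xpow x (col j A)^T.
    by rewrite mulr_sumr; apply: eq_bigr => j _; rewrite ev_mexp // mulrCA.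
  split=> [/eqP|->]; last by rewrite mulr0.
  by rewrite mulf_eq0 expf_eq0 (negPf (xall_neq0 tx)) andbF => /eqP.
apply/seteqP; split=> x.
  move=> [tx Gx]; split.
    split=> // _ [i _ <-].
    pose v : 'cV[C]_n := \col_j leval (F j) x.
    have Mv : M *m v = 0.
      apply/colP => j; rewrite !mxE -[RHS](Gx (mul_system M F j)).
        by rewrite leval_mul_system; apply: eq_bigr => l _; rewrite mxE.
      by left; exists j.
    have /colP/(_ i) : v = 0 by rewrite -(mulKmx uM v) Mv mulmx0.
    by rewrite !mxE.
  by move=> k kd; apply/lE => //; apply: Gx; right; exists k.
move=> [[tx Fx] lx]; split=> // _ [[i _ <-]|[k kd <-]].
  by rewrite leval_mul_system big1 // => j _; rewrite Fx ?mulr0 //; exists j.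
by apply/lE => //; apply: lx.
Qed.

Lemma slice_zeros_closed c d : zclosed (slice_zeros F mx c d).
Proof. by rewrite -(@zeros_sliced 1%:M) ?unitmx1 //; eexists. Qed.

(** Components and values of [d] are finitely many, so one polynomial in [c] serves them all; each
    [U] is fixed by its component before [c] is chosen. *)
Lemma good_generic : generically (fun p : 'rV[C]_(n * m) =>
  forall Z, component V Z -> exists e U, good_component N F mx (vec_mx p) Z e U).
Proof.
have [k [Y [irrY YP]]] := components_finite (V_closed F).
have /choice[D DP] (i : 'I_k) : exists D : nat * 'M[C]_n, component V (Y i) ->
    [/\ has_zdim (Y i) D.1, (D.1 <= n)%N,
      forall c, good_fields N F mx c (Y i) D.1 D.2 &
      forall d, (d <= n)%N -> generically (fun p : 'rV[C]_(n * m) =>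
        good_slice N F mx (vec_mx p) (Y i) D.1 D.2 d)].
  have [cY|nc] := pselect (component V (Y i)); last by exists (0%N, 0).
  have [I [v [W [W0 [[vP vI WP] W0P rk Yd]]]]] :=
    component_frame supp_bounds cY (fun d => reduced_F cY).
  have [_ YV _] := cY.
  have [U UP] := generic_component ncC supp_bounds (fun x => mexp_neq0 SN k0 (x := x))
    (mexp_span SN AB Ak0) (irrY i) YV vP vI WP W0P rk.
  exists (#|I|, U) => _; split=> //; first exact: dim_le.
  by move=> c x Yx jx; apply: (adj_field supp_bounds (irrY i) YV vP vI WP Yx jx).
have gen : generically (fun p : 'rV[C]_(n * m) => forall l : 'I_k * 'I_n.+1,
    component V (Y l.1) ->
    good_slice N F mx (vec_mx p) (Y l.1) (D l.1).1 (D l.1).2 l.2).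
  apply: generically_all => -[i d] /=.
  have [cY|nc] := pselect (component V (Y i)); last exact: generically_true.
  have [_ _ _ /(_ d (ltn_ord d))] := DP i cY.
  exact: generically_impl.
apply: generically_impl gen => p gp Z cZ; have [i Zi] := YP Z cZ; subst Z.
have [Yd Yn Yf _] := DP i cZ; exists (D i).1, (D i).2; split=> // d dn.
by have := gp (i, Ordinal (dn : (d < n.+1)%N)); apply.
Qed.

Lemma sample_bound (M : 'M[C]_n) (c : 'M[C]_(n, m)) (ds : seq nat) :
    M \in unitmx ->
    (forall Z, component V Z -> exists e U, good_component N F mx c Z e U) ->
    uniq ds -> (forall d, d \in ds <-> equidim_part V d !=set0) ->
  exists j : nat -> nat, [/\ forall d, d \in ds -> (sample_set A F M c d #= `I_(j d))%card,
    forall d, d \in ds -> (0 < j d)%N &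
    exists K, forall k, ((\sum_(d <- ds) j d) * 'C(n + k, n) <= size (ksums S (K + k)))%N].
Proof.
move=> uM good uds dsP; have closed := slice_zeros_closed c.
have sE d : sample_set A F M c d = equidim_part (slice_zeros F mx c d) 0.
  by rewrite /sample_set /isolated_zeros zeros_sliced.
have /choice[w wP] d := sample_finite closed d.
have comp d : d \in ds -> exists2 Z, component V Z & has_zdim Z d.
  by move=> /dsP[x [Z [cZ Zd _]]]; exists Z.
exists (fun d => size (w d)); split=> [d dd|d dd|].
- by rewrite sE; apply: card_set_seq; [case: (wP d)|case: (wP d)].
- have [Z cZ Zd] := comp d dd.
  have [x Wx] := sample_nonempty supp_bounds good closed cZ Zd.
  by have /(wP d).2 := Wx; case: (w d).
have [|K KP] := sample_count supp_bounds good closed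
    (fun x => mexp_neq0 SN k0 (x := x)) sys_ksum_supp (mexp_shift SN AB Ak0) (w := w) uds.
  move=> d dd; have [Z cZ Zd] := comp d dd; have [e [U [Ze en _ _]]] := good Z cZ.
  by split; [rewrite (has_zdim_unique Zd Ze)|case: (wP d)|case: (wP d)].
by exists K => k; apply: leq_trans (KP k) _; apply: size_ksum_mons.
Qed.

End Assembly.


Lemma generic_of_generically (C : numClosedFieldType) q (P : 'rV[C]_q -> Prop) :
  generically P -> generic P.
Proof.
move=> [g g0 gP]; exists [set p | ev p g != 0]; split=> //.
  exists [set g]; apply/seteqP; split=> [p gp|p [_ -> //]]; by exists g.
by have [p gp] := ev_neq0 g0; exists p.
Qed.

Lemma generically_unit (C : numClosedFieldType) n q (P : 'rV[C]_q -> Prop) :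
  generically P -> generically (fun p : 'rV[C]_(n * n + q) =>
    (vec_mx (lsubmx p) : 'M[C]_n) \in unitmx /\ P (rsubmx p)).
Proof.
move=> [g g0 gP].
pose D : 'M[pol (n * n + q) C]_n := \matrix_(i, j) var (lshift q (mxvec_index i j)).
pose h : pol (n * n + q) C := msubst (fun l => var (rshift _ l)) g.
have DE p : ev p (\det D) = \det (vec_mx (lsubmx p)).
  by rewrite -det_map_mx; congr (\det _); apply/matrixP => i j; rewrite !mxE /= evX.
have hE p : ev p h = ev (rsubmx p) g.
  by rewrite ev_msubst; congr (ev _ _); apply/rowP => l; rewrite !mxE evX.
exists (\det D * h).
  have [u gu] := ev_neq0 g0; apply: contraNneq gu => Dh.
  have := congr1 (ev (row_mx (mxvec (1%:M : 'M[C]_n)) u)) Dh.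
  rewrite rmorphM rmorph0 /= DE hE row_mxKl row_mxKr mxvecK det1 mul1r => ->.
  by rewrite eqxx.
move=> p; rewrite rmorphM mulf_eq0 negb_or /= DE hE => /andP[Dp /gP gp].
by split=> //; rewrite unitmxE unitfE.
Qed.

Theorem proposition5p2 (R : realType) (n : nat) (F : 'I_n -> laurent R[i] n)
    (ds : seq nat)
    (standard_S : standard_form (exponent_matrix (support_union F)))
    (reduced_F : forall (Z : set 'rV[R[i]]_n) (d : nat),
       component (zeros (range F)) Z -> has_zdim Z d ->
       generically_reduced F Z d)
    (uniq_ds : uniq ds)
    (dsP : forall d : nat,
       d \in ds <-> equidim_part (zeros (range F)) d !=set0) :
  let S := support_union F in
  let A := exponent_matrix S in
  let bound (M : 'M[R[i]]_n) (c : 'M[R[i]]_(n, #|` S|)) :=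
    exists j : nat -> nat,
      [/\ forall d, d \in ds -> (sample_set A F M c d #= `I_(j d))%card,
          forall d, d \in ds -> (0 < j d)%N &
          (((\sum_(d <- ds) j d)%N%:R : R)%:E
             <= ((n`!)%:R : R)%:E * vol (convhull R S))%E] in
  generic_mx2 bound /\
  ((forall i, lsupp (F i) = S) -> generic_mx (bound 1%:M)).
Proof.
move=> S A bound.
have [B AB] := standard_form_section standard_S; have [_ [k0 Ak0] _ _] := standard_S.
have [N SN] := bounds_fset S.
have good := good_generic (@complex_uncountable R) SN AB Ak0 reduced_F.
have boundP (M : 'M[R[i]]_n) (c : 'M[R[i]]_(n, #|` S|)) : M \in unitmx ->
    (forall Z, component (zeros (range F)) Z ->
      exists e U, good_component N F (@mexp n N S) c Z e U) -> bound M c.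
  move=> uM gc.
  have [j [j1 j2 [K jK]]] := sample_bound SN AB Ak0 uM gc uniq_ds dsP.
  exists j; split=> //; have [c0 c0P] := vol_ksums R AB Ak0.
  apply: (volume_limit (c := K + c0) jK) => k; have := c0P (K + k)%N.
  by rewrite (_ : (K + k + c0 = k + (K + c0))%N) //; lia.
split=> [|_]; apply: generic_of_generically.
  apply: generically_impl (generically_unit n good) => p [uM gp].
  exact: boundP.
by apply: generically_impl good => p; apply: boundP; apply: unitmx1.
Qed.
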